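(* Let $d \in \mathbb N \cup \{\infty\}$ and let $\mathcal H$ be a reproducing kernel Hilbert space of analytic functions on $\mathbb B_d$ with kernel $K$, normalized at $0$. The following are equivalent: (i) $\mathcal H$ is an irreducible complete Nevanlinna-Pick space and every $\varphi \in \operatorname{Aut}(\mathbb B_d)$ induces an isometric composition operator $\psi \mapsto \psi\circ\varphi$ on $\operatorname{Mult}(\mathcal H)$. (ii) There exists $\alpha \in (0,1]$ such that $$K(z,w) = \frac{1}{(1-\langle z,w\rangle)^\alpha} \quad (z,w \in \mathbb B_d).$$
   Context: $\mathbb B_d$ is the open unit ball of $\mathbb C^d$, where $\mathbb C^\infty$ is understood to be $\ell^2$; $\operatorname{Aut}(\mathbb B_d)$ is the group of conformal automorphisms (biholomorphic self-maps) of $\mathbb B_d$. Powers are defined by the principal branch. Reproducing kernel Hilbert spaces are separable complex Hilbert spaces of functions on a set. For such a space on $X$ with kernel $K$, $\operatorname{Mult}(\mathcal H)$ is the algebra of all $\psi : X \to \mathbb C$ with $\psi f \in \mathcal H$ for all $f \in \mathcal H$, with norm $\|\psi\|=\|M_\psi\|$, $M_\psi f=\psi f$. $K$ is normalized at $x_0$ if $K(x,x_0)=1$ for all $x$. $\mathcal H$ is irreducible if $K(x,y) \ne 0$ for all $x,y\in X$ and $K(\cdot,x),K(\cdot,y)$ are linearly independent for $x\neq y$. $\mathcal H$ is a complete Nevanlinna-Pick space if for all $n,r \ge 1$, $z_1,\dots,z_n\in X$ and $\Lambda_1,\dots,\Lambda_n \in M_r(\mathbb C)$ such that the block matrix $\big(K(z_i,z_j)(1-\Lambda_i\Lambda_j^*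 )\big)_{i,j}$ is positive semidefinite, there is $\Phi \in M_r(\operatorname{Mult}(\mathcal H))$ of norm at most $1$ (as an operator on $\mathcal H\otimes\mathbb C^r$) with $\Phi(z_i)=\Lambda_i$ for all $i$. *)

(* Defs.v *)
From HB Require Import structures.
From mathcomp Require Import all_boot all_order all_algebra.
From mathcomp Require Import all_classical all_reals all_analysis.
From mathcomp Require Import complex.

Set Implicit Arguments.
Unset Strict Implicit.
Unset Printing Implicit Defensive.

Import Order.TTheory GRing.Theory Num.Theory.
Import numFieldNormedType.Exports.
Import Normc.

Local Open Scope classical_set_scope.
Local Open Scope ring_scope.
Local Open Scope complex_scope.
Local Open Scope sesquilinear_scope.

(* [R[i]] with its usual topology, as a normed space over itself. *)
HB.instance Definition _ (R : realType) := NormedModule.copy R[i] R[i]^o.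

(* [d : option nat]: [Some n] stands for the dimension n, [None] for oo. *)
Definition is_coordinate (d : option nat) (n : nat) : bool :=
  if d is Some m then (n < m)%N else true.

Section Ell2.
Variables (R : realType) (d : option nat).
Implicit Types x y : nat -> R[i].

(* C^d is realized inside l^2(nat) as the square-summable sequences that
   vanish from index d on; for finite d summability is automatic. *)
Definition sqnorm_series x : R^nat := series (fun n => normc (x n) ^+ 2).

Definition ell2_pred : {pred nat -> R[i]} :=
  [pred x | `[< cvgn (sqnorm_series x) /\
               forall n, ~~ is_coordinate d n -> x n = 0 >] ].

Lemma sqnorm_seriesS x n :
  sqnorm_series x n.+1 = sqnorm_series x n + normc (x n) ^+ 2.
Proof. by rewrite /sqnorm_series !seriesEnat /= big_nat_recr. Qed.

Lemma sqnorm_series0 x : sqnorm_series x 0 = 0.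
Proof. by rewrite /sqnorm_series seriesEnat /= big_geq. Qed.

Lemma sqnorm_series_ge0 x n : 0 <= sqnorm_series x n.
Proof.
by elim: n => [|n IH]; rewrite ?sqnorm_series0 ?sqnorm_seriesS ?addr_ge0 ?sqr_ge0.
Qed.

Lemma nd_sqnorm_series x : nondecreasing_seq (sqnorm_series x).
Proof. by apply/nondecreasing_seqP => n; rewrite sqnorm_seriesS lerDl sqr_ge0. Qed.

Lemma normc_ge0 (z : R[i]) : 0 <= normc z.
Proof. by case: z => a b; rewrite /normc sqrtr_ge0. Qed.

Lemma minkowski2 (a b c e : R) :
  Num.sqrt ((a + c) ^+ 2 + (b + e) ^+ 2) <=
  Num.sqrt (a ^+ 2 + b ^+ 2) + Num.sqrt (c ^+ 2 + e ^+ 2).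
Proof. exact: (le_normcD (a +i* b) (c +i* e)). Qed.

Lemma sqrt_sqnorm_seriesD x y n :
  Num.sqrt (sqnorm_series (x + y) n) <=
  Num.sqrt (sqnorm_series x n) + Num.sqrt (sqnorm_series y n).
Proof.
elim: n => [|n IH]; first by rewrite !sqnorm_series0 sqrtr0 addr0.
rewrite !sqnorm_seriesS.
set A := sqnorm_series (x + y) n; set B := sqnorm_series x n.
set C := sqnorm_series y n.
have -> : B = Num.sqrt B ^+ 2 by rewrite sqr_sqrtr ?sqnorm_series_ge0.
have -> : C = Num.sqrt C ^+ 2 by rewrite sqr_sqrtr ?sqnorm_series_ge0.
apply: le_trans (minkowski2 _ _ _ _).
rewrite ler_wsqrtr// lerD//.
  rewrite -[leLHS]sqr_sqrtr ?sqnorm_series_ge0//.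
  by rewrite ler_sqr ?nnegrE ?addr_ge0 ?sqrtr_ge0.
by rewrite ler_sqr ?nnegrE ?addr_ge0 ?normc_ge0// le_normcD.
Qed.

Lemma le_sqnorm_lim x n : cvgn (sqnorm_series x) ->
  sqnorm_series x n <= limn (sqnorm_series x).
Proof. by move=> cx; apply: nondecreasing_cvgn_le (nd_sqnorm_series x) cx n. Qed.

Lemma sqnorm_seriesD_le x y n :
  cvgn (sqnorm_series x) -> cvgn (sqnorm_series y) ->
  sqnorm_series (x + y) n <=
  (Num.sqrt (limn (sqnorm_series x)) + Num.sqrt (limn (sqnorm_series y))) ^+ 2.
Proof.
move=> cx cy; rewrite -[leLHS]sqr_sqrtr ?sqnorm_series_ge0//.
rewrite ler_sqr ?nnegrE ?addr_ge0 ?sqrtr_ge0//.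
apply: le_trans (sqrt_sqnorm_seriesD _ _ _) _.
by rewrite lerD// ler_wsqrtr// le_sqnorm_lim.
Qed.

Lemma cvg_sqnorm_seriesD x y :
  cvgn (sqnorm_series x) -> cvgn (sqnorm_series y) ->
  cvgn (sqnorm_series (x + y)).
Proof.
move=> cx cy; apply: nondecreasing_is_cvgn; first exact: nd_sqnorm_series.
by eexists => _ [n _ <-]; exact: sqnorm_seriesD_le.
Qed.

Lemma sqnorm_seriesZ (a : R[i]) x :
  sqnorm_series (a *: x) = normc a ^+ 2 *: sqnorm_series x.
Proof.
apply/funext => n; rewrite [RHS]/GRing.scale/=.
elim: n => [|n IH]; first by rewrite !sqnorm_series0 scaler0.
by rewrite !sqnorm_seriesS IH scalerDr normcM exprMn.
Qed.

Lemma ell2_submod_closed : submod_closed ell2_pred.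
Proof.
split=> [|a x y].
  apply/asboolP; split=> //.
  rewrite (_ : sqnorm_series 0 = cst 0); first exact: is_cvg_cst.
  apply/funext => n; elim: n => [|n IH]; first by rewrite sqnorm_series0.
  by rewrite sqnorm_seriesS IH normc0 expr0n /= addr0.
move=> /asboolP[cx x0] /asboolP[cy y0]; apply/asboolP; split=> [|n dn].
  apply: cvg_sqnorm_seriesD => //.
  by rewrite sqnorm_seriesZ; apply: is_cvgZr.
by rewrite /= [LHS]/GRing.add/= [X in X + _]/GRing.scale/= x0// y0// scaler0 addr0.
Qed.

HB.instance Definition _ :=
  GRing.isSubmodClosed.Build _ _ ell2_pred ell2_submod_closed.

Record ell2 := Ell2 { coord :> nat -> R[i]; coordP : coord \in ell2_pred }.

HB.instance Definition _ := [isSub for coord].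
HB.instance Definition _ := [Choice of ell2 by <:].
HB.instance Definition _ := [SubChoice_isSubLmodule of ell2 by <:].

Definition ell2_norm (x : ell2) : R[i] :=
  (Num.sqrt (limn (sqnorm_series x)))%:C.

Lemma cvg_ell2 (x : ell2) : cvgn (sqnorm_series x).
Proof. by have /asboolP[] := coordP x. Qed.

Lemma ler_ell2_normD (x y : ell2) :
  ell2_norm (x + y) <= ell2_norm x + ell2_norm y.
Proof.
rewrite /ell2_norm -rmorphD lecR.
rewrite -[leRHS]ger0_norm ?addr_ge0 ?sqrtr_ge0// -sqrtr_sqr ler_wsqrtr//.
apply: limr_le; first exact: cvg_ell2.
by apply: nearW => n; apply: sqnorm_seriesD_le; exact: cvg_ell2.
Qed.

Lemma ell2_normZ (a : R[i]) (x : ell2) :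
  ell2_norm (a *: x) = `|a| * ell2_norm x.
Proof.
rewrite /ell2_norm /= sqnorm_seriesZ limZr; last exact: cvg_ell2.
by rewrite sqrtrM ?sqr_ge0// sqrtr_sqr ger0_norm ?normc_ge0// rmorphM.
Qed.

Lemma ell2_norm0_eq0 (x : ell2) : ell2_norm x = 0 -> x = 0.
Proof.
move=> /eqP; rewrite /ell2_norm fmorph_eq0 sqrtr_eq0 => l0.
apply/val_inj/funext => n /=; apply/eq0_normc/eqP.
rewrite -sqrf_eq0 eq_le sqr_ge0 andbT.
apply: le_trans _ l0; apply: le_trans _ (@le_sqnorm_lim x n.+1 (@cvg_ell2 x)).
by rewrite sqnorm_seriesS lerDr sqnorm_series_ge0.
Qed.

HB.instance Definition _ :=
  Lmodule_isNormed.Build R[i] ell2 ler_ell2_normD ell2_normZ ell2_norm0_eq0.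

(* Linear in the first variable. *)
Definition inner (x y : ell2) : R[i] :=
  limn (series (fun n => x n * (y n)^*)).

Definition in_uball : pred ell2 := fun z => `|z| < 1.

Definition uball := {z : ell2 | in_uball z}.

Lemma in_uball0 : in_uball 0.
Proof. by rewrite /in_uball normr0. Qed.

Definition origin : uball := exist _ 0 in_uball0.

(* Extension by 0 outside the open ball; differentiability at points of the
   ball does not depend on the values outside. *)
Definition extend0 (W : normedModType R[i]) (f : uball -> W) (z : ell2) : W :=
  oapp f 0 (insub z).

(* Complex Frechet differentiability: the scalars are [R[i]]. *)
Definition holomorphic (W : normedModType R[i]) (f : uball -> W) : Prop :=
  forall z : uball, differentiable (extend0 f) (val z).

Definition holomorphic_self_map (phi : uball -> uball) : Prop :=
  holomorphic (fun z => val (phi z)).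

Definition is_automorphism (phi : uball -> uball) : Prop :=
  holomorphic_self_map phi /\
  exists phi' : uball -> uball,
    [/\ holomorphic_self_map phi', cancel phi phi' & cancel phi' phi].

End Ell2.

(* A separable complex Hilbert space whose elements are, through the injective
   linear map [ev], functions on [X], with continuous point evaluations. *)
Record rkhs (R : realType) (X : Type) := Rkhs {
  rkhs_space :> completeNormedModType R[i];
  ip : {dot rkhs_space for (@Num.conj R[i])};
  ip_norm : forall f : rkhs_space, `|f| ^+ 2 = ip f f;
  rkhs_separable : exists A : set rkhs_space, countable A /\ dense A;
  ev : {linear rkhs_space -> (X -> R[i])};
  ev_inj : injective ev;
  ev_continuous : forall x : X, continuous (fun f : rkhs_space => ev f x) }.

Arguments ip {R X}.
Arguments ev {R X} {r}.

Section Rkhs.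
Variables (R : realType) (X : Type).
Implicit Types (H : rkhs R X) (K : X -> X -> R[i]) (psi : X -> R[i]).

Definition is_kernel H K : Prop :=
  forall y, exists2 k : H, ev k = K^~ y & forall f : H, ev f y = ip H f k.

Definition normalized_at K (x0 : X) : Prop := forall x, K x x0 = 1.

Definition irreducible K : Prop :=
  (forall x y, K x y != 0) /\
  (forall x y, x <> y -> forall a b : R[i],
     (forall t, a * K t x + b * K t y = 0) -> a = 0 /\ b = 0).

(* Norms over [R[i]] take values in the nonnegative reals of [R[i]]. *)
Definition hnorm H (f : H) : R := complex.Re `|f|.

Definition multiplier H psi : Prop :=
  forall f : H, exists g : H, forall x, ev g x = psi x * ev f x.

(* The supremum of |psi f| over the unit ball of H, with g = psi f. *)
Definition mult_norm H psi : \bar R :=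
  ereal_sup [set e | exists f g : H,
    [/\ hnorm f <= 1, (forall x, ev g x = psi x * ev f x)
      & e = (hnorm g)%:E] ].

(* H (x) C^r is identified with H^r. *)
Definition vhnorm H (r : nat) (f : 'I_r -> H) : R :=
  Num.sqrt (\sum_(i < r) hnorm (f i) ^+ 2).

Definition mx_multiplier H (r : nat) (Phi : 'M[X -> R[i]]_r) : Prop :=
  forall i j, multiplier H (Phi i j).

Definition mx_mult_norm H (r : nat) (Phi : 'M[X -> R[i]]_r) : \bar R :=
  ereal_sup [set e | exists f g : 'I_r -> H,
    [/\ vhnorm f <= 1,
        (forall i x, ev (g i) x = \sum_(j < r) Phi i j x * ev (f j) x)
      & e = (vhnorm g)%:E] ].

(* In the order of [R[i]], 0 <= c means that c is real and nonnegative. *)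
Definition possemidef (n : nat) (A : 'M[R[i]]_n) : Prop :=
  forall v : 'cV[R[i]]_n, 0 <= (v^t Num.conj *m A *m v) 0 0.

Definition complete_nevanlinna_pick H K : Prop :=
  forall (n r : nat), (0 < n)%N -> (0 < r)%N ->
  forall (z : 'I_n -> X) (Lambda : 'I_n -> 'M[R[i]]_r),
  possemidef (\mxblock_(i < n, j < n)
    (K (z i) (z j) *: (1%:M - Lambda i *m (Lambda j)^t Num.conj))) ->
  exists Phi : 'M[X -> R[i]]_r,
    [/\ mx_multiplier H Phi, (mx_mult_norm H Phi <= 1%:E)%E
      & forall i, map_mx (fun psi => psi (z i)) Phi = Lambda i].

Definition isometric_composition H (phi : X -> X) : Prop :=
  forall psi, multiplier H psi ->
    multiplier H (psi \o phi) /\ mult_norm H (psi \o phi) = mult_norm H psi.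

End Rkhs.

Section PrincipalPower.
Variable R : realType.
Implicit Type z : R[i].

(* The argument in (-pi, pi], for z != 0; [acos] takes values in [0, pi]. *)
Definition carg z : R :=
  let t := acos (complex.Re z / normc z) in
  if 0 <= complex.Im z then t else - t.

Definition clog z : R[i] := ln (normc z) +i* carg z.

Definition cexp z : R[i] :=
  (expR (complex.Re z))%:C * (cos (complex.Im z) +i* sin (complex.Im z)).

Definition cpow z (a : R) : R[i] := cexp (a%:C * clog z).

End PrincipalPower.

(* Main.v *)
From HB Require Import structures.
Require Import Defs.
From mathcomp Require Import all_boot all_order all_algebra.
From mathcomp Require Import all_classical all_reals all_analysis.
From mathcomp Require Import complex.
From mathcomp Require Import ring lra.

Set Implicit Arguments.
Unset Strict Implicit.
Unset Printing Implicit Defensive.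

Import Order.TTheory GRing.Theory Num.Theory.
Import numFieldNormedType.Exports.

Local Open Scope ring_scope.

(** Let phi_w denote the involutive automorphism of the ball exchanging 0 and w. Two
    facts about the automorphism group are used throughout: automorphisms multiply
    1 - <z, w> by a factor depending on z times a factor depending on w
    ([automorphism_inner]), and unitary maps act transitively on spheres
    ([unitary_transitive]). The first one rests on Schwarz's lemma, which is derived
    from Goursat's theorem through the mean value property at the centre of a disc.

    From the formula to the space. A kernel K for which F = 1 - 1/K is positive has
    the complete Pick property ([cnp_of_kernel]): the interpolation data determine a
    partial isometry between finite-dimensional spaces, whose transfer function Phi
    interpolates ([lurking_isometry]), and K (1 - Phi Phi^* ) is positive by Schur's
    product theorem. For K = (1 - <z, w>)^(-alpha) the function F is
    1 - (1 - <z, w>)^alpha, a power series in <z, w> whose coefficients are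
    nonnegative exactly because alpha <= 1 ([binsum_cvg], [psd_one_minus_pow]).
    Since an automorphism rescales K by delta(z) times the conjugate of delta(w),
    composition with it on multipliers is conjugation by a unitary weighted
    composition operator ([isometric_composition_of_kernel]).

    From the space to the formula. By the Pick property for two points,
    |K(z, w)|^2 / (K(z, z) K(w, w)) is determined by the norms of the multipliers that
    vanish at w, so that it is invariant under automorphisms ([overlap_invariant]).
    Hence K(z, z) depends on |z| only, and moving w to 0 by phi_w gives
    |K(z, w)|^2 = K(z, z) K(w, w) / K(phi_w z, phi_w z). Write ln K(z, z) = M(y) with
    y = -ln(1 - |z|^2); it has to be shown that M is linear ([radial_profile]). On a
    complex line K(z, w) is holomorphic in z and invariant under common rotations of
    z and w, because holomorphic functions with equal moduli and equal values at 0
    coincide. For |u| = 1 this relates K(ru, s) to K(su^*, r), and the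
    Cauchy-Riemann equations turn the relation into
    M'(y_r) xi_r - M'(y_s) xi_s = M'(y) (xi_r - xi_s), where xi_r = 2 r^2 / (1 - r^2),
    y_r and y_s are the heights of r and s, and y is that of phi_s(ru). Varying u
    changes y alone, so M' is constant.
    Thus |K(z, w)| = |1 - <z, w>|^(-alpha), and holomorphy in z determines the phase
    ([kernel_power]). Finally alpha > 0 by the Cauchy-Schwarz inequality and
    irreducibility, and alpha <= 1 by Schwarz's lemma applied to the extremal
    multiplier vanishing at 0 ([exponent_bounds]). *)

(** * Real and complex derivatives *)

(** One notion for real functions of a real variable and complex functions of a
    complex variable. *)
Definition der (F : numFieldType) (f : F -> F) (x D : F) : Prop :=
  is_derive x 1 f D.

Section DerAlgebra.
Local Open Scope classical_set_scope.
Local Open Scope ring_scope.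
Variable F : numFieldType.
Implicit Types (f g : F -> F) (x a b c : F).

Lemma derP f x a : der f x a <->
  (forall e : F, 0 < e -> exists2 d : F, 0 < d &
     forall h : F, `|h| < d -> `|f (x + h) - f x - a * h| <= e * `|h|).
Proof.
split.
  move=> [fd fa] e e0.
  have : h^-1 *: (f (h *: 1 + x) - f x) @[h --> 0^'] --> a.
    by rewrite -fa; exact: fd.
  move/cvgrPdist_le => /(_ _ e0).
  rewrite near_withinE => /nbhs_ballP[d /= d0 H]; exists d => // h hd.
  have [->|h0] := eqVneq h 0.
    by rewrite addr0 subrr mulr0 subrr normr0 mulr0.
  have := H h; rewrite /ball/= sub0r normrN => /(_ hd h0) /=.
  move=> /(ler_wpM2r (normr_ge0 h)).
  rewrite -normrM /GRing.scale/= mulr1 (addrC h x) mulrBl mulrAC mulVf// mul1r.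
  by rewrite distrC.
move=> H.
have K : h^-1 *: (f (h *: 1 + x) - f x) @[h --> 0^'] --> a.
  apply/cvgrPdist_le => e e0; rewrite near_withinE; apply/nbhs_ballP.
  have [d d0 {}H] := H e e0; exists d => //= h.
  rewrite /ball/= sub0r normrN => hd h0.
  rewrite /GRing.scale/= mulr1 (addrC h x).
  rewrite -(ler_pM2r (x := `|h|)) ?normr_gt0// -normrM.
  by rewrite mulrBl mulrAC mulVf// mul1r distrC; exact: H.
apply: DeriveDef; last exact: (cvg_lim _ K).
by apply/cvg_ex; exists a.
Qed.

Lemma der_cst c x : der (fun=> c) x 0.
Proof. exact: is_derive_cst. Qed.

Lemma der_id x : der (fun t => t) x 1.
Proof. exact: is_derive_id. Qed.

Lemma derD f g x a b :
  der f x a -> der g x b -> der (fun t => f t + g t) x (a + b).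
Proof. exact: is_deriveD. Qed.

Lemma derN f x a : der f x a -> der (fun t => - f t) x (- a).
Proof. exact: is_deriveN. Qed.

Lemma derB f g x a b :
  der f x a -> der g x b -> der (fun t => f t - g t) x (a - b).
Proof. exact: is_deriveB. Qed.

Lemma derM f g x a b :
  der f x a -> der g x b -> der (fun t => f t * g t) x (f x * b + g x * a).
Proof. exact: is_deriveM. Qed.

Lemma derMl f x a c : der f x a -> der (fun t => c * f t) x (c * a).
Proof.
by move=> fa; have := derM (der_cst c x) fa; rewrite /= mulr0 addr0.
Qed.

Lemma derV f x a :
  f x != 0 -> der f x a -> der (fun t => (f t)^-1) x (- a / f x ^+ 2).
Proof.
move=> fx0 [fd <-]; apply: DeriveDef; first exact: derivableV.
by rewrite deriveV// /GRing.scale/= mulNr mulrC mulNr.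
Qed.

Lemma der_eq f x a b : der f x a -> a = b -> der f x b.
Proof. by move=> + <-. Qed.

Lemma der_ext f g x a : (forall t, f t = g t) -> der f x a -> der g x a.
Proof. by move=> /funext ->. Qed.

Lemma der_uniq f x a b : der f x a -> der f x b -> a = b.
Proof. by move=> [_ <-] [_ <-]. Qed.

Lemma der_near f g x a d : 0 < d ->
  (forall t, `|t - x| < d -> f t = g t) -> der f x a -> der g x a.
Proof.
move=> d0 fg; apply: near_eq_is_derive; apply/nbhs_ballP; exists d => //= t.
by rewrite /ball/= distrC; exact: fg.
Qed.

Lemma der_cont f x a : der f x a -> {for x, continuous f}.
Proof.
move=> [/derivable1_diffP fd _]; exact: differentiable_continuous.
Qed.

Lemma der_comp f g x a b :
  der f (g x) a -> der g x b -> der (fun t => f (g t)) x (a * b).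
Proof.
move=> [/derivable1_diffP fd <-] [/derivable1_diffP gd <-].
have fgd : differentiable (f \o g) x by apply: differentiable_comp.
apply: DeriveDef; first exact/derivable1_diffP.
have lin1 (g' : F -> F) y : differentiable g' y -> forall h, 'd g' y h = h * 'D_1 g' y.
  move=> gd' h; rewrite (deriveE _ gd') -[X in 'd _ _ X](mulr1 h).
  exact: linearZ.
rewrite (_ : 'D_1 (fun t => f (g t)) x = 'd (f \o g) x 1); last exact: deriveE.
rewrite (_ : 'd (f \o g) x = 'd f (g x) \o 'd g x :> (F -> F)); last exact: diff_comp.
by rewrite /= lin1// lin1// mul1r mulrC.
Qed.

Lemma derX f x a n : der f x a -> der (fun t => f t ^+ n) x (n%:R * f x ^+ n.-1 * a).
Proof.
move=> fa; elim: n => [|n IH].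
  by rewrite mul0r mul0r; apply: der_ext (der_cst 1 x) => t; rewrite expr0.
apply: (der_ext (f := fun t => f t * f t ^+ n)); first by move=> t; rewrite exprS.
apply: der_eq (derM fa IH) _ => /=.
rewrite -natr1 !mulrDl mul1r; congr (_ + _).
case: n {IH} => [|n]; first by rewrite !mul0r mulr0.
by rewrite /= exprS !mulrA (mulrC (f x)).
Qed.

End DerAlgebra.

Section ComplexCalculus.
Variable R : realType.
Local Open Scope complex_scope.
Local Notation "x ^*" := (Num.conj x) : complex_scope.
Import Normc.
Notation C := R[i].
Notation Re := (@complex.Re R).
Notation Im := (@complex.Im R).
Implicit Types (z w : C) (f g : C -> C) (u : R -> C).

Lemma norm_normc z : `|z| = (normc z)%:C.
Proof. by case: z. Qed.

Lemma normc_le z (x : R) : (`|z| <= x%:C) = (normc z <= x).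
Proof. by rewrite norm_normc lecR. Qed.

Lemma normc_lt z (x : R) : (`|z| < x%:C) = (normc z < x).
Proof. by rewrite norm_normc ltcR. Qed.

Lemma sqr_normcE z : normc z ^+ 2 = Re z ^+ 2 + Im z ^+ 2.
Proof. by case: z => a b; rewrite /= sqr_sqrtr// addr_ge0 ?sqr_ge0. Qed.

Lemma normc_conj z : normc z^* = normc z.
Proof. by case: z => a b; rewrite /= sqrrN. Qed.

Lemma mulC_conj z : z * z^* = ((normc z) ^+ 2)%:C.
Proof. by rewrite sqr_normcE; case: z => a b; simpc; congr (_ +i* _); ring. Qed.

Lemma normc_real (x : R) : normc x%:C = `|x|.
Proof. by rewrite /= expr0n/= addr0 sqrtr_sqr. Qed.

Lemma normc_gt0 z : (0 < normc z) = (z != 0).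
Proof.
rewrite lt_def normc_ge0 andbT; congr (~~ _); apply/eqP/eqP => [/eq0_normc//|->].
exact: normc0.
Qed.

Lemma Re_le_normc z : `|Re z| <= normc z.
Proof.
rewrite -(ler_sqr (x := `|_|)) ?nnegrE ?normc_ge0// sqr_normcE real_normK ?num_real//.
by rewrite lerDl sqr_ge0.
Qed.

Lemma Im_le_normc z : `|Im z| <= normc z.
Proof.
rewrite -(ler_sqr (x := `|_|)) ?nnegrE ?normc_ge0// sqr_normcE real_normK ?num_real//.
by rewrite lerDr sqr_ge0.
Qed.

Lemma normc_le_ReIm z : normc z <= `|Re z| + `|Im z|.
Proof.
rewrite -(ler_sqr (x := normc z)) ?nnegrE ?normc_ge0 ?addr_ge0// sqr_normcE.
rewrite sqrrD !real_normK ?num_real//.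
by rewrite lerD2r lerDl mulrn_wge0// mulr_ge0.
Qed.

Lemma ReM z w : Re (z * w) = Re z * Re w - Im z * Im w.
Proof. by case: z => a b; case: w. Qed.

Lemma ImM z w : Im (z * w) = Re z * Im w + Im z * Re w.
Proof. by case: z => a b; case: w => c d; rewrite /= (mulrC b). Qed.

Lemma ReD z w : Re (z + w) = Re z + Re w. Proof. by case: z; case: w. Qed.
Lemma ImD z w : Im (z + w) = Im z + Im w. Proof. by case: z; case: w. Qed.
Lemma ReN z : Re (- z) = - Re z. Proof. by case: z. Qed.
Lemma ImN z : Im (- z) = - Im z. Proof. by case: z. Qed.

Lemma eqC z w : Re z = Re w -> Im z = Im w -> z = w.
Proof. by case: z => a b; case: w => c d /= -> ->. Qed.

Lemma conjcD z w : (z + w)^* = z^* + w^*. Proof. exact: rmorphD. Qed.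
Lemma conjcM z w : (z * w)^* = z^* * w^*. Proof. exact: rmorphM. Qed.
Lemma conjcN z : (- z)^* = - z^*. Proof. exact: rmorphN. Qed.
Lemma conjcB z w : (z - w)^* = z^* - w^*. Proof. exact: rmorphB. Qed.
Lemma conjc_realE (x : R) : (x%:C)^* = x%:C :> C.
Proof. by apply: eqC => //=; rewrite oppr0. Qed.
Lemma conjcK z : z^*^* = z. Proof. exact: conjCK. Qed.
Lemma conjcV z : (z^-1)^* = (z^*)^-1. Proof. exact: fmorphV. Qed.

Lemma derCP f z (a : C) : der f z a <->
  (forall e : R, 0 < e -> exists2 d : R, 0 < d &
     forall h, normc h < d -> normc (f (z + h) - f z - a * h) <= e * normc h).
Proof.
split=> [/derP H e e0|H].
  have [|d d0 {}H] := H e%:C; first by rewrite ltcR.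
  have dE : d = (Re d)%:C by rewrite RRe_real// gtr0_real.
  exists (Re d); first by rewrite -ltcR -dE.
  move=> h; rewrite -normc_lt -dE => /H.
  by rewrite (norm_normc h) -rmorphM normc_le.
apply/derP => e e0.
have eE : e = (Re e)%:C by rewrite RRe_real// gtr0_real.
have [|d d0 {}H] := H (Re e); first by rewrite -ltcR -eE.
exists d%:C; first by rewrite ltcR.
by move=> h; rewrite normc_lt eE (norm_normc h) -rmorphM normc_le; exact: H.
Qed.

(** Real and imaginary parts are differentiated separately, since [der] needs the
    same field on both sides. *)
Definition curve_der u (t : R) (v : C) : Prop :=
  der (fun s => Re (u s)) t (Re v) /\ der (fun s => Im (u s)) t (Im v).

Lemma curve_derP u t v : curve_der u t v <->
  (forall e : R, 0 < e -> exists2 d : R, 0 < d &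
     forall h, `|h| < d -> normc (u (t + h) - u t - v * h%:C) <= e * `|h|).
Proof.
have ReE h : Re (u (t + h) - u t - v * h%:C) = Re (u (t + h)) - Re (u t) - Re v * h.
  by rewrite !ReD !ReN ReM/= mulr0 subr0.
have ImE h : Im (u (t + h) - u t - v * h%:C) = Im (u (t + h)) - Im (u t) - Im v * h.
  by rewrite !ImD !ImN ImM/= mulr0 add0r.
split=> [[/derP H1 /derP H2] e e0|H].
  have e20 : 0 < e / 2 by rewrite divr_gt0.
  have [d1 d10 {}H1] := H1 _ e20; have [d2 d20 {}H2] := H2 _ e20.
  exists (Num.min d1 d2); first by rewrite lt_min d10.
  move=> h; rewrite lt_min => /andP[/H1 h1 /H2 h2].
  apply: le_trans (normc_le_ReIm _) _; rewrite ReE ImE.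
  by apply: le_trans (lerD h1 h2) _; rewrite -mulrDl -splitr.
split; apply/derP => e e0; have [d d0 {}H] := H e e0; exists d => // h /H; apply: le_trans.
  by rewrite -ReE; exact: Re_le_normc.
by rewrite -ImE; exact: Im_le_normc.
Qed.

(** Chain rule for a holomorphic function along a real curve: the two first order
    expansions compose. *)
Lemma curve_der_comp f u t (a v : C) :
  der f (u t) a -> curve_der u t v -> curve_der (fun s => f (u s)) t (a * v).
Proof.
move=> /derCP fa /curve_derP uv; apply/curve_derP => e e0.
pose M := normc v + 1; have M0 : 0 < M by rewrite ltr_wpDl ?normc_ge0.
pose N := normc a + 1; have N0 : 0 < N by rewrite ltr_wpDl ?normc_ge0.
have [d1 d10 H1] := fa (e / 2 / M) ltac:(by rewrite !divr_gt0).
have [d2 d20 H2] := uv (Num.min 1 (e / 2 / N))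
  ltac:(by rewrite lt_min ltr01 !divr_gt0).
exists (Num.min d2 (d1 / M)); first by rewrite lt_min d20 divr_gt0.
move=> h; rewrite lt_min => /andP[/H2 hu]; rewrite ltr_pdivlMr// => hd1.
set k := u (t + h) - u t in hu *.
have kM : normc k <= M * `|h|.
  have -> : k = (k - v * h%:C) + v * h%:C by rewrite subrK.
  apply: le_trans (le_normcD _ _) _; rewrite normcM normc_real /M mulrDl mul1r addrC.
  by rewrite lerD2l; apply: le_trans hu _; rewrite ler_piMl// ge_min lexx.
have -> : f (u (t + h)) - f (u t) - a * v * h%:C =
    (f (u t + k) - f (u t) - a * k) + a * (k - v * h%:C).
  by rewrite /k [u t + _]addrC subrK; ring.
apply: le_trans (le_normcD _ _) _; rewrite [leRHS](_ : _ = e / 2 * `|h| + e / 2 * `|h|); last first.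
  by rewrite -mulrDl -splitr.
apply: lerD.
  have /H1 : normc k < d1 by apply: le_lt_trans kM _; rewrite mulrC.
  move=> /le_trans; apply; apply: le_trans (ler_wpM2l _ kM) _.
    by rewrite !divr_ge0 ?ltW.
  by rewrite mulrA divfK// gt_eqF.
rewrite normcM.
have hu2 : normc (k - v * h%:C) <= e / 2 / N * `|h|.
  by apply: le_trans hu _; rewrite ler_wpM2r// ge_min lexx orbT.
apply: le_trans (ler_wpM2l (normc_ge0 _) hu2) _.
rewrite mulrA ler_wpM2r// mulrCA ler_piMr ?divr_ge0 ?ltW//.
by rewrite ltr_pdivrMr// mul1r /N ltrDl.
Qed.

Lemma curve_der_line z v t : curve_der (fun s => z + s%:C * v) t v.
Proof.
split.
  apply: (der_ext (f := fun s => Re z + Re v * s)).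
    by move=> s; rewrite ReD ReM/= mul0r subr0 mulrC.
  by apply: der_eq (derD (der_cst _ _) (derMl _ (der_id _))) _; rewrite add0r mulr1.
apply: (der_ext (f := fun s => Im z + Im v * s)).
  by move=> s; rewrite ImD ImM/= mul0r addr0 mulrC.
by apply: der_eq (derD (der_cst _ _) (derMl _ (der_id _))) _; rewrite add0r mulr1.
Qed.

Lemma curve_der_normc2 u t v : curve_der u t v ->
  der (fun s => normc (u s) ^+ 2) t (2 * Re ((u t)^* * v)).
Proof.
move=> [u1 u2].
apply: (der_ext (f := fun s => Re (u s) ^+ 2 + Im (u s) ^+ 2)).
  by move=> s; rewrite sqr_normcE.
apply: der_eq (derD (derX 2 u1) (derX 2 u2)) _.
by rewrite /= !expr1 ReM; case: (u t) => a b /=; ring.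
Qed.

Lemma der_MVT (f df : R -> R) (a b : R) : a < b ->
  (forall x, a <= x <= b -> der f x (df x)) ->
  exists2 c, a < c < b & f b - f a = df c * (b - a).
Proof.
move=> ab fd.
have fd1 x : x \in `]a, b[%R -> is_derive x 1 f (df x).
  by rewrite in_itv/= => /andP[/ltW ax /ltW xb]; apply: fd; rewrite ax.
have fd2 x : x \in `[a, b]%R -> derivable f x 1 by rewrite in_itv/= => /fd[].
have [c] := MVT ab fd1 (derivable_within_continuous fd2).
by rewrite in_itv/=; exists c.
Qed.

Lemma der_le0_le (f df : R -> R) (a b : R) : a <= b ->
  (forall x, a <= x <= b -> der f x (df x)) ->
  (forall x, a <= x <= b -> df x <= 0) -> f b <= f a.
Proof.
rewrite le_eqVlt => /predU1P[-> //|ab] fd f0.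
have [c /andP[/ltW ac /ltW cb] fE] := der_MVT ab fd.
rewrite -subr_le0 fE mulr_le0_ge0 ?subr_ge0 ?(ltW ab)//.
by apply: f0; rewrite ac cb.
Qed.

Lemma der0_cst (f : R -> R) (a b : R) : a <= b ->
  (forall x, a <= x <= b -> der f x 0) -> f b = f a.
Proof.
rewrite le_eqVlt => /predU1P[-> //|ab] fd.
by have [c _ /eqP] := der_MVT ab fd; rewrite mul0r subr_eq0 => /eqP.
Qed.

Definition cdiff f z : Prop := exists a, der f z a.

(** A holomorphic function of constant modulus has zero derivative, because
    the derivative of its squared modulus in every direction vanishes. *)
Lemma der0_of_normc1 f z a (d : R) : 0 < d ->
  (forall w, normc (w - z) < d -> normc (f w) = 1) -> der f z a -> a = 0.
Proof.
move=> d0 f1 fa.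
have fz0 : f z != 0 by rewrite -normc_gt0 f1 ?subrr ?normc0.
have dir v : Re ((f z)^* * (a * v)) = 0.
  have fa' : der f (z + 0%:C * v) a by rewrite mul0r addr0.
  have /curve_der_normc2 := curve_der_comp fa' (curve_der_line z v 0).
  rewrite mul0r addr0 => H; have {H} := der_near (g := fun=> 1) _ _ H.
  move=> /(_ (d / (normc v + 1))) /=.
  have v1 : 0 < normc v + 1 by rewrite ltr_wpDl ?normc_ge0.
  rewrite divr_gt0// => /(_ isT) H.
  have {}H : der (fun=> 1) (0 : R) (2 * Re ((f z)^* * (a * v))).
    apply: H => t; rewrite subr0 ltr_pdivlMr// => td; rewrite f1 ?expr1n//.
    rewrite (addrC z) addrK normcM normc_real; apply: le_lt_trans td.
    by rewrite ler_wpM2l// lerDl.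
  have /eqP := der_uniq H (der_cst _ _).
  by rewrite mulf_eq0 pnatr_eq0/= => /eqP.
have D1 := dir 1; have D2 := dir 'i%C.
have : (f z)^* * a = 0.
  apply: eqC => /=; first by rewrite -[a]mulr1 D1.
  by move: D2; rewrite mulrA ReM /= mulr0 mulr1 sub0r => /eqP; rewrite oppr_eq0 => /eqP.
by move/eqP; rewrite mulf_eq0 conjC_eq0 (negbTE fz0)/= => /eqP.
Qed.

(** The quotient f / g has modulus 1, hence zero derivative, and equals 1 at the
    centre. *)
Lemma eq_of_eq_normc f g :
  (forall z, normc z < 1 -> cdiff f z) -> (forall z, normc z < 1 -> cdiff g z) ->
  (forall z, normc z < 1 -> g z != 0) ->
  (forall z, normc z < 1 -> normc (f z) = normc (g z)) -> f 0 = g 0 ->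
  forall z, normc z < 1 -> f z = g z.
Proof.
move=> fd gd g0 fg fg0 z z1.
pose h w := f w * (g w)^-1.
have h1 w : normc w < 1 -> normc (h w) = 1.
  by move=> w1; rewrite normcM normcV fg// divff// gt_eqF// normc_gt0 g0.
have hd w : normc w < 1 -> der h w 0.
  move=> w1; have [a fa] := fd w w1; have [b gb] := gd w w1.
  have D := derM fa (derV (g0 _ w1) gb); apply: (der_eq D).
  apply: (der0_of_normc1 (d := 1 - normc w) _ _ D); first by rewrite subr_gt0.
  move=> w' ww'; apply: h1; rewrite -(subrK w w').
  by apply: le_lt_trans (le_normcD _ _) _; rewrite -ltrBrDr.
have cur t : 0 <= t <= 1 -> curve_der (fun s => h (0 + s%:C * z)) t 0.
  move=> /andP[t0 t1].
  suff ht : der h (0 + t%:C * z) 0.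
    by have := curve_der_comp ht (curve_der_line 0 z t); rewrite mul0r.
  apply: hd; rewrite add0r normcM normc_real ger0_norm//.
  by apply: le_lt_trans z1; rewrite ler_piMl ?normc_ge0.
have : h (0 + 1%:C * z) = h (0 + 0%:C * z).
  apply: eqC.
    by apply: (der0_cst (f := fun s => Re (h (0 + s%:C * z))) ler01) => x /cur[].
  by apply: (der0_cst (f := fun s => Im (h (0 + s%:C * z))) ler01) => x /cur[].
rewrite mul0r !add0r mul1r /h fg0 divff; last by apply: g0; rewrite normc0.
by move/(congr1 (fun w => w * g z)); rewrite divfK ?mul1r ?g0.
Qed.

End ComplexCalculus.

(** * The exponential and the principal power *)

Section PrincipalBranch.
Variable R : realType.
Local Open Scope complex_scope.
Local Notation "x ^*" := (Num.conj x) : complex_scope.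
Import Normc.
Notation C := R[i].
Notation Re := (@complex.Re R).
Notation Im := (@complex.Im R).
Implicit Types (z w v : C) (a : R).

Lemma cexpD z w : cexp (z + w) = cexp z * cexp w.
Proof.
by rewrite /cexp ReD ImD expRD cosD sinD; apply: eqC; rewrite /= ?(mul0r, addr0, subr0); ring.
Qed.

Lemma cexp0 : cexp (0 : C) = 1.
Proof. by rewrite /cexp expR0 cos0 sin0; apply: eqC; rewrite /=; ring. Qed.

Lemma normc_cexp z : normc (cexp z) = expR (Re z).
Proof. by rewrite normcM normc_real ger0_norm ?expR_ge0//= cos2Dsin2 sqrtr1 mulr1. Qed.

Lemma cexp_neq0 z : cexp z != 0.
Proof. by rewrite -normc_gt0 normc_cexp expR_gt0. Qed.

Lemma cexpN z : cexp (- z) = (cexp z)^-1.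
Proof. by apply: (mulfI (cexp_neq0 z)); rewrite -cexpD subrr cexp0 divff// cexp_neq0. Qed.

(** From the first order expansions of [expR], [cos] and [sin] at 0; the addition
    formula carries the result to the other points. *)
Lemma der_cexp0 : der (@cexp R) 0 1.
Proof.
apply/derCP => e e0; rewrite cexp0.
pose e' := Num.min (e / 8) 1.
have e'0 : 0 < e' by rewrite lt_min ltr01 divr_gt0.
have e81 : e' <= e / 8 by rewrite ge_min lexx.
have e11 : e' <= 1 by rewrite ge_min lexx orbT.
clearbody e'.
have [d1 d10 H1] := (derP _ _ _).1 (is_derive_expR (0 : R)) _ e'0.
have [d2 d20 H2] := (derP _ _ _).1 (is_derive_cos (0 : R)) _ e'0.
have [d3 d30 H3] := (derP _ _ _).1 (is_derive_sin (0 : R)) _ e'0.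
exists (Num.min (Num.min d1 d2) (Num.min d3 e')); first by rewrite !lt_min d10 d20 d30 e'0.
move=> h; rewrite !lt_min => /andP[/andP[h1 h2] /andP[h3 h4]].
have hR := Re_le_normc h; have hI := Im_le_normc h.
have {}H1 := H1 _ (le_lt_trans hR h1); have {}H2 := H2 _ (le_lt_trans hI h2).
have {}H3 := H3 _ (le_lt_trans hI h3).
rewrite !add0r expR0 mul1r in H1; rewrite !add0r cos0 sin0 oppr0 mul0r subr0 in H2.
rewrite !add0r cos0 sin0 subr0 mul1r in H3.
rewrite add0r mul1r; apply: le_trans (normc_le_ReIm _) _.
have n0 := normc_ge0 h.
have cs1 : `|cos (Im h)| <= 1 by rewrite ler_norml cos_geN1 cos_le1.
have sn1 : `|sin (Im h)| <= 1 by rewrite ler_norml sin_geN1 sin_le1.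
have ex1 : `|expR (Re h) - 1| <= 2 * normc h.
  rewrite -(subrK (Re h) (_ - 1)); apply: le_trans (ler_normD _ _) _.
  rewrite mulr_natl mulr2n; apply: lerD => //.
  apply: le_trans H1 _; apply: le_trans (ler_wpM2r (normr_ge0 _) e11) _.
  by rewrite mul1r.
have -> : Re (cexp h - 1 - h) = (expR (Re h) - 1 - Re h) * cos (Im h)
    + (1 + Re h) * (cos (Im h) - 1).
  by rewrite /cexp !ReD !ReN ReM /=; ring.
have -> : Im (cexp h - 1 - h) = (expR (Re h) - 1) * sin (Im h) + (sin (Im h) - Im h).
  by rewrite /cexp !ImD !ImN ImM /=; ring.
have T1 : `|(expR (Re h) - 1 - Re h) * cos (Im h)| <= e' * normc h.
  rewrite normrM -[leRHS]mulr1; apply: ler_pM => //.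
  by apply: le_trans H1 _; rewrite ler_wpM2l// ltW.
have T2 : `|(1 + Re h) * (cos (Im h) - 1)| <= 2 * (e' * normc h).
  rewrite normrM; apply: ler_pM => //.
    apply: le_trans (ler_normD _ _) _; rewrite normr1 -[leRHS]/(1 + 1 : R) lerD2l.
    by apply: le_trans hR _; apply: le_trans (ltW h4) _.
  by apply: le_trans H2 _; rewrite ler_wpM2l// ltW.
have T3 : `|(expR (Re h) - 1) * sin (Im h)| <= 2 * e' * (2 * normc h).
  rewrite normrM; apply: ler_pM => //.
    by apply: le_trans ex1 _; rewrite ler_pM2l// ltW.
  rewrite -(subrK (Im h) (sin _)); apply: le_trans (ler_normD _ _) _.
  rewrite [leRHS]mulr_natl mulr2n; apply: lerD => //; apply: le_trans H3 _.
  by apply: le_trans (ler_wpM2r (normr_ge0 _) e11) _; rewrite mul1r.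
have T4 : `|sin (Im h) - Im h| <= e' * normc h.
  by apply: le_trans H3 _; rewrite ler_wpM2l// ltW.
apply: le_trans (lerD (ler_normD _ _) (ler_normD _ _)) _.
have T5 : e' * normc h <= e / 8 * normc h by rewrite ler_wpM2r.
by lra.
Qed.

Lemma der_cexp z : der (@cexp R) z (cexp z).
Proof.
have H : der (fun w => cexp z * cexp (w - z)) z (cexp z).
  have D0 : der (@cexp R) (z - z) 1 by rewrite subrr; exact: der_cexp0.
  have D1 := der_comp (g := fun w => w - z) D0 (derB (der_id z) (der_cst z z)).
  apply: der_eq (derMl (cexp z) D1) _.
  by rewrite subr0 !mulr1.
by apply: der_ext H => w; rewrite -cexpD addrC subrK.
Qed.

Lemma cos1_eq0 (t : R) : `|t| < 2 * pi -> cos t = 1 -> t = 0.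
Proof.
have pos (s : R) : 0 < s -> s < 2 * pi -> cos s != 1.
  move=> s0 s2; have -> : s = s / 2 *+ 2 by rewrite -mulr_natr divfK.
  rewrite cos_mulr2n.
  have s2pi : 0 < sin (s / 2).
    by rewrite sin_gt0_pi// divr_gt0//= ltr_pdivrMr// mulrC.
  have sc := cos2Dsin2 (s / 2); apply/eqP => c2.
  have : 0 < sin (s / 2) ^+ 2 by rewrite exprn_gt0.
  by move: c2; rewrite mulr2n => c2 s20; lra.
move=> t2 c1; case: (ltgtP t 0) => // t0; last first.
  by move/eqP: c1; rewrite (negbTE (pos _ t0 _))// -(gtr0_norm t0).
move: c1; rewrite -cosN => /eqP; rewrite (negbTE (pos _ _ _)) ?oppr_gt0//.
by rewrite -(ltr0_norm t0).
Qed.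

(** The exponential of z - w is 1, so z - w is purely imaginary and its imaginary
    part has cosine 1. *)
Lemma cexp_inj_strip z w : `|Im z - Im w| < 2 * pi -> cexp z = cexp w -> z = w.
Proof.
move=> zw E.
have E1 : cexp (z - w) = 1.
  by rewrite cexpD cexpN E divff ?cexp_neq0.
have Re0 : Re (z - w) = 0.
  by apply: expR_inj; rewrite -normc_cexp E1 normc1 expR0.
have : Re (cexp (z - w)) = 1 by rewrite E1.
rewrite /cexp Re0 expR0 mul1r /= => c1.
have Im0 : Im (z - w) = 0 by apply: cos1_eq0 c1; rewrite ImD ImN.
by apply/eqP; rewrite -subr_eq0; apply/eqP/eqC.
Qed.

Lemma Re_div_normc z : z != 0 -> -1 <= Re z / normc z <= 1.
Proof.
rewrite -normc_gt0 => z0.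
by rewrite -ler_norml normrM normfV (gtr0_norm z0) ler_pdivrMr// mul1r Re_le_normc.
Qed.

Lemma clogK z : z != 0 -> cexp (clog z) = z.
Proof.
move=> z0; have n0 : 0 < normc z by rewrite normc_gt0.
have c1 := Re_div_normc z0.
have ca : cos (carg z) = Re z / normc z.
  by rewrite /carg; case: ifP => _; rewrite ?cosN acosK// in_itv.
have sa : sin (acos (Re z / normc z)) = `|Im z| / normc z.
  rewrite sin_acos// expr_div_n -[1](divff (x := normc z ^+ 2)); last first.
    by rewrite expf_neq0// gt_eqF.
  rewrite -mulrBl {1}sqr_normcE [_ ^+ 2 + _]addrC addrK sqrtrM ?sqr_ge0//.
  by rewrite sqrtr_sqr sqrtrV ?sqr_ge0// sqrtr_sqr (gtr0_norm n0).
have sn : sin (carg z) = Im z / normc z.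
  rewrite /carg; case: ifPn => iz; rewrite ?sinN sa; first by rewrite ger0_norm.
  by rewrite ltr0_norm ?ltNge// mulNr opprK.
rewrite /cexp /clog /= lnK ?posrE// ca sn.
by apply: eqC; rewrite /= ?(mul0r, addr0, subr0) mulrC divfK// gt_eqF.
Qed.

Lemma Re_gt0_neq0 z : 0 < Re z -> z != 0.
Proof. by apply: contraTneq => ->; rewrite ltxx. Qed.

Lemma carg_bound z : 0 < Re z -> `|Im (clog z)| < pi / 2.
Proof.
move=> z0; have n0 : 0 < normc z by rewrite normc_gt0 Re_gt0_neq0.
have c1 := Re_div_normc (Re_gt0_neq0 z0).
have -> : `|Im (clog z)| = acos (Re z / normc z).
  by rewrite /= /carg; case: ifP => _; rewrite ?normrN ger0_norm// acos_ge0.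
rewrite -ltr_cos ?in_itv/= ?acos_ge0 ?acos_lepi//; last first.
  by rewrite divr_ge0 ?pi_ge0//= ler_pdivrMr// ler_peMr ?pi_ge0// ler1n.
by rewrite cos_pihalf acosK ?in_itv// divr_gt0.
Qed.

(** The bound is the one satisfied by a sum of three arguments in
    (-pi/2, pi/2). *)
Lemma clog_uniq z v : 0 < Re z -> cexp v = z -> `|Im v| < 3 * pi / 2 -> clog z = v.
Proof.
move=> z0 vz v3; apply: cexp_inj_strip; last by rewrite clogK// Re_gt0_neq0.
apply: le_lt_trans (ler_normB _ _) _.
by have := carg_bound z0; move: v3; set p : R := pi; lra.
Qed.

Lemma clog1 : clog (1 : C) = 0.
Proof.
apply: clog_uniq; rewrite ?cexp0//= ?ltr01// normr0.
by rewrite divr_gt0// mulr_gt0// pi_gt0.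
Qed.

Lemma clogM z w : 0 < Re z -> 0 < Re w -> 0 < Re (z * w) ->
  clog (z * w) = clog z + clog w.
Proof.
move=> z0 w0 zw0; apply: clog_uniq => //.
  by rewrite cexpD !clogK// Re_gt0_neq0.
rewrite ImD; apply: le_lt_trans (ler_normD _ _) _.
have := carg_bound z0; have := carg_bound w0; have := pi_gt0 R.
by set p : R := pi; lra.
Qed.

(** On the right half-plane the argument is an arctangent, whose derivative at 0
    is available, whereas [acos] is not differentiable at 1. *)
Lemma Im_clog z : 0 < Re z -> Im (clog z) = atan (Im z / Re z).
Proof.
move=> z0; have n0 : 0 < normc z by rewrite normc_gt0 Re_gt0_neq0.
suff -> : clog z = ln (normc z) +i* atan (Im z / Re z) by [].
apply: clog_uniq => //=; last first.
  have := atan_gtNpi2 (Im z / Re z); have := atan_ltpi2 (Im z / Re z).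
  have := pi_gt0 R; rewrite ltr_norml.
  by set p : R := pi; set q := atan _ => ? ? ?; apply/andP; split; lra.
have rz : Re z != 0 by rewrite gt_eqF.
have cE : cos (atan (Im z / Re z)) = Re z / normc z.
  rewrite cos_atan; have -> : 1 + (Im z / Re z) ^+ 2 = (normc z / Re z) ^+ 2.
    by rewrite !expr_div_n sqr_normcE; field.
  by rewrite sqrtr_sqr ger0_norm ?divr_ge0 ?ltW// invf_div.
have sE : sin (atan (Im z / Re z)) = Im z / normc z.
  have := atanK (Im z / Re z); rewrite /tan cE => /(congr1 (fun s => s * (Re z / normc z))).
  by rewrite divfK ?mulf_neq0 ?invr_eq0 ?gt_eqF// => ->; rewrite mulrA divfK.
rewrite /cexp /= lnK ?posrE// cE sE.
by apply: eqC; rewrite /= ?(mul0r, addr0, subr0) mulrC divfK// gt_eqF.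
Qed.

Lemma Re_clog z : Re (clog z) = ln (normc z). Proof. by []. Qed.

Lemma der_clog1 : der (@clog R) 1 1.
Proof.
apply/derCP => e e0; rewrite clog1.
pose e' := Num.min (e / 16) 1.
have e'0 : 0 < e' by rewrite lt_min ltr01 divr_gt0.
have e81 : e' <= e / 16 by rewrite ge_min lexx.
have e11 : e' <= 1 by rewrite ge_min lexx orbT.
clearbody e'.
have [d1 d10 H1] := (derP _ _ _).1 (is_derive1_ln ltr01) _ e'0.
have [d2 d20 H2] := (derP _ _ _).1 (is_derive1_atan (0 : R)) _ e'0.
exists (Num.min (Num.min (d1 / 3) (d2 / 2)) (Num.min (1 / 2) e')).
  by rewrite !lt_min e'0 !divr_gt0.
move=> h; rewrite !lt_min => /andP[/andP[h1 h2] /andP[h3 h4]].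
have hR := Re_le_normc h; have hI := Im_le_normc h; have n0 := normc_ge0 h.
rewrite subr0 mul1r.
have Rh : 1 / 2 < Re (1 + h).
  rewrite ReD /=; move: hR; rewrite ler_norml => /andP[a b]; lra.
have Rh0 : 0 < Re (1 + h) by apply: lt_trans Rh.
have nh0 : 0 < normc (1 + h) by rewrite normc_gt0 Re_gt0_neq0.
pose dl := 2 * Re h + normc h ^+ 2.
have nE : normc (1 + h) ^+ 2 = 1 + dl.
  by rewrite /dl !sqr_normcE ReD ImD /=; ring.
have dl3 : `|dl| <= 3 * normc h.
  apply: le_trans (ler_normD _ _) _; rewrite normrM (ger0_norm (sqr_ge0 _)) (ger0_norm (ler0n _ 2)).
  have : normc h ^+ 2 <= normc h by rewrite expr2 ler_piMl//; lra.
  lra.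
have ReE : Re (clog (1 + h) - h) = (ln (1 + dl) - dl) / 2 + normc h ^+ 2 / 2.
  by rewrite ReD ReN Re_clog -nE lnXn// /dl; field.
pose q := Im h / Re (1 + h).
have ImE : Im (clog (1 + h) - h) = (atan q - q) - Re h * q.
  rewrite ImD ImN Im_clog// ImD /= add0r /q.
  have : 1 + Re h != 0 by move: Rh0; rewrite ReD => /gt_eqF ->.
  by rewrite ReD /= => ?; field.
have q2 : `|q| <= 2 * normc h.
  rewrite normrM normfV (gtr0_norm Rh0) ler_pdivrMr//.
  apply: le_trans hI _; rewrite mulrAC -[leLHS]mul1r ler_wpM2r//; lra.
apply: le_trans (normc_le_ReIm _) _; rewrite ReE ImE.
have {}H1 : `|ln (1 + dl) - dl| <= e' * `|dl|.
  have := H1 dl; rewrite ln1 subr0 invr1 mul1r; apply; apply: le_lt_trans dl3 _.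
  by rewrite mulrC -ltr_pdivlMr.
have {}H2 : `|atan q - q| <= e' * `|q|.
  have := H2 q; rewrite add0r atan0 subr0 expr0n addr0 invr1 mul1r; apply.
  by apply: le_lt_trans q2 _; rewrite mulrC -ltr_pdivlMr.
have T1 : `|ln (1 + dl) - dl| <= 3 * (e' * normc h).
  by apply: le_trans H1 _; rewrite mulrCA ler_pM2l.
have T2 : `|atan q - q| <= 2 * (e' * normc h).
  by apply: le_trans H2 _; rewrite mulrCA ler_pM2l.
have T3 : `|Re h * q| <= 2 * (e' * normc h).
  rewrite normrM mulrCA; apply: ler_pM => //; apply: le_trans hR _; exact: ltW.
have T4 : normc h ^+ 2 <= e' * normc h by rewrite expr2 ler_wpM2r// ltW.
have T5 : e' * normc h <= e / 16 * normc h by rewrite ler_wpM2r.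
apply: le_trans (lerD (ler_normD _ _) (ler_normB _ _)) _.
rewrite (normrM _ 2^-1) (ger0_norm (divr_ge0 (sqr_ge0 (normc h)) (ler0n _ 2))).
rewrite (ger0_norm (x := 2^-1)) ?invr_ge0//.
have T6 := mulr_ge0 (ltW e0) n0; have T7 := mulr_ge0 (ltW e'0) n0.
move: (normr_ge0 (ln (1 + dl) - dl)) T1 T2 T3 T4 T5 T6 T7 => T8 T1 T2 T3 T4 T5 T6 T7.
lra.
Qed.

(** Near z, [clog w] is [clog z + clog (w / z)], and w / z is close to 1. *)
Lemma der_clog z : 0 < Re z -> der (@clog R) z z^-1.
Proof.
move=> z0; have zn0 := Re_gt0_neq0 z0.
have D1 : der (@clog R) (z / z) 1 by rewrite divff//; exact: der_clog1.
have D2 : der (fun w => w / z) z z^-1.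
  apply: (der_ext (f := fun w => z^-1 * w)); first by move=> w; rewrite mulrC.
  by apply: der_eq (derMl _ (der_id _)) _; rewrite mulr1.
have D3 := derD (der_cst (clog z) z) (der_comp (g := fun w => w / z) D1 D2).
rewrite /= mul1r add0r in D3.
have nz : 0 < normc z by rewrite normc_gt0.
apply: (der_near (d := (Re z / 2)%:C) _ _ D3); first by rewrite ltcR divr_gt0.
move=> w; rewrite normc_lt => wz.
have Rw : 0 < Re w.
  have := le_lt_trans (Re_le_normc _) wz; rewrite ReD ReN ltr_norml => /andP[].
  by lra.
have Rwz : 0 < Re (w / z).
  have : normc (w / z - 1) < 1.
    rewrite -(divff zn0) -mulrBl normcM normcV ltr_pdivrMr// mul1r.
    apply: lt_le_trans wz _; apply: le_trans (Re_le_normc z); rewrite gtr0_norm//; lra.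
  move/(le_lt_trans (Re_le_normc _)); rewrite ReD ReN ltr_norml => /andP[/= ].
  by lra.
by rewrite -clogM// mulrC divfK.
Qed.

Lemma cpow_neq0 z a : cpow z a != 0.
Proof. exact: cexp_neq0. Qed.

Lemma cpow1 a : cpow (1 : C) a = 1.
Proof. by rewrite /cpow clog1 mulr0 cexp0. Qed.

Lemma der_cpow z a : 0 < Re z -> der (fun w => cpow w a) z (a%:C * cpow z a / z).
Proof.
move=> z0; apply: der_eq (der_comp (der_cexp _) (derMl a%:C (der_clog z0))) _.
by rewrite mulrCA mulrA.
Qed.

Lemma normc_cpow z a : z != 0 -> normc (cpow z a) = normc z `^ a.
Proof.
move=> z0; rewrite normc_cexp ReM /= mul0r subr0 /powR gt_eqF ?normc_gt0//.
Qed.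

Lemma cpowN z a : cpow z (- a) = (cpow z a)^-1.
Proof. by rewrite /cpow rmorphN mulNr cexpN. Qed.

Lemma cpow_real (x a : R) : 0 < x -> cpow x%:C a = (x `^ a)%:C.
Proof.
move=> x0; rewrite /cpow /clog /carg /= lexx expr0n/= addr0 sqrtr_sqr gtr0_norm//.
rewrite divff ?gt_eqF// acos1; apply: eqC; rewrite /cexp /= ?(mulr0, mul0r, subr0, add0r, addr0).
  by rewrite cos0 mulr1 /powR gt_eqF.
by rewrite sin0 mulr0.
Qed.

Lemma Re_conj z : Re z^* = Re z. Proof. by case: z. Qed.
Lemma Im_conj z : Im z^* = - Im z. Proof. by case: z. Qed.

Lemma cexp_conj z : cexp z^* = (cexp z)^*.
Proof.
by rewrite /cexp Re_conj Im_conj cosN sinN; apply: eqC; rewrite /= ?(mul0r, addr0, subr0) ?mulrN.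
Qed.

Lemma cpow_conj z a : 0 < Re z -> cpow z^* a = (cpow z a)^*.
Proof.
move=> z0; rewrite /cpow -cexp_conj.
have -> : (a%:C * clog z)^* = a%:C * (clog z)^*.
  by case: (clog z) => x y; simpc; congr (_ +i* _); ring.
congr (cexp (_ * _)).
apply: clog_uniq; rewrite ?Re_conj// ?cexp_conj ?clogK ?Re_gt0_neq0//.
rewrite Im_conj normrN; have := carg_bound z0; have := pi_gt0 R.
by set p : R := pi; lra.
Qed.

(** For a <= 1 the multiples by a of the two logarithms lie in a strip of height
    pi, on which [cexp] is injective. *)
Lemma cpow_inj z w a : 0 < a <= 1 -> 0 < Re z -> 0 < Re w ->
  cpow z a = cpow w a -> z = w.
Proof.
move=> /andP[a0 a1] z0 w0 /cexp_inj_strip E.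
rewrite -(clogK (Re_gt0_neq0 z0)) -(clogK (Re_gt0_neq0 w0)); congr cexp.
apply: (mulfI (x := a%:C)); first by rewrite -normc_gt0 normc_real normr_gt0 gt_eqF.
apply: E; rewrite !ImM /= !mul0r !addr0 -mulrBr normrM (gtr0_norm a0).
have b1 := carg_bound z0; have b2 := carg_bound w0.
apply: (@le_lt_trans _ _ (`|Im (clog z)| + `|Im (clog w)|)).
  by apply: le_trans (ler_normB _ _); rewrite ler_piMl.
by have := pi_gt0 R; move: b1 b2; set p : R := pi; lra.
Qed.

(** The three factors on the right have arguments in (-pi/2, pi/2), so the sum
    of their logarithms stays within one branch of the left-hand one. *)
Lemma cpow_moebius (c a : R) z p q : 0 < c -> 0 < Re z -> 0 < Re p -> 0 < Re q ->
  0 < Re (c%:C * z / (p * q)) ->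
  cpow (c%:C * z / (p * q)) a = (c `^ a)%:C * cpow z a / (cpow p a * cpow q a).
Proof.
move=> c0 z0 p0 q0 u0.
suff E : clog (c%:C * z / (p * q)) = (ln c)%:C + clog z - (clog p + clog q).
  rewrite /cpow E mulrDr mulrDr mulrN mulrDr !(cexpD, cexpN).
  congr (_ * _ * _); rewrite /cexp /= ?(mulr0, mul0r, subr0, addr0) cos0 sin0.
  by rewrite /powR gt_eqF//; apply: eqC; rewrite /= ?(mulr1, mulr0, mul0r, subr0, addr0).
apply: clog_uniq => //.
  have cE : cexp (ln c)%:C = c%:C.
    by rewrite /cexp /= cos0 sin0 lnK ?posrE//; apply: eqC; rewrite /= ?(mulr1, mulr0, mul0r, subr0, addr0).
  by rewrite !(cexpD, cexpN) cE !clogK// Re_gt0_neq0.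
rewrite !ImD ImN ImD (_ : Im (ln c)%:C = 0)// add0r.
have := carg_bound z0; have := carg_bound p0; have := carg_bound q0; have := pi_gt0 R.
rewrite !ltr_norml; set pp : R := pi => ? /andP[? ?] /andP[? ?] /andP[? ?].
by apply/andP; split; lra.
Qed.

End PrincipalBranch.

(** * Goursat's theorem *)

Section Goursat.
Variable R : realType.
Variables (A B P Q : R -> R -> R) (x0 x1 y0 y1 : R).
Hypothesis derA : forall x y, x0 < x < x1 -> y0 < y < y1 ->
  der (fun s => A s y) x (P x y).
Hypothesis derB' : forall x y, x0 < x < x1 -> y0 < y < y1 -> der (B x) y (Q x y).
(* The common coefficient [s] says that P dx + Q dy is closed. For F holomorphic,
   P = Im F and Q = Re F satisfy this by the Cauchy-Riemann equations; only first
   order expansions are required, no continuity of partial derivatives. *)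
Hypothesis closedPQ : forall x y, x0 < x < x1 -> y0 < y < y1 -> exists p q s : R,
  forall e : R, 0 < e -> exists2 d : R, 0 < d & forall h k, `|h| < d -> `|k| < d ->
    `|P (x + h) (y + k) - P x y - (p * h + s * k)| <= e * (`|h| + `|k|) /\
    `|Q (x + h) (y + k) - Q x y - (s * h + q * k)| <= e * (`|h| + `|k|).

(* [Delta a b c d] is the integral of the form along the boundary of the
   rectangle. *)
Let S x y := B x y - A x y.
Let Delta a b c d := S b d - S b c - (S a d - S a c).

Let Delta_splitx a m b c d : Delta a b c d = Delta a m c d + Delta m b c d.
Proof. by rewrite /Delta; ring. Qed.

Let Delta_splity a b c m d : Delta a b c d = Delta a b c m + Delta a b m d.
Proof. by rewrite /Delta; ring. Qed.

Let Delta_quarter a b c d m n : exists i j : bool,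
  `|Delta a b c d| <=
  4 * `|Delta (if i then m else a) (if i then b else m)
              (if j then n else c) (if j then d else n)|.
Proof.
rewrite (Delta_splitx a m b) (Delta_splity a m c n) (Delta_splity m b c n).
set D1 := Delta a m c n; set D2 := Delta a m n d.
set D3 := Delta m b c n; set D4 := Delta m b n d.
have [|h1] := leP `|D1 + D2 + (D3 + D4)| (4 * `|D1|); first by exists false, false.
have [|h2] := leP `|D1 + D2 + (D3 + D4)| (4 * `|D2|); first by exists false, true.
have [|h3] := leP `|D1 + D2 + (D3 + D4)| (4 * `|D3|); first by exists true, false.
exists true, true; rewrite -/D4.
have := le_trans (ler_normD (D1 + D2) (D3 + D4)) (lerD (ler_normD _ _) (ler_normD _ _)).
by move: h1 h2 h3; lra.
Qed.

(** By the mean value theorem [Delta] is a combination of values of P and Q, in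
    which the linear parts of their expansions at (x, y) cancel. *)
Let Delta_small x y (e : R) : x0 < x < x1 -> y0 < y < y1 -> 0 < e ->
  exists2 dl : R, 0 < dl & forall a b c d,
    x0 < a -> a <= x <= b -> b < x1 -> y0 < c -> c <= y <= d -> d < y1 -> a < b -> c < d ->
    b - a < dl -> d - c < dl ->
    `|Delta a b c d| <= 2 * e * ((b - a) + (d - c)) ^+ 2.
Proof.
move=> x01 y01 e0; have [p [q [s H]]] := closedPQ x01 y01.
have {H}[dl dl0 H] := H _ e0; exists dl => // a b c d.
move=> xa /andP[ax xb] bx yc /andP[cy yd] dy ab cd abd cdd.
have near u v : a <= u <= b -> c <= v <= d ->
    `|P u v - P x y - (p * (u - x) + s * (v - y))| <= e * ((b - a) + (d - c)) /\
    `|Q u v - Q x y - (s * (u - x) + q * (v - y))| <= e * ((b - a) + (d - c)).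
  move=> /andP[au ub] /andP[cv vd].
  have ux : `|u - x| <= b - a by rewrite ler_norml; apply/andP; split; lra.
  have vy : `|v - y| <= d - c by rewrite ler_norml; apply/andP; split; lra.
  have := H _ _ (le_lt_trans ux abd) (le_lt_trans vy cdd).
  rewrite !subrKC => -[h1 h2].
  by split; [apply: le_trans h1 _|apply: le_trans h2 _]; rewrite ler_pM2l// lerD.
have [xi /andP[axi xib] EA] : exists2 xi, a < xi < b &
    (A b d - A b c) - (A a d - A a c) = (P xi d - P xi c) * (b - a).
  apply: (der_MVT (f := fun t => A t d - A t c)) => // t /andP[at_ tb].
  by apply: derB; apply: derA; lra.
have [et /andP[cet etd] EB] : exists2 et, c < et < d &
    (B b d - B a d) - (B b c - B a c) = (Q b et - Q a et) * (d - c).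
  apply: (der_MVT (f := fun t => B b t - B a t)) => // t /andP[ct td].
  by apply: derB; apply: derB'; lra.
have -> : Delta a b c d = (Q b et - Q a et) * (d - c) - (P xi d - P xi c) * (b - a).
  by rewrite -EA -EB /Delta /S; ring.
set E := e * ((b - a) + (d - c)) in near *.
have [n1 _] := near xi d ltac:(lra) ltac:(lra).
have [n2 _] := near xi c ltac:(lra) ltac:(lra).
have [_ n3] := near b et ltac:(lra) ltac:(lra).
have [_ n4] := near a et ltac:(lra) ltac:(lra).
set N1 := P xi d - _ - _ in n1; set N2 := P xi c - _ - _ in n2.
set N3 := Q b et - _ - _ in n3; set N4 := Q a et - _ - _ in n4.
have -> : (Q b et - Q a et) * (d - c) - (P xi d - P xi c) * (b - a) =
   (N3 - N4) * (d - c) - (N1 - N2) * (b - a).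
  by rewrite /N1 /N2 /N3 /N4; ring.
have M1 : `|N3 - N4| <= 2 * E by apply: le_trans (ler_normB _ _) _; lra.
have M2 : `|N1 - N2| <= 2 * E by apply: le_trans (ler_normB _ _) _; lra.
apply: le_trans (ler_normB _ _) _; rewrite !normrM.
rewrite (gtr0_norm (x := d - c)) ?subr_gt0// (gtr0_norm (x := b - a)) ?subr_gt0//.
have M3 : `|N3 - N4| * (d - c) <= 2 * E * (d - c) by rewrite ler_wpM2r// subr_ge0 ltW.
have M4 : `|N1 - N2| * (b - a) <= 2 * E * (b - a) by rewrite ler_wpM2r// subr_ge0 ltW.
apply: le_trans (lerD M3 M4) _.
by rewrite le_eqVlt; apply/orP; left; apply/eqP; rewrite /E; ring.
Qed.

(** Bisect into quarters, keeping one that carries at least a quarter of [Delta],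
    and apply [Delta_small] at the common point of the rectangles. *)
Lemma goursat a b c d : x0 < a -> a < b -> b < x1 -> y0 < c -> c < d -> d < y1 ->
  B b d - B b c - (B a d - B a c) = A b d - A b c - (A a d - A a c).
Proof.
move=> xa ab bx yc cd dy.
suff : Delta a b c d = 0 by rewrite /Delta /S => E; apply/eqP; rewrite -subr_eq0 -E; apply/eqP; ring.
pose w n : R := (b - a) / 2 ^+ n; pose h n : R := (d - c) / 2 ^+ n.
have w0 n : 0 < w n by rewrite divr_gt0 ?subr_gt0 ?exprn_gt0.
have h0 n : 0 < h n by rewrite divr_gt0 ?subr_gt0 ?exprn_gt0.
have wS n : w n = w n.+1 + w n.+1 by rewrite /w exprS; field; rewrite expf_neq0.
have hS n : h n = h n.+1 + h n.+1 by rewrite /h exprS; field; rewrite expf_neq0.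
pose Dl n (p : R * R) := Delta p.1 (p.1 + w n) p.2 (p.2 + h n).
have step : forall np : nat * (R * R), exists p' : R * R,
    [/\ np.2.1 <= p'.1, p'.1 + w np.1.+1 <= np.2.1 + w np.1,
        np.2.2 <= p'.2, p'.2 + h np.1.+1 <= np.2.2 + h np.1 &
        `|Dl np.1 np.2| <= 4 * `|Dl np.1.+1 p'|].
  move=> [n [x y]] /=.
  have [i [j H]] := Delta_quarter x (x + w n) y (y + h n) (x + w n.+1) (y + h n.+1).
  exists ((if i then x + w n.+1 else x), (if j then y + h n.+1 else y)).
  have w1 := w0 n.+1; have h1 := h0 n.+1; have w2 := wS n; have h2 := hS n.
  rewrite /Dl /=; move: H; case: i; case: j => H; split; rewrite //; try lra;
  by rewrite -?addrA -?wS -?hS in H *.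
have [f fP] := choice step.
pose p := fix p n := if n is m.+1 then f (m, p m) else (a, c).
have pS n := fP (n, p n).
have Dn n : `|Delta a b c d| <= 4 ^+ n * `|Dl n (p n)|.
  elim: n => [|n IH].
    by rewrite expr0 mul1r /Dl /w /h /= expr0 !divr1 !subrKC.
  apply: le_trans IH _; rewrite exprSr -mulrA ler_pM2l ?exprn_gt0//.
  by have [] := pS n.
have mono m n : (m <= n)%N -> [/\ (p m).1 <= (p n).1, (p n).1 + w n <= (p m).1 + w m,
    (p m).2 <= (p n).2 & (p n).2 + h n <= (p m).2 + h m].
  elim: n => [|n IH]; first by rewrite leqn0 => /eqP ->; rewrite !lexx.
  rewrite leq_eqVlt => /predU1P[->|]; first by rewrite !lexx.
  rewrite ltnS => /IH[i1 i2 i3 i4]; have [/= j1 j2 j3 j4 _] := pS n.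
  by split; [exact: le_trans j1|exact: le_trans i2|exact: le_trans j3|exact: le_trans i4].
have cross m n : (p m).1 <= (p n).1 + w n /\ (p m).2 <= (p n).2 + h n.
  have wm := w0 m; have wn := w0 n; have hm := h0 m; have hn := h0 n.
  by case: (leqP m n) => [/mono[]|/ltnW/mono[]] *; split; lra.
pose xs := sup (range (fun n => (p n).1)); pose ys := sup (range (fun n => (p n).2)).
have xsP n : (p n).1 <= xs <= (p n).1 + w n.
  apply/andP; split.
    apply: ub_le_sup; last by exists n.
    by exists ((p 0).1 + w 0) => _ [m _ <-]; have [] := cross m 0.
  apply: ge_sup; first by exists (p 0).1, 0.
  by move=> _ [m _ <-]; have [] := cross m n.
have ysP n : (p n).2 <= ys <= (p n).2 + h n.
  apply/andP; split.
    apply: ub_le_sup; last by exists n.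
    by exists ((p 0).2 + h 0) => _ [m _ <-]; have [] := cross m 0.
  apply: ge_sup; first by exists (p 0).2, 0.
  by move=> _ [m _ <-]; have [] := cross m n.
have w0E : a + w 0 = b by rewrite /w expr0 divr1 addrC subrK.
have h0E : c + h 0 = d by rewrite /h expr0 divr1 addrC subrK.
have xs1 : x0 < xs < x1 by have := xsP 0; rewrite /= w0E => /andP[? ?]; lra.
have ys1 : y0 < ys < y1 by have := ysP 0; rewrite /= h0E => /andP[? ?]; lra.
pose L := (b - a) + (d - c).
have L0 : 0 < L by rewrite addr_gt0 ?subr_gt0.
have bound e : 0 < e -> `|Delta a b c d| <= 2 * e * L ^+ 2.
  move=> e0; have [dl dl0 H] := Delta_small xs1 ys1 e0.
  have [n ndl] : exists n, L / 2 ^+ n < dl.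
    exists (Num.bound (L / dl)); rewrite ltr_pdivrMr ?exprn_gt0// mulrC -ltr_pdivrMr//.
    have := archi_boundP (divr_ge0 (ltW L0) (ltW dl0)); move=> /lt_trans; apply.
    by rewrite -natrX ltr_nat ltn_expl.
  have whn : w n + h n = L / 2 ^+ n by rewrite /w /h -mulrDl.
  have [m1 m2 m3 m4] := mono 0 n isT; rewrite /= w0E h0E in m1 m2 m3 m4.
  have {}H : `|Dl n (p n)| <= 2 * e * (w n + h n) ^+ 2.
    have wn := w0 n; have hn := h0 n; have xn := xsP n; have yn := ysP n.
    have wE : (p n).1 + w n - (p n).1 = w n by rewrite addrC addKr.
    have hE : (p n).2 + h n - (p n).2 = h n by rewrite addrC addKr.
    have := H (p n).1 ((p n).1 + w n) (p n).2 ((p n).2 + h n).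
    rewrite wE hE; apply => //; clear -m1 m2 m3 m4 wn hn whn ndl xa bx yc dy; lra.
  apply: le_trans (Dn n) _; apply: le_trans (ler_wpM2l _ H) _; first by rewrite exprn_ge0.
  rewrite whn expr_div_n -exprM mulnC exprM (_ : 2 ^+ 2 = 4 :> R); last by rewrite expr2; ring.
  by rewrite le_eqVlt; apply/orP; left; apply/eqP; field; rewrite expf_neq0.
apply/eqP; rewrite -normr_le0; apply/ler_addgt0Pr => e e0; rewrite add0r.
have L2 : 0 < 2 * L ^+ 2 by rewrite mulr_gt0// exprn_gt0.
apply: le_trans (bound (e / (2 * L ^+ 2)) _) _; first by rewrite divr_gt0.
by rewrite mulrAC mulrCA divff ?gt_eqF// mulr1.
Qed.

End Goursat.

Section Primitive.
Local Open Scope classical_set_scope.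
Local Open Scope ring_scope.

Lemma primitive (R : realType) (f : R -> R) (a b : R) :
  (forall x, a <= x <= b -> {for x, continuous f}) ->
  exists G : R -> R, forall x, a < x < b -> der G x (f x).
Proof.
move=> fc; pose mu := @lebesgue_measure R.
have cf : {within `[a, b], continuous f}.
  apply: continuous_in_subspaceT => x; rewrite inE/= in_itv/=; exact: fc.
have int : mu.-integrable `[a, b] (EFin \o f).
  by apply: continuous_compact_integrable => //; exact: segment_compact.
exists (fun x => \int[mu]_(t in `[a, x]) f t) => x /andP[ax xb].
have [d e] := continuous_FTC1_closed xb int ax (fc x ltac:(by rewrite !ltW)).
by apply: DeriveDef; [exact: d|rewrite -derive1E; exact: e].
Qed.

End Primitive.

(** * The mean value property and Schwarz's lemma *)

Section MeanValue.
Variable R : realType.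
Local Open Scope complex_scope.
Local Notation "x ^*" := (Num.conj x) : complex_scope.
Import Normc.
Notation C := R[i].
Notation Re := (@complex.Re R).
Notation Im := (@complex.Im R).
Implicit Types (z w : C) (g h : C -> C).

Lemma normc_cexpE (x y : R) : normc (cexp (x +i* y)) = expR x.
Proof. exact: normc_cexp. Qed.

(** In the coordinates z = exp (x + iy) the function becomes periodic in y, so
    by Goursat's theorem its integral over a period does not depend on x; the
    limit x -> -oo is the value at the centre. *)
Lemma mean_value g (r c : R) : 0 < r < 1 ->
  (forall z, 0 < normc z < 1 -> cdiff g z) ->
  (forall e : R, 0 < e -> exists2 d : R, 0 < d &
    forall z, normc z < d -> normc (g z - g 0) <= e) ->
  exists B : R -> R, 
    (forall y, c - 1 < y < c + 2 * pi + 1 -> der B y (Re (g (cexp (ln r +i* y))))) /\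
    B (c + 2 * pi) - B c = 2 * pi * Re (g 0).
Proof.
move=> /andP[r0 r1] gd gc.
pose x1 := ln r / 2; have lr : ln r < 0 by rewrite ln_lt0// r0.
have pi0 := pi_gt0 R.
pose F x y := g (cexp (x +i* y)).
have Fd (x y : R) : x < 0 -> exists D : C, forall e : R, 0 < e -> exists2 d : R, 0 < d &
    forall h k : R, `|h| < d -> `|k| < d ->
      normc (F (x + h) (y + k) - F x y - D * (h +i* k)) <= e * (`|h| + `|k|).
  move=> x0; have [|D gD] := gd (cexp (x +i* y)).
    by rewrite normc_cexpE expR_gt0 expR_lt1.
  have /derCP FD := der_comp gD (der_cexp (x +i* y)).
  exists (D * cexp (x +i* y)) => e e0; have [d d0 {}FD] := FD _ e0.
  have le_hk (h k : R) : normc (h +i* k) <= `|h| + `|k| by exact: (normc_le_ReIm (h +i* k)).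
  exists (d / 2); first by rewrite divr_gt0.
  move=> h k hd kd; have hk := le_hk h k.
  have /FD : normc (h +i* k) < d by apply: le_lt_trans hk _; lra.
  by move=> /le_trans; apply; rewrite ler_pM2l.
have FcontP (x y : R) (T : C -> R) : x < 0 -> (forall z w, `|T z - T w| <= normc (z - w)) ->
    forall e : R, 0 < e -> exists2 d : R, 0 < d & forall h k : R, `|h| < d -> `|k| < d ->
      `|T (F (x + h) (y + k)) - T (F x y)| <= e.
  move=> x0 Tl e e0; have [D HD] := Fd x y x0.
  have [d d0 {}HD] := HD 1 ltr01.
  pose M := normc D + 1; have M0 : 0 < M by rewrite ltr_wpDl ?normc_ge0.
  exists (Num.min d (e / M / 2)); first by rewrite lt_min d0 !divr_gt0.
  move=> h k; rewrite !lt_min => /andP[h1 h2] /andP[k1 k2].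
  apply: le_trans (Tl _ _) _; have H := HD h k h1 k1.
  rewrite -[F _ _ - _](subrK (D * (h +i* k))).
  apply: le_trans (le_normcD _ _) _; apply: le_trans (lerD H (lexx _)) _.
  rewrite normcM.
  have hk : normc (h +i* k) <= `|h| + `|k| by exact: (normc_le_ReIm (h +i* k)).
  have := ler_wpM2l (normc_ge0 D) hk.
  have : (`|h| + `|k|) * M <= e by rewrite -ler_pdivlMr//; lra.
  by rewrite /M mulrDr mulr1 (mulrC _ (normc D)); lra.
have ReL z w : `|Re z - Re w| <= normc (z - w) by rewrite -ReN -ReD Re_le_normc.
have ImL z w : `|Im z - Im w| <= normc (z - w) by rewrite -ImN -ImD Im_le_normc.
have cont1 (f : R -> R) (x : R) : (forall e : R, 0 < e -> exists2 d : R, 0 < d & forall h : R,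
    `|h| < d -> `|f (x + h) - f x| <= e) -> {for x, continuous f}.
  move=> H; apply/cvgrPdist_le => e e0; have [d d0 {}H] := H e e0.
  apply/nbhs_ballP; exists d => //= t; rewrite /ball/= => td.
  by rewrite distrC -{1}(subrKC x t); apply: H; rewrite distrC.
have F2pi (x y : R) : F x (y + 2 * pi) = F x y.
  rewrite /F /cexp /= (_ : 2 * pi = pi *+ 2); last by rewrite mulr_natl.
  by rewrite cosD2pi sinD2pi.
have [B BP] : exists B : R -> R -> R, forall x, x < 0 ->
    forall y, c - 1 < y < c + 2 * pi + 1 -> der (B x) y (Re (F x y)).
  have : forall x : R, exists Bx : R -> R, x < 0 ->
      forall y, c - 1 < y < c + 2 * pi + 1 -> der Bx y (Re (F x y)).
    move=> x; have [x0|x0] := ltP x 0; last by exists (fun=> 0).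
    have [y _|G GP] := @primitive R (fun y => Re (F x y)) (c - 1) (c + 2 * pi + 1).
      apply: cont1 => e e0; have [d d0 H] := FcontP x y Re x0 ReL e e0.
      by exists d => // k kd; have := H 0 k; rewrite normr0 addr0; apply.
    by exists G.
  by move=> /choice[B H]; exists B => x; exact: H.
exists (B (ln r)); split=> [y yc|]; first exact: BP.
have indep x0 : x0 < ln r -> B (ln r) (c + 2 * pi) - B (ln r) c = B x0 (c + 2 * pi) - B x0 c.
  move=> x0r.
  have [A AP] : exists A : R -> R -> R, forall x y, x0 - 1 < x < x1 -> der (fun s => A s y) x (Im (F x y)).
    have : forall y : R, exists A : R -> R, forall x, x0 - 1 < x < x1 -> der A x (Im (F x y)).
      move=> y.
      have [x /andP[_ xx1]|G GP] := @primitive R (fun x => Im (F x y)) (x0 - 1) x1.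
        apply: cont1 => e e0.
        have [|d d0 H] := FcontP x y Im _ ImL e e0; first by move: xx1; rewrite /x1; lra.
        by exists d => // h hd; have := H h 0; rewrite normr0 addr0; apply.
      by exists G.
    move=> /choice[A AP]; exists (fun x y => A y x) => x y; exact: AP.
  have per x : x0 - 1 < x < x1 -> der (fun s => A s (c + 2 * pi) - A s c) x 0.
    by move=> xx; apply: der_eq (derB (AP _ _ xx) (AP _ _ xx)) _; rewrite F2pi subrr.
  have AA : A (ln r) (c + 2 * pi) - A (ln r) c = A x0 (c + 2 * pi) - A x0 c.
    apply: (der0_cst (f := fun s => A s (c + 2 * pi) - A s c) (ltW x0r)) => x xr.
    by apply: per; rewrite /x1; lra.
  have := @goursat R A B (fun x y => Im (F x y)) (fun x y => Re (F x y))
     (x0 - 1) x1 (c - 1) (c + 2 * pi + 1).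
  move=> /(_ _ _ _ x0 (ln r) c (c + 2 * pi)); rewrite AA subrr => H.
  apply/eqP; rewrite -subr_eq0; apply/eqP; apply: H; rewrite /x1; try lra.
  - by move=> x y xx yy; exact: AP.
  - by move=> x y xx yy; apply: BP; lra.
  - move=> x y xx yy; have [|D HD] := Fd x y; first by lra.
    exists (Im D), (- Im D), (Re D) => e e0; have [d d0 {}HD] := HD e e0.
    exists d => // h k hd kd; have {HD} := HD h k hd kd.
    set T := F (x + h) (y + k) - F x y - _ => H.
    have -> : Im (F (x + h) (y + k)) - Im (F x y) - (Im D * h + Re D * k) = Im T.
      by rewrite /T !ImD !ImN ImM /=; ring.
    have -> : Re (F (x + h) (y + k)) - Re (F x y) - (Re D * h + - Im D * k) = Re T.
      by rewrite /T !ReD !ReN ReM /=; ring.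
    by split; apply: le_trans H; rewrite ?Im_le_normc ?Re_le_normc.
apply/eqP; rewrite -subr_eq0 -normr_le0; apply/ler_addgt0Pr => e e0; rewrite add0r.
have p20 : 0 < 2 * pi :> R by rewrite mulr_gt0.
have [d d0 gd0] := gc (e / (2 * pi)) ltac:(by rewrite divr_gt0).
pose x0 := Num.min (ln r) (ln d) - 1.
have m1 : Num.min (ln r) (ln d) <= ln r by rewrite ge_min lexx.
have m2 : Num.min (ln r) (ln d) <= ln d by rewrite ge_min lexx orbT.
have x0r : x0 < ln r by rewrite /x0; lra.
rewrite (indep _ x0r).
have [|y|t _ ->] := @der_MVT R (B x0) (fun y => Re (F x0 y)) c (c + 2 * pi); first lra.
  by move=> yc; apply: BP; lra.
rewrite [c + _]addrC addrK mulrC -mulrBr normrM (gtr0_norm p20) mulrC -ler_pdivlMr//.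
apply: le_trans (ReL _ _) _; apply: gd0; rewrite normc_cexpE.
rewrite -[d]lnK ?posrE// ltr_expR /x0; lra.
Qed.

(** If the mean of Re g over the circle equals its bound M, then a primitive of
    Re g - M in the angle is nonincreasing with equal values at both ends of a
    period, hence constant. *)
Lemma mean_value_max g (r M : R) : 0 < r < 1 ->
  (forall z, 0 < normc z < 1 -> cdiff g z) ->
  (forall e : R, 0 < e -> exists2 d : R, 0 < d &
    forall z, normc z < d -> normc (g z - g 0) <= e) ->
  (forall z, normc z = r -> Re (g z) <= M) ->
  Re (g 0) <= M /\ (Re (g 0) = M -> forall z, normc z = r -> Re (g z) = M).
Proof.
move=> r01 gd gc gM; have pi0 := pi_gt0 R; have /andP[r0 r1] := r01.
have lrE y : normc (cexp (ln r +i* y)) = r by rewrite normc_cexpE lnK.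
split.
  have [B [BP BE]] := mean_value 0 r01 gd gc.
  have [||t _] := @der_MVT R B (fun y => Re (g (cexp (ln r +i* y)))) 0 (0 + 2 * pi); first lra.
    by move=> y yc; apply: BP; lra.
  rewrite BE subr0 add0r mulrC => E; have := gM _ (lrE t).
  suff -> : Re (g 0) = Re (g (cexp (ln r +i* t))) by [].
  by apply: (mulIf (x := 2 * pi)) => //; rewrite gt_eqF// mulr_gt0.
move=> g0 z zr; have z0 : z != 0 by rewrite -normc_gt0 zr.
pose t := carg z.
have zE : cexp (ln r +i* t) = z by rewrite -[RHS]clogK// /clog zr.
have [B [BP BE]] := mean_value (t - pi) r01 gd gc; rewrite g0 in BE.
pose G y := B y - M * y.
have GD y : t - pi <= y <= t + pi -> der G y (Re (g (cexp (ln r +i* y))) - M).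
  move=> yt; apply: der_eq (derB (BP y _) (derMl M (der_id y))) _; first lra.
  by rewrite mulr1.
have Gle y1 y2 : t - pi <= y1 -> y1 <= y2 -> y2 <= t + pi -> G y2 <= G y1.
  move=> h1 h12 h2; apply: (der_le0_le h12 (df := fun y => Re (g (cexp (ln r +i* y))) - M)).
    by move=> x xx; apply: GD; lra.
  by move=> x _; rewrite subr_le0 gM.
have Gend : G (t + pi) = G (t - pi).
  have E : t - pi + 2 * pi = t + pi by ring.
  by move: BE; rewrite /G E => BE; apply/eqP; rewrite -subr_eq0; apply/eqP; lra.
have Gcst y : t - pi <= y <= t + pi -> G y = G (t - pi).
  move=> /andP[h1 h2].
  have l1 : G y <= G (t - pi) by apply: Gle; lra.
  have l2 : G (t + pi) <= G y by apply: Gle; lra.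
  by apply/eqP; rewrite eq_le l1 -Gend l2.
have tin : t - pi <= t <= t + pi by lra.
have := der_near (g := fun=> G (t - pi)) pi0 _ (GD t tin).
have Gc x : `|x - t| < pi -> G x = G (t - pi).
  by rewrite ltr_norml => /andP[h1 h2]; apply: Gcst; lra.
move=> /(_ Gc) D; have := der_uniq D (der_cst _ _).
by rewrite zE => /eqP; rewrite subr_eq0 => /eqP.
Qed.

(** The value D at 0 is going to be the derivative of h there. *)
Definition quot0 h (D : C) z : C := if z == 0 then D else h z / z.

Lemma quot0_cdiff h D : (forall z, normc z < 1 -> cdiff h z) ->
  forall z, 0 < normc z < 1 -> cdiff (quot0 h D) z.
Proof.
move=> hd z /andP[z0 z1]; have [a ha] := hd z z1.
have zn0 : z != 0 by rewrite -normc_gt0.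
eexists; apply: (der_near (d := (normc z)%:C) _ _ (derM ha (derV _ (der_id z)))) => //.
  by rewrite ltcR.
move=> t; rewrite normc_lt /quot0 => tz; case: eqP => // t0.
by move: tz; rewrite t0 sub0r normcN ltxx.
Qed.

Lemma quot0_cont h D : der h 0 D -> h 0 = 0 ->
  forall e : R, 0 < e -> exists2 d : R, 0 < d &
    forall z, normc z < d -> normc (quot0 h D z - quot0 h D 0) <= e.
Proof.
move=> /derCP hD h0 e e0; have [d d0 {}hD] := hD e e0; exists d => // z zd.
rewrite /quot0 eqxx; case: eqVneq => [_|z0]; first by rewrite subrr normc0 ltW.
have := hD z zd; rewrite add0r h0 subr0 -ler_pdivrMr ?normc_gt0// -normcV -normcM.
by rewrite mulrBl mulfK.
Qed.

Lemma ler_Re_normc z : Re z <= normc z.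
Proof. exact: le_trans (ler_norm _) (Re_le_normc z). Qed.

(** The mean value property of h(z)/z, whose value at the centre is D, bounds |D|
    by 1/r for every r < 1; h is rotated so that D becomes its own modulus. *)
Lemma schwarz_deriv h D : (forall z, normc z < 1 -> cdiff h z) ->
  (forall z, normc z < 1 -> normc (h z) <= 1) -> h 0 = 0 -> der h 0 D ->
  normc D <= 1.
Proof.
move=> hd h1 h0 hD; have [->|D0] := eqVneq D 0; first by rewrite normc0 ler01.
have nD0 : 0 < normc D by rewrite normc_gt0.
pose u : C := D^* / (normc D)%:C.
have nr : normc (normc D)%:C = normc D by rewrite normc_real gtr0_norm.
have nu : normc u = 1 by rewrite normcM normcV normc_conj nr divff// gt_eqF.
have uD : u * D = (normc D)%:C.
  rewrite mulrAC (mulrC _ D) mulC_conj expr2 rmorphM mulfK//.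
  by rewrite -normc_gt0 nr.
have der0_u : der (fun z => u * h z) 0 (u * D) by exact: derMl.
pose g := quot0 (fun z => u * h z) (u * D).
have gd : forall z, 0 < normc z < 1 -> cdiff g z.
  by apply: quot0_cdiff => z /hd[a ha]; exists (u * a); exact: derMl.
have hu0 : u * h 0 = 0 by rewrite h0 mulr0.
have gc := quot0_cont der0_u hu0.
have bound r : 0 < r < 1 -> normc D <= r^-1.
  move=> r01; have /andP[r0 r1] := r01.
  have [|+ _] := mean_value_max (M := r^-1) r01 gd gc; last first.
    by rewrite /g /quot0 eqxx uD.
  move=> z zr; apply: le_trans (ler_Re_normc _) _.
  rewrite /g /quot0; have [z0|z0] := eqVneq z 0.
    by move: zr r0; rewrite z0 normc0 => <-; rewrite ltxx.
  rewrite normcM normcV zr normcM nu mul1r ler_piMl ?invr_ge0 ?(ltW r0)//.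
  by apply: h1; rewrite zr.
apply/ler_addgt0Pr => e e0; have e10 : 0 < 1 + e by rewrite addr_gt0.
have := bound (1 + e)^-1; rewrite invrK; apply.
by rewrite invr_gt0 e10 invf_lt1// ltrDl.
Qed.

Lemma moebius_normc z (a : C) :
  normc (1 + a^* * z) ^+ 2 - normc (z + a) ^+ 2 = (1 - normc a ^+ 2) * (1 - normc z ^+ 2).
Proof.
rewrite !sqr_normcE !ReD !ImD ReM ImM; case: a => a b; case: z => x y /=; ring.
Qed.

Lemma moebius_den z (a : C) : normc a < 1 -> normc z < 1 -> 1 + a^* * z != 0.
Proof.
move=> a1 z1; rewrite addrC addr_eq0; apply/eqP => /(congr1 (@normc R)).
rewrite normcM normc_conj normcN normc1 => E.
suff : normc a * normc z < 1 by rewrite E ltxx.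
by rewrite mulr_ilt1 ?normc_ge0.
Qed.

Lemma moebius_lt1 z (a : C) : normc a < 1 -> normc z < 1 ->
  normc ((z + a) / (1 + a^* * z)) < 1.
Proof.
move=> a1 z1; have d0 := moebius_den a1 z1.
rewrite normcM normcV ltr_pdivrMr ?normc_gt0// mul1r.
rewrite -(ltr_sqr (x := normc _)) ?nnegrE ?normc_ge0// -subr_gt0 moebius_normc.
by rewrite mulr_gt0// subr_gt0 expr_lt1 ?normc_ge0.
Qed.

Lemma der_moebius z (a : C) : normc a < 1 -> normc z < 1 ->
  der (fun w => (w + a) / (1 + a^* * w)) z ((1 - normc a ^+ 2)%:C / (1 + a^* * z) ^+ 2).
Proof.
move=> a1 z1; have d0 := moebius_den a1 z1.
have D1 := derD (der_id z) (der_cst a z).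
have D2 := derD (der_cst 1 z) (derMl a^* (der_id z)).
apply: der_eq (derM D1 (derV (f := fun w => 1 + a^* * w) d0 D2)) _ => /=.
rewrite rmorphB/= rmorph1 -mulC_conj; field; exact: d0.
Qed.

(** Composing h with disc automorphisms that move a and [h a] to 0 reduces the
    claim to [schwarz_deriv]. *)
Lemma schwarz_pick h (a D : C) : (forall z, normc z < 1 -> cdiff h z) ->
  (forall z, normc z < 1 -> normc (h z) < 1) -> normc a < 1 -> der h a D ->
  normc D * (1 - normc a ^+ 2) <= 1 - normc (h a) ^+ 2.
Proof.
move=> hd h1 a1 hD; set c := h a.
have c1 : normc (- c) < 1 by rewrite normcN h1.
have z1 : normc (0 : C) < 1 by rewrite normc0.
pose m (b w : C) := (w + b) / (1 + b^* * w).
pose H z := m (- c) (h (m a z)).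
have m0 : m a 0 = a by rewrite /m add0r mulr0 addr0 divr1.
have hma z : normc z < 1 -> normc (h (m a z)) < 1 by move=> ?; apply/h1/moebius_lt1.
have H0 : H 0 = 0 by rewrite /H m0 /m addrN mul0r.
have Hd z b : normc z < 1 -> der h (m a z) b ->
    der H z ((1 - normc (- c) ^+ 2)%:C / (1 + (- c)^* * h (m a z)) ^+ 2 *
             (b * ((1 - normc a ^+ 2)%:C / (1 + a^* * z) ^+ 2))).
  move=> zz hb; apply: (der_comp (f := m (- c)) (g := fun z => h (m a z))).
    by apply: der_moebius => //; exact: hma.
  by apply: (der_comp (f := h) (g := m a)) => //; exact: der_moebius.
have hDm : der h (m a 0) D by rewrite m0.
have := schwarz_deriv _ _ H0 (Hd _ _ z1 hDm).
rewrite m0 -/c mulr0 addr0 expr1n divr1.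
have c21 : 0 < 1 - normc c ^+ 2 by rewrite subr_gt0 expr_lt1 ?normc_ge0// h1.
have a21 : 0 < 1 - normc a ^+ 2 by rewrite subr_gt0 expr_lt1 ?normc_ge0.
have -> : 1 + (- c)^* * c = (1 - normc c ^+ 2)%:C.
  by rewrite rmorphN mulNr mulrC mulC_conj rmorphB.
rewrite normcN; set X := 1 - normc c ^+ 2 in c21 *; set Y := 1 - normc a ^+ 2 in a21 *.
rewrite !normcM normcV expr2 normcM !normc_real !gtr0_norm//.
have -> : X / (X * X) = X^-1 by field; rewrite gt_eqF.
rewrite ler_pdivrMl// mulr1; apply.
  move=> z zz; have [b hb] := hd (m a z) (moebius_lt1 a1 zz).
  by eexists; exact: Hd zz hb.
by move=> z zz; apply/ltW/moebius_lt1 => //; exact: hma.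
Qed.

(** Schwarz's lemma, by integrating the Schwarz-Pick inequality
    y' <= (1 - y^2) / (1 - t^2) along a radius; in this way the mean value property
    is used at the centre only. *)
Lemma schwarz_lt h : (forall z, normc z < 1 -> cdiff h z) ->
  (forall z, normc z < 1 -> normc (h z) < 1) -> h 0 = 0 ->
  forall z, normc z < 1 -> normc (h z) <= normc z.
Proof.
move=> hd h1 h0 z z1.
have [->|hz0] := eqVneq (h z) 0; first by rewrite normc0 normc_ge0.
have [z0|z0] := eqVneq z 0; first by rewrite z0 h0 eqxx in hz0.
have nz : 0 < normc z by rewrite normc_gt0.
have nh : 0 < normc (h z) by rewrite normc_gt0.
pose u : C := z / (normc z)%:C; pose v : C := (h z)^* / (normc (h z))%:C.
have nu : normc u = 1 by rewrite normcM normcV normc_real gtr0_norm// divff// gt_eqF.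
have nv : normc v = 1.
  by rewrite normcM normcV normc_conj normc_real gtr0_norm// divff// gt_eqF.
pose y (t : R) := Re (v * h (0 + t%:C * u)).
have in1 t : 0 <= t <= normc z -> normc (0 + t%:C * u) < 1.
  move=> /andP[t0 tz]; rewrite add0r normcM nu mulr1 normc_real ger0_norm//.
  exact: le_lt_trans tz z1.
have yd t : 0 <= t <= normc z -> exists2 b : R, der y t b & b * (1 - t ^+ 2) <= 1 - y t ^+ 2.
  move=> tz; have [b hb] := hd _ (in1 t tz); have /andP[t0 _] := tz.
  exists (Re (v * b * u)).
    exact: (curve_der_comp (derMl v hb) (curve_der_line 0 u t)).1.
  have tn : normc (0 + t%:C * u) = t.
    by rewrite add0r normcM nu mulr1 normc_real ger0_norm.
  have := schwarz_pick hd h1 (in1 t tz) hb; rewrite tn => SP.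
  apply: (@le_trans _ _ (1 - normc (h (0 + t%:C * u)) ^+ 2)).
    apply: le_trans SP; apply: ler_wpM2r.
      rewrite subr_ge0 expr_le1//; case/andP: tz => _ /le_trans; apply; exact: ltW.
    by apply: le_trans (ler_Re_normc _) _; rewrite (normcM (v * b)) (normcM v) nu nv mulr1 mul1r.
  rewrite lerD2l lerN2 -[leLHS]real_normK ?num_real// ler_sqr ?nnegrE ?normc_ge0//.
  by apply: le_trans (Re_le_normc _) _; rewrite normcM nv mul1r.
have y1 t : 0 <= t <= normc z -> `|y t| < 1.
  move=> tz; apply: le_lt_trans (Re_le_normc _) _.
  by rewrite normcM nv mul1r; apply: h1; exact: in1.
have y0 : y 0 = 0 by rewrite /y mul0r addr0 h0 mulr0.
have yz : y (normc z) = normc (h z).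
  rewrite /y add0r /u mulrCA divff ?mulr1; last by rewrite -normc_gt0 normc_real gtr0_norm.
  rewrite /v mulrAC (mulrC _ (h z)) mulC_conj expr2 rmorphM mulfK//.
  by rewrite -normc_gt0 normc_real gtr0_norm.
rewrite -yz; set T := normc z in nz z1 yz yd y1 in1 *.
have [yp yD] : exists yp : R -> R, forall t, 0 <= t <= T ->
    der y t (yp t) /\ yp t * (1 - t ^+ 2) <= 1 - y t ^+ 2.
  have : forall t : R, exists b, 0 <= t <= T -> der y t b /\ b * (1 - t ^+ 2) <= 1 - y t ^+ 2.
    move=> t; have [tT|tT] := boolP (0 <= t <= T); last by exists 0.
    by have [b b1 b2] := yd t tT; exists b.
  by move=> /choice[f fP]; exists f => t; exact: fP.
pose Ph t := ln (1 + y t) - ln (1 - y t) - (ln (1 + t) - ln (1 - t)).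
have dln (f : R -> R) (t b : R) : 0 < f t -> der f t b -> der (fun s => ln (f s)) t ((f t)^-1 * b).
  by move=> f0 fb; exact: der_comp (is_derive1_ln f0) fb.
have PhD t : 0 <= t <= T -> der Ph t (2 * yp t / (1 - y t ^+ 2) - 2 / (1 - t ^+ 2)).
  move=> tT; have [yt _] := yD t tT; have := y1 t tT; rewrite ltr_norml => /andP[ya yb].
  have /andP[t0 tT'] := tT.
  have q1 : 0 < 1 + y t by lra.
  have q2 : 0 < 1 - y t by lra.
  have q3 : 0 < 1 + t by lra.
  have q4 : 0 < 1 - t by lra.
  have A1 := dln (fun s => 1 + y s) t _ q1 (derD (der_cst 1 t) yt).
  have A2 := dln (fun s => 1 - y s) t _ q2 (derB (der_cst 1 t) yt).
  have A3 := dln (fun s => 1 + s) t _ q3 (derD (der_cst 1 t) (der_id t)).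
  have A4 := dln (fun s => 1 - s) t _ q4 (derB (der_cst 1 t) (der_id t)).
  apply: der_eq (derB (derB A1 A2) (derB A3 A4)) _ => /=.
  have -> : 1 - y t ^+ 2 = (1 + y t) * (1 - y t) by ring.
  have -> : 1 - t ^+ 2 = (1 + t) * (1 - t) by ring.
  by field; rewrite !gt_eqF.
have : Ph T <= Ph 0.
  apply: (der_le0_le (ltW nz) PhD) => t tT; have [_ yt] := yD t tT.
  have /andP[t0 tT'] := tT; have yy := y1 t tT.
  have t1 : 0 < 1 - t ^+ 2 by rewrite subr_gt0 expr_lt1//; lra.
  have yy1 : 0 < 1 - y t ^+ 2 by rewrite subr_gt0 -real_normK ?num_real// expr_lt1.
  by rewrite subr_le0 ler_pdivrMr// mulrAC ler_pdivlMr// -mulrA ler_pM2l.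
rewrite /Ph y0 !subr0 !addr0 !subrr subr_le0.
have := y1 T; rewrite lexx (ltW nz) => /(_ isT); rewrite ltr_norml => /andP[ya yb].
have q1 : 0 < 1 + y T by lra.
have q2 : 0 < 1 - y T by lra.
have q3 : 0 < 1 + T by lra.
have q4 : 0 < 1 - T by lra.
rewrite -!ln_div ?posrE// ler_ln ?posrE ?divr_gt0// ler_pdivrMr// mulrAC ler_pdivlMr//.
by move=> ?; nra.
Qed.

Lemma schwarz h : (forall z, normc z < 1 -> cdiff h z) ->
  (forall z, normc z < 1 -> normc (h z) <= 1) -> h 0 = 0 ->
  forall z, normc z < 1 -> normc (h z) <= normc z.
Proof.
move=> hd h1 h0 z z1; apply/ler_addgt0Pr => e e0.
have e1 : 0 < 1 + e by rewrite addr_gt0.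
pose k := (1 + e)^-1.
have k0 : 0 < k by rewrite invr_gt0.
have k1 : k < 1 by rewrite invf_lt1// ltrDl.
have nk : normc k%:C = k by rewrite normc_real gtr0_norm.
have : normc (k%:C * h z) <= normc z.
  apply: (@schwarz_lt (fun z => k%:C * h z)) => //; last by rewrite h0 mulr0.
    by move=> w /hd[a ha]; exists (k%:C * a); exact: derMl.
  move=> w w1; rewrite normcM nk; apply: le_lt_trans k1.
  by rewrite ler_piMr ?(ltW k0) ?h1.
rewrite normcM nk mulrC ler_pdivrMr// => /le_trans; apply.
by rewrite mulrDr mulr1 lerD2l ler_piMl// ltW.
Qed.

(** The real part of h(z)/z is at most 1 and equals 1 at the centre, hence
    everywhere. *)
Lemma schwarz_eq h : (forall z, normc z < 1 -> cdiff h z) ->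
  (forall z, normc z < 1 -> normc (h z) <= normc z) -> h 0 = 0 -> der h 0 1 ->
  forall z, normc z < 1 -> h z = z.
Proof.
move=> hd h1 h0 hD z z1; have [->//|z0] := eqVneq z 0.
have nz : 0 < normc z by rewrite normc_gt0.
have le1 w : 0 < normc w < 1 -> normc (h w / w) <= 1.
  by move=> /andP[w0 w1]; rewrite normcM normcV ler_pdivrMr// mul1r h1.
have nr : 0 < normc z < 1 by rewrite nz.
have [|_ eq] := mean_value_max (M := 1) nr (quot0_cdiff 1 hd) (quot0_cont hD h0).
  move=> w wz; apply: le_trans (ler_Re_normc _) _; rewrite /quot0; case: eqVneq => w0.
    by rewrite normc1.
  by apply: le1; rewrite wz.
have := eq _ z erefl; rewrite /quot0 eqxx => /(_ erefl); rewrite (negbTE z0) => R1.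
have := le1 z nr; rewrite -(ler_sqr (x := normc _)) ?nnegrE ?normc_ge0//.
rewrite sqr_normcE R1 expr1n gerDl => I0.
have : h z / z = 1.
  by apply: eqC => //=; apply/eqP; rewrite -sqrf_eq0 eq_le I0 sqr_ge0.
by move/(congr1 (fun w => w * z)); rewrite divfK// mul1r.
Qed.

End MeanValue.

(** * The inner product of square-summable sequences *)

Section Ell2Inner.
Variables (R : realType) (d : option nat).
Local Open Scope classical_set_scope.
Local Open Scope ring_scope.
Local Open Scope complex_scope.
Local Notation "x ^*" := (Num.conj x) : complex_scope.
Import Normc.
Notation C := R[i].
Notation E := (ell2 R d).
Notation Re := (@complex.Re R).
Notation Im := (@complex.Im R).

Lemma cvg_complex (u : nat -> C) (z : C) :
  (fun n => Re (u n)) @ \oo --> Re z -> (fun n => Im (u n)) @ \oo --> Im z ->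
  u @ \oo --> z.
Proof.
move=> /cvgrPdist_lt uR /cvgrPdist_lt uI; apply/cvgrPdist_lt => e e0.
have eE : e = (Re e)%:C by rewrite RRe_real// gtr0_real.
have e20 : 0 < Re e / 2 by rewrite divr_gt0// -ltcR -eE.
have := uI _ e20; have := uR _ e20; apply: filterS2 => n h1 h2.
rewrite eE normc_lt; apply: le_lt_trans (normc_le_ReIm _) _.
by rewrite (splitr (Re e)) ltrD// ?ReD ?ReN ?ImD ?ImN.
Qed.

Lemma cvg_Re (u : nat -> C) (z : C) : u @ \oo --> z -> (fun n => Re (u n)) @ \oo --> Re z.
Proof.
move=> /cvgrPdist_lt H; apply/cvgrPdist_lt => e e0; have /= := H e%:C.
rewrite ltcR => /(_ e0); apply: filterS => n; rewrite normc_lt.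
by apply: le_lt_trans; rewrite -ReN -ReD Re_le_normc.
Qed.

Lemma cvg_Im (u : nat -> C) (z : C) : u @ \oo --> z -> (fun n => Im (u n)) @ \oo --> Im z.
Proof.
move=> /cvgrPdist_lt H; apply/cvgrPdist_lt => e e0; have /= := H e%:C.
rewrite ltcR => /(_ e0); apply: filterS => n; rewrite normc_lt.
by apply: le_lt_trans; rewrite -ImN -ImD Im_le_normc.
Qed.

Lemma cvgC_lim (u : nat -> C) (z : C) : u @ \oo --> z -> limn u = z.
Proof. by move=> uz; apply: cvg_lim uz; exact: norm_hausdorff. Qed.

Definition inner_series (x y : nat -> C) : nat -> C := series (fun n => x n * (y n)^*).

Lemma inner_seriesE x y n : inner_series x y n = \sum_(k < n) x k * (y k)^*.
Proof. by rewrite /inner_series /series /= big_mkord. Qed.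

Lemma Re_sum n (f : 'I_n -> C) : Re (\sum_(k < n) f k) = \sum_(k < n) Re (f k).
Proof. by elim/big_ind2 : _ => // a b c e <- <-; rewrite ReD. Qed.

Lemma Im_sum n (f : 'I_n -> C) : Im (\sum_(k < n) f k) = \sum_(k < n) Im (f k).
Proof. by elim/big_ind2 : _ => // a b c e <- <-; rewrite ImD. Qed.

Lemma cvg_dominated (x y : E) (v : nat -> R) :
  (forall n, `|v n| <= normc (x n * (y n)^*)) -> cvgn (series v).
Proof.
move=> vxy; apply: normed_cvg.
apply: (@series_le_cvg _ _ (fun n => normc (x n) ^+ 2 + normc (y n) ^+ 2)) => n.
- exact: normr_ge0.
- by rewrite addr_ge0 ?sqr_ge0.
- apply: le_trans (vxy n) _; rewrite normcM normc_conj.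
  have := sqr_ge0 (normc (x n) - normc (y n)); have := sqr_ge0 (normc (x n)).
  have := sqr_ge0 (normc (y n)); rewrite sqrrB; nra.
- rewrite (_ : series _ = sqnorm_series x + sqnorm_series y).
    by apply: is_cvgD; exact: cvg_ell2.
  apply/funext => m; rewrite /sqnorm_series [RHS]/GRing.add/= /series/=.
  by rewrite big_split.
Qed.

Lemma inner_cvg (x y : E) : inner_series x y @ \oo --> inner x y.
Proof.
have H1 : cvgn (series (fun n => Re (x n * (y n)^*))).
  by apply: (@cvg_dominated x y) => n; exact: Re_le_normc.
have H2 : cvgn (series (fun n => Im (x n * (y n)^*))).
  by apply: (@cvg_dominated x y) => n; exact: Im_le_normc.
have H : inner_series x y @ \oo --> limn (series (fun n => Re (x n * (y n)^*)))
     +i* limn (series (fun n => Im (x n * (y n)^*))).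
  apply: cvg_complex => /=.
    rewrite (_ : (fun n => _) = series (fun n => Re (x n * (y n)^*)))//.
    by apply/funext => n; rewrite inner_seriesE Re_sum /series /= big_mkord.
  rewrite (_ : (fun n => _) = series (fun n => Im (x n * (y n)^*)))//.
  by apply/funext => n; rewrite inner_seriesE Im_sum /series /= big_mkord.
have HE : inner x y = _ := cvgC_lim H.
by rewrite HE.
Qed.

Arguments inner_cvg : clear implicits.

Lemma coordD (x y : E) n : (x + y) n = x n + y n. Proof. by []. Qed.
Lemma coordZ a (x : E) n : (a *: x) n = a * x n. Proof. by []. Qed.

Lemma innerDl (x y z : E) : inner (x + y) z = inner x z + inner y z.
Proof.
have H : (inner_series x z + inner_series y z) @ \oo --> inner x z + inner y z.
  by apply: cvgD; exact: inner_cvg.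
apply: cvgC_lim; rewrite (_ : series _ = inner_series x z + inner_series y z)//.
apply/funext => n; rewrite [RHS]/GRing.add/= -/(inner_series (x + y) z n).
rewrite !inner_seriesE -big_split/=.
by apply: eq_bigr => k _; rewrite -mulrDl.
Qed.

Lemma innerZl a (x y : E) : inner (a *: x) y = a * inner x y.
Proof.
have H : (a \*: inner_series x y) @ \oo --> a *: inner x y.
  by apply: cvgZr; exact: inner_cvg.
apply: cvgC_lim; rewrite (_ : series _ = a \*: inner_series x y)//.
apply/funext => n; rewrite -/(inner_series (a *: x) y n) /= !inner_seriesE.
rewrite /GRing.scale/= mulr_sumr.
by apply: eq_bigr => k _; rewrite mulrA.
Qed.

Lemma inner_conj (x y : E) : inner y x = (inner x y)^*.
Proof.
have xy := inner_cvg x y.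
apply: cvgC_lim; apply: cvg_complex.
  rewrite Re_conj; apply: cvg_trans (cvg_Re xy).
  rewrite (_ : (fun n => _) = (fun n => Re (inner_series x y n)))//.
  apply/funext => n; rewrite -/(inner_series y x n) !inner_seriesE !Re_sum.
  by apply: eq_bigr => k _; rewrite !ReM !Re_conj !Im_conj; ring.
have H : (- (fun n => Im (inner_series x y n))) @ \oo --> - Im (inner x y).
  by apply: cvgN; exact: cvg_Im.
rewrite Im_conj; rewrite (_ : (fun n => _) = - (fun n => Im (inner_series x y n)))//.
apply/funext => n; rewrite [RHS]/GRing.opp/= -/(inner_series y x n) !inner_seriesE !Im_sum -sumrN.
by apply: eq_bigr => k _; rewrite !ImM !Re_conj !Im_conj; ring.
Qed.

(** The norm as a real number; [`|x|] is an element of [R[i]]. *)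
Definition en (x : E) : R := Num.sqrt (limn (sqnorm_series x)).

Lemma norm_en (x : E) : `|x| = (en x)%:C. Proof. by []. Qed.

Lemma en_ge0 (x : E) : 0 <= en x. Proof. exact: sqrtr_ge0. Qed.

Lemma lim_sqnorm_ge0 (x : E) : 0 <= limn (sqnorm_series x).
Proof. by apply: limr_ge; [exact: cvg_ell2|apply: nearW => n; exact: sqnorm_series_ge0]. Qed.

Lemma inner_self (x : E) : inner x x = (en x ^+ 2)%:C.
Proof.
rewrite /en sqr_sqrtr ?lim_sqnorm_ge0//.
apply: cvgC_lim; apply: cvg_complex => /=.
  rewrite (_ : (fun n => _) = sqnorm_series x); first exact: cvg_ell2.
  apply/funext => n; rewrite -/(inner_series x x n) inner_seriesE Re_sum /sqnorm_series /series /=.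
  by rewrite big_mkord; apply: eq_bigr => k _; rewrite mulC_conj.
rewrite (_ : (fun n => _) = cst 0); first exact: cvg_cst.
apply/funext => n; rewrite -/(inner_series x x n) inner_seriesE Im_sum big1// => k _.
by rewrite mulC_conj.
Qed.

Lemma en_eq0 (x : E) : en x = 0 -> x = 0.
Proof. by move=> x0; apply/eqP; rewrite -normr_eq0 norm_en x0. Qed.

Lemma enZ a (x : E) : en (a *: x) = normc a * en x.
Proof.
by have := norm_en (a *: x); rewrite normrZ norm_normc norm_en -rmorphM => /(congr1 Re).
Qed.

Lemma enN (x : E) : en (- x) = en x.
Proof. by have := norm_en (- x); rewrite normrN norm_en => /(congr1 Re). Qed.

Lemma le_enD (x y : E) : en (x + y) <= en x + en y.
Proof. by rewrite -lecR rmorphD -!norm_en ler_normD. Qed.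

Lemma inner0l (x : E) : inner 0 x = 0 :> C.
Proof. by rewrite -(scale0r (0 : E)) innerZl mul0r. Qed.

Lemma innerNl (x y : E) : inner (- x) y = - inner x y :> C.
Proof. by rewrite -scaleN1r innerZl mulN1r. Qed.

Lemma innerBl (x y z : E) : inner (x - y) z = inner x z - inner y z :> C.
Proof. by rewrite innerDl innerNl. Qed.

Lemma innerDr (x y z : E) : inner x (y + z) = inner x y + inner x z :> C.
Proof. by rewrite inner_conj innerDl conjcD -!inner_conj. Qed.

Lemma innerZr a (x y : E) : inner x (a *: y) = a^* * inner x y :> C.
Proof. by rewrite inner_conj innerZl conjcM -inner_conj. Qed.

Lemma inner0r (x : E) : inner x 0 = 0 :> C.
Proof. by rewrite inner_conj inner0l conjC0. Qed.

Lemma innerNr (x y : E) : inner x (- y) = - inner x y :> C.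
Proof. by rewrite inner_conj innerNl conjcN -inner_conj. Qed.

Lemma innerBr (x y z : E) : inner x (y - z) = inner x y - inner x z :> C.
Proof. by rewrite innerDr innerNr. Qed.

End Ell2Inner.

Section CauchySchwarz.
Variable R : realType.
Local Open Scope complex_scope.
Local Notation "x ^*" := (Num.conj x) : complex_scope.
Import Normc.
Notation C := R[i].
Notation Re := (@complex.Re R).

(** The common core of the Cauchy-Schwarz inequality in [ell2] and in abstract
    Hilbert spaces: take t = b / c. *)
Lemma discriminant (a c : R) (b : C) : 0 <= c ->
  (forall t : C, 0 <= a - 2 * Re (t^* * b) + normc t ^+ 2 * c) ->
  normc b ^+ 2 <= a * c.
Proof.
have Re2 (s : R) : Re ((s%:C * b)^* * b) = s * normc b ^+ 2.
  by rewrite conjcM conjc_realE -mulrA (mulrC b^*) mulC_conj -rmorphM.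
have nr (s : R) : normc (s%:C * b) ^+ 2 = s ^+ 2 * normc b ^+ 2.
  by rewrite normcM exprMn normc_real real_normK ?num_real.
rewrite le_eqVlt => /predU1P[<-|c0] H.
  rewrite mulr0; have [->//|b0] := eqVneq (normc b ^+ 2) 0.
  have bp : 0 < normc b ^+ 2 by rewrite lt_def b0 sqr_ge0.
  have := H (((a + 1) / normc b ^+ 2)%:C * b).
  by rewrite mulr0 addr0 Re2 divfK//; have := H 0; rewrite rmorph0 mul0r /=; lra.
have := H (c^-1%:C * b); rewrite Re2 nr.
rewrite (_ : _ + _ = a - normc b ^+ 2 / c); last by field; rewrite gt_eqF.
by rewrite subr_ge0 ler_pdivrMr.
Qed.

Lemma inner_CS d (x y : ell2 R d) : normc (inner x y) <= en x * en y.
Proof.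
rewrite -(ler_sqr (x := normc _)) ?nnegrE ?normc_ge0 ?mulr_ge0 ?en_ge0//.
rewrite exprMn; apply: discriminant => [|t]; first exact: sqr_ge0.
have := sqr_ge0 (en (x - t *: y)); rewrite -lecR -inner_self.
rewrite innerBl !innerBr !innerZl !innerZr !inner_self (inner_conj x y).
set b := inner x y.
have -> : (en x ^+ 2)%:C - t^* * b - (t * b^* - t * (t^* * (en y ^+ 2)%:C)) =
   (en x ^+ 2 - 2 * Re (t^* * b) + normc t ^+ 2 * en y ^+ 2)%:C.
  rewrite sqr_normcE; case: t => t1 t2; case: b => b1 b2; simpc.
  by apply: eqC => /=; ring.
by rewrite lecR.
Qed.

End CauchySchwarz.

(** * Automorphisms of the ball *)

Section Frechet.
Local Open Scope classical_set_scope.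
Local Open Scope ring_scope.

(** With the remainder in norm form, a candidate for the derivative can be
    supplied. *)
Lemma frechetP (K : numFieldType) (V W : normedModType K) (f : V -> W) (x : V) :
  differentiable f x <-> exists L : {linear V -> W}, continuous L /\
    forall e : K, 0 < e -> \forall h \near (0 : V), `|f (h + x) - (f x + L h)| <= e * `|h|.
Proof.
split=> [/diff_locallyP[dc /eqaddoP H]|[L [Lc H]]]; first by exists ('d f x).
have H' : f \o shift x = cst (f x) + L +o_ (0 : V) id by apply/eqaddoP.
apply/diff_locallyP; rewrite (diff_unique Lc H'); split=> //.
Qed.

Lemma differentiable_near (K : numFieldType) (V W : normedModType K) (f g : V -> W) (x : V) :
  (\forall y \near x, f y = g y) -> differentiable f x -> differentiable g x.
Proof.
move=> fg /frechetP[L [Lc H]]; apply/frechetP; exists L; split=> // e e0.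
have fgx := nbhs_singleton fg.
have fg0 : \forall h \near (0 : V), f (h + x) = g (h + x).
  by move/nbhs0P : fg; apply: filterS => h; rewrite addrC.
by have := H e e0; apply: filterS2 fg0 => h <-; rewrite fgx.
Qed.

Lemma scale_is_bilinear (K : numFieldType) (V : normedModType K) :
  bilinear_for (GRing.Scale.Law.clone _ _ *:%R _) (GRing.Scale.Law.clone _ _ *:%R _)
    (@GRing.scale K V : K^o -> V -> V).
Proof.
split=> [u'|u] a x y /=; first by rewrite scalerDl scalerA.
by rewrite scalerDr !scalerA mulrC.
Qed.

Lemma differentiable_scale (K : numFieldType) (U V : normedModType K)
    (k : U -> K^o) (f : U -> V) (x : U) :
  differentiable k x -> differentiable f x -> differentiable (fun y => k y *: f y) x.
Proof.
move=> kd fd.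
pose sM := bilinear_isBilinear.Build K K^o V V _ _ (@GRing.scale K V) (scale_is_bilinear V).
pose S : {bilinear K^o -> V -> V} := HB.pack (@GRing.scale K V : K^o -> V -> V) sM.
have Sc : continuous (fun p : K^o * V => S p.1 p.2) by exact: scale_continuous.
have D := @differentiable_bilin K K^o V V S (k x, f x) Sc.
have P := differentiable_pair kd fd.
exact: (@differentiable_comp K U (K^o * V)%type V _ _ x P D).
Qed.

End Frechet.

Section Ball.
Variables (R : realType) (d : option nat).
Local Open Scope classical_set_scope.
Local Open Scope ring_scope.
Local Open Scope complex_scope.
Local Notation "x ^*" := (Num.conj x) : complex_scope.
Import Normc.
Notation C := R[i].
Notation E := (ell2 R d).
Notation B := (uball R d).
Notation Re := (@complex.Re R).
Notation Im := (@complex.Im R).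

Lemma ell2_ext (x y : E) : (forall n, x n = y n) -> x = y.
Proof. by move=> xy; apply/val_inj/funext. Qed.

Lemma coordN (x : E) n : (- x) n = - x n. Proof. by []. Qed.

Lemma in_uballE (z : E) : in_uball z = (en z < 1).
Proof. by rewrite /in_uball norm_en ltcR. Qed.

Lemma uball_lt1 (z : B) : en (val z) < 1.
Proof. by rewrite -in_uballE; exact: (valP z). Qed.

Definition in_ball (z : E) (z1 : en z < 1) : B := exist _ z (etrans (in_uballE z) z1).

Lemma uball_inj (z w : B) : val z = val w -> z = w. Proof. exact: val_inj. Qed.

Lemma extend0_val (W : normedModType C) (f : B -> W) (z : B) : extend0 f (val z) = f z.
Proof. by rewrite /extend0 valK. Qed.

Lemma extend0E (W : normedModType C) (f : B -> W) (z : E) (z1 : en z < 1) :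
  extend0 f z = f (in_ball z1).
Proof. by rewrite -(extend0_val f (in_ball z1)). Qed.

Lemma near_ball (z : E) : en z < 1 -> \forall y \near z, en y < 1.
Proof.
move=> z1; apply/nbhs_ballP; exists (1 - en z)%:C; rewrite /= ?ltcR ?subr_gt0//.
move=> y; rewrite -ball_normE /= norm_en ltcR => zy.
have := le_enD (y - z) z; rewrite subrK (_ : en (y - z) = en (z - y)); last by rewrite -enN opprB.
move=> /le_lt_trans; apply.
by rewrite -ltrBrDr.
Qed.

(** Differentiability is local, so the extension by 0 may be replaced by a formula
    that makes sense everywhere. *)
Lemma holomorphic_of (W : normedModType C) (F : E -> W) (f : B -> W) :
  (forall z : B, f z = F (val z)) -> (forall z : B, differentiable F (val z)) ->
  holomorphic f.
Proof.
move=> fF Fd z; apply: differentiable_near (Fd z).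
have := near_ball (uball_lt1 z); apply: filterS => y y1.
by rewrite (extend0E _ y1) fF.
Qed.

Lemma holomorphic_comp (W : normedModType C) (f : B -> W) (phi : B -> B) :
  holomorphic f -> holomorphic_self_map phi -> holomorphic (f \o phi).
Proof.
move=> fd phid.
have H (z : B) : differentiable (extend0 f \o extend0 (fun z => val (phi z))) (val z).
  by apply: differentiable_comp; [exact: phid|rewrite extend0_val; exact: fd].
apply: (holomorphic_of (F := extend0 f \o extend0 (fun z => val (phi z)))) => // z.
by rewrite /= !extend0_val.
Qed.

Lemma cdiff_of_differentiable (f : C -> C) z : differentiable f z -> cdiff f z.
Proof. by move/derivable1_diffP/derivableP; exists ('D_1 f z). Qed.

Lemma differentiable_line (u : E) (z : C) : differentiable (fun t : C => t *: u) z.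
Proof. exact: differentiableZl. Qed.

(** The passage from the ball to functions of one complex variable. *)
Lemma cdiff_line (f : B -> C) (u : E) (z : C) : holomorphic f -> en (z *: u) < 1 ->
  cdiff (fun t => extend0 f (t *: u)) z.
Proof.
move=> fd z1; apply: cdiff_of_differentiable.
apply: (@differentiable_comp _ _ _ _ (fun t : C => t *: u) (extend0 f)).
  exact: differentiable_line.
by have := fd (in_ball z1).
Qed.

Definition innerl (v : E) (x : E) : C := inner x v.

Lemma innerl_linear v : linear (innerl v : E -> C^o).
Proof. by move=> a x y; rewrite /innerl innerDl innerZl. Qed.

HB.instance Definition _ v :=
  GRing.isLinear.Build C E C^o _ (innerl v) (innerl_linear v).

Lemma bounded_continuous (V W : normedModType C) (L : {linear V -> W}) (M : C) : 0 <= M ->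
  (forall x, `|L x| <= M * `|x|) -> continuous L.
Proof.
move=> M0 LM x; apply/cvgrPdist_le => e e0.
have M1 : 0 < M + 1 by rewrite ltr_wpDl.
apply/nbhs_ballP; exists (e / (M + 1)); first by rewrite /= divr_gt0.
move=> y; rewrite -ball_normE/= => xy; rewrite -linearB.
apply: le_trans (LM _) _; move: (ltW xy); rewrite ler_pdivlMr// mulrC.
by apply: le_trans; rewrite ler_wpM2r// lerDl.
Qed.

Lemma continuous_innerl v : continuous (innerl v : E -> C^o).
Proof.
apply: (@bounded_continuous E C^o (innerl v) (en v)%:C); first by rewrite lecR en_ge0.
move=> x; rewrite /= /innerl; rewrite (norm_normc (inner x v)) norm_en -rmorphM lecR mulrC.
exact: inner_CS.
Qed.

Lemma differentiable_inner v x : differentiable (fun y : E => inner y v : C^o) x.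
Proof. exact: (linear_differentiable x (@continuous_innerl v)). Qed.

Lemma inner_lt1 (z w : E) : en z < 1 -> en w < 1 -> normc (inner z w) < 1.
Proof. by move=> z1 w1; apply: le_lt_trans (inner_CS _ _) _; rewrite mulr_ilt1 ?en_ge0. Qed.

Lemma Re_1B (z : C) : normc z < 1 -> 0 < Re (1 - z).
Proof.
move=> z1; rewrite ReD ReN /= subr_gt0; apply: le_lt_trans z1.
exact: le_trans (ler_norm _) (Re_le_normc z).
Qed.

Lemma Re_1B_inner (z w : B) : 0 < Re (1 - inner (val z) (val w)).
Proof. by apply/Re_1B/inner_lt1; exact: uball_lt1. Qed.

Lemma inner1B_neq0 (z w : B) : 1 - inner (val z) (val w) != 0.
Proof. exact/Re_gt0_neq0/Re_1B_inner. Qed.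

Lemma en_lt1P (x : E) : (en x < 1) = (0 < Re (1 - inner x x)).
Proof. by rewrite inner_self -[in RHS]rmorphB/= subr_gt0 expr_lt1 ?en_ge0. Qed.

(** Rank one perturbations of the identity suffice for transitivity on spheres. *)
Definition unitary (v : E) (m : C) (x : E) : E := x + (m * inner x v) *: v.

(** Expanding <Ux, Uy> - <x, y> leaves <x, v><v, y> times this quantity. *)
Definition unitary_cond (v : E) (m : C) := m + m^* + m * m^* * inner v v = 0.

Lemma inner_unitary v m x y : unitary_cond v m ->
  inner (unitary v m x) (unitary v m y) = inner x y.
Proof.
move=> H; rewrite /unitary !innerDl !innerDr !innerZl !innerZr !conjcM.
rewrite -(inner_conj y v).
transitivity (inner x y + (m + m^* + m * m^* * inner v v) * (inner x v * inner v y)).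
  by ring.
by rewrite H mul0r addr0.
Qed.

Lemma en_of_inner (x y : E) : inner x x = inner y y -> en x = en y.
Proof.
rewrite !inner_self => -[] /eqP; rewrite eqrXn2 ?en_ge0//; exact: eqP.
Qed.

Lemma en_unitary v m x : unitary_cond v m -> en (unitary v m x) = en x.
Proof. by move=> H; apply: en_of_inner; exact: inner_unitary. Qed.

Lemma unitary_cond_conj v m : unitary_cond v m -> unitary_cond v m^*.
Proof. by rewrite /unitary_cond conjcK (addrC m^*) (mulrC m^*). Qed.

Lemma unitaryK v m x : unitary_cond v m -> unitary v m^* (unitary v m x) = x.
Proof.
move=> H; rewrite /unitary innerDl innerZl -addrA -scalerDl.
rewrite (_ : _ + _ = (m + m^* + m * m^* * inner v v) * inner x v); last by ring.
by rewrite H mul0r scale0r addr0.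
Qed.

Lemma differentiable_unitary v m x : differentiable (unitary v m) x.
Proof.
apply: (@differentiableD C E E (fun y => y) (fun y => (m * inner y v) *: v)).
  by have [] := @is_diff_id C E x.
apply: differentiableZl.
apply: (@differentiableZ C E C^o (fun y => inner y v) m).
exact: differentiable_inner.
Qed.

Definition ball_unitary v m (H : unitary_cond v m) (z : B) : B :=
  in_ball (eq_ind_r (fun t => t < 1) (uball_lt1 z) (en_unitary (val z) H)).

Lemma val_ball_unitary v m (H : unitary_cond v m) z :
  val (ball_unitary H z) = unitary v m (val z).
Proof. by []. Qed.

Lemma ball_unitary_automorphism v m (H : unitary_cond v m) : is_automorphism (ball_unitary H).
Proof.
have hol m' (H' : unitary_cond v m') : holomorphic_self_map (ball_unitary H').
  apply: (holomorphic_of (F := unitary v m')) => z; first exact: val_ball_unitary.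
  exact: differentiable_unitary.
split=> //; exists (ball_unitary (unitary_cond_conj H)); split=> // z; apply: uball_inj.
  by rewrite !val_ball_unitary unitaryK.
by rewrite !val_ball_unitary -{1}(conjcK m) unitaryK//; exact: unitary_cond_conj.
Qed.

(** For v = w - z, the map x |-> x + m <x, v> v with m = 1 / <z, v> sends z to w,
    and it is unitary because z and w have the same norm. If <z, v> = 0 then
    z = w. *)
Lemma unitary_transitive (z w : B) : en (val z) = en (val w) ->
  exists2 phi : B -> B, is_automorphism phi & phi z = w /\
    forall x y, inner (val (phi x)) (val (phi y)) = inner (val x) (val y).
Proof.
move=> zw; pose v := val w - val z.
have vv : inner v v = - (inner (val z) v + (inner (val z) v)^*).
  rewrite -inner_conj {1}/v innerBl /v !innerBr !innerBl !inner_self zw; ring.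
have [v0|v0] := eqVneq (inner (val z) v) 0.
  have : inner v v = 0 by rewrite vv v0 conjC0 addr0 oppr0.
  rewrite inner_self => -[] /eqP; rewrite sqrf_eq0 => /eqP/en_eq0/eqP.
  rewrite subr_eq0 => /eqP wz.
  have H0 : unitary_cond v 0 by rewrite /unitary_cond conjC0 !mul0r !addr0.
  exists (ball_unitary H0); first exact: ball_unitary_automorphism.
  split=> [|x y]; last by rewrite inner_unitary.
  by apply: uball_inj; rewrite val_ball_unitary /unitary mul0r scale0r addr0.
have H : unitary_cond v (inner (val z) v)^-1.
  rewrite /unitary_cond conjcV vv; field.
  by rewrite conjC_eq0 v0.
exists (ball_unitary H); first exact: ball_unitary_automorphism.
split=> [|x y]; last by rewrite inner_unitary.
apply: uball_inj; rewrite val_ball_unitary /unitary mulVf// scale1r /v.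
by rewrite subrKC.
Qed.

Definition moeb_s (a : B) : R := Num.sqrt (1 - en (val a) ^+ 2).

(** With P the orthogonal projection onto the line of a, this is
    a - P z - s (z - P z); the coefficient 1 / (1 + s) stands for (1 - s) / |a|^2,
    so that a = 0 is not an exception. *)
Definition moeb_num (a : B) (z : E) : E :=
  val a - (moeb_s a)%:C *: z - ((1 + moeb_s a)^-1%:C * inner z (val a)) *: val a.

(** The involution of the ball exchanging 0 and a. *)
Definition moeb (a : B) (z : E) : E := (1 - inner z (val a))^-1 *: moeb_num a z.

Lemma moeb_s_gt0 a : 0 < moeb_s a.
Proof. by rewrite sqrtr_gt0 subr_gt0 expr_lt1 ?en_ge0// uball_lt1. Qed.

Lemma moeb_s2 a : moeb_s a ^+ 2 = 1 - en (val a) ^+ 2.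
Proof. by rewrite sqr_sqrtr// subr_ge0 expr_le1 ?en_ge0// ltW// uball_lt1. Qed.

Lemma inner_a a : inner (val a) (val a) = 1 - (moeb_s a)%:C ^+ 2.
Proof. by rewrite inner_self -rmorphXn moeb_s2 rmorphB /= subKr. Qed.

Lemma moeb_t a : (1 + moeb_s a)^-1%:C = (1 + (moeb_s a)%:C)^-1.
Proof. by rewrite fmorphV rmorphD. Qed.

Lemma moeb_s1 a : 1 + (moeb_s a)%:C != 0.
Proof.
rewrite -(rmorph1 (real_complex R)) -rmorphD fmorph_eq0 gt_eqF//.
by rewrite addr_gt0// moeb_s_gt0.
Qed.

Lemma inner_moeb_num a (z w : E) :
  inner (moeb_num a z) (moeb_num a w) =
  (1 - inner z (val a)) * (1 - inner (val a) w) - (moeb_s a)%:C ^+ 2 * (1 - inner z w).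
Proof.
rewrite /moeb_num !innerBl !innerBr !innerZl !innerZr !conjcM !conjc_realE.
rewrite -(inner_conj w (val a)) inner_a moeb_t; field; exact: moeb_s1.
Qed.

Lemma inner_moeb a (z w : B) :
  1 - inner (moeb a (val z)) (moeb a (val w)) =
  (1 - en (val a) ^+ 2)%:C * (1 - inner (val z) (val w)) /
  ((1 - inner (val z) (val a)) * (1 - inner (val a) (val w))).
Proof.
rewrite /moeb innerZl innerZr inner_moeb_num conjcV conjcB -inner_conj conjC1.
rewrite -moeb_s2 rmorphXn/=; field.
by rewrite !inner1B_neq0.
Qed.

Lemma Re_div_norm2 (p : C) (x y : R) : p != 0 -> 0 < x -> 0 < y ->
  0 < Re (x%:C * y%:C / (p * p^*)).
Proof.
move=> p0 x0 y0; rewrite mulC_conj -fmorphV -!rmorphM /=.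
by rewrite divr_gt0 ?mulr_gt0 ?exprn_gt0 ?normc_gt0.
Qed.

Lemma moeb_lt1 a (z : B) : en (moeb a (val z)) < 1.
Proof.
rewrite en_lt1P inner_moeb inner_self -(rmorph1 (real_complex R)) -rmorphB.
rewrite rmorph1 (_ : 1 - inner (val a) (val z) = (1 - inner (val z) (val a))^*).
  apply: Re_div_norm2; first exact: inner1B_neq0.
    by rewrite subr_gt0 expr_lt1 ?en_ge0// uball_lt1.
  by rewrite subr_gt0 expr_lt1 ?en_ge0// uball_lt1.
by rewrite conjcB -inner_conj conjC1.
Qed.

Definition ball_moeb a (z : B) : B := in_ball (moeb_lt1 a z).

Lemma val_ball_moeb a z : val (ball_moeb a z) = moeb a (val z). Proof. by []. Qed.

Lemma inner_moeb_a a (z : B) :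
  inner (moeb a (val z)) (val a) = 1 - (moeb_s a)%:C ^+ 2 / (1 - inner (val z) (val a)).
Proof.
rewrite /moeb innerZl /moeb_num !innerBl !innerZl inner_a moeb_t; field.
by rewrite moeb_s1 inner1B_neq0.
Qed.

Lemma moebK a (z : B) : moeb a (moeb a (val z)) = val z.
Proof.
have s0 : (moeb_s a)%:C != 0 :> C by rewrite fmorph_eq0 gt_eqF// moeb_s_gt0.
have A1 : 1 - inner (val z) (val a) != 0 := inner1B_neq0 z a.
have s1 := moeb_s1 a.
rewrite {1}/moeb /moeb_num inner_moeb_a moeb_t; apply: ell2_ext => n.
rewrite !(coordZ, coordD, coordN) moeb_t.
rewrite opprB subrKC; move: (inner _ _) ((moeb_s a)%:C) s0 s1 A1 => A s s0 s1 A1.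
by field; rewrite s0 s1 A1.
Qed.

Lemma differentiable_moeb a (x : B) : differentiable (moeb a) (val x).
Proof.
have D1 : differentiable (fun z : E => (1 - inner z (val a))^-1 : C^o) (val x).
  apply: differentiableV; last exact: inner1B_neq0.
  apply: (@differentiableB C E C^o (cst 1) (fun z => inner z (val a))).
    exact: differentiable_cst.
  exact: differentiable_inner.
apply: (differentiable_scale D1).
apply: (@differentiableB C E E (fun z => val a - (moeb_s a)%:C *: z)
   (fun z => ((1 + moeb_s a)^-1%:C * inner z (val a)) *: val a)).
  apply: (@differentiableB C E E (cst (val a)) (fun z => (moeb_s a)%:C *: z)).
    exact: differentiable_cst.
  apply: (@differentiableZ C E E (fun z => z)).
  by have [] := @is_diff_id C E (val x).
apply: differentiableZl.
apply: (@differentiableZ C E C^o (fun z => inner z (val a))).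
exact: differentiable_inner.
Qed.

Lemma ball_moebK a : involutive (ball_moeb a).
Proof. by move=> z; apply: uball_inj; rewrite !val_ball_moeb moebK. Qed.

Lemma ball_moeb_automorphism a : is_automorphism (ball_moeb a).
Proof.
have hol : holomorphic_self_map (ball_moeb a).
  apply: (holomorphic_of (F := moeb a)) => z; first exact: val_ball_moeb.
  exact: differentiable_moeb.
by split=> //; exists (ball_moeb a); split=> //; exact: ball_moebK.
Qed.

Lemma moeb0 a : ball_moeb a (origin R d) = a.
Proof.
apply: uball_inj; rewrite val_ball_moeb /moeb /moeb_num /= inner0l.
by rewrite subr0 invr1 scale1r scaler0 subr0 mulr0 scale0r subr0.
Qed.

Lemma moeba a : ball_moeb a a = origin R d.
Proof. by rewrite -{2}(moeb0 a) ball_moebK. Qed.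

Lemma automorphism_comp (phi psi : B -> B) :
  is_automorphism phi -> is_automorphism psi -> is_automorphism (phi \o psi).
Proof.
move=> [ph [phi' [ph' phK phK']]] [ps [psi' [ps' psK psK']]].
have comp (f g : B -> B) : holomorphic_self_map f -> holomorphic_self_map g ->
    holomorphic_self_map (f \o g).
  by move=> fh gh; exact: (holomorphic_comp (f := fun z => val (f z))).
split; first exact: comp.
by exists (psi' \o phi'); split; [exact: comp|exact: can_comp|exact: can_comp].
Qed.

Lemma differentiable_ext0 (chi : B -> B) : holomorphic_self_map chi ->
  forall (u : E) (t : C), en (t *: u) < 1 ->
  differentiable (fun s : C => extend0 (fun z => val (chi z)) (s *: u)) t.
Proof.
move=> hc u t t1; apply: (@differentiable_comp _ _ _ _ (fun t : C => t *: u)).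
  exact: differentiable_line.
by have := hc (in_ball t1).
Qed.

(** Schwarz's lemma for the component of chi in the direction of [chi z], along
    the complex line of z. *)
Lemma schwarz_ball (chi : B -> B) : holomorphic_self_map chi ->
  chi (origin R d) = origin R d -> forall z, en (val (chi z)) <= en (val z).
Proof.
move=> hc c0 z.
have [w0|w0] := eqVneq (en (val (chi z))) 0; first by rewrite w0 en_ge0.
have wp : 0 < en (val (chi z)) by rewrite lt_def w0 en_ge0.
have [z0|z0] := eqVneq (en (val z)) 0.
  have zE : z = origin R d by apply: uball_inj; exact: en_eq0.
  by rewrite zE c0.
have zp : 0 < en (val z) by rewrite lt_def z0 en_ge0.
pose u := (en (val z))^-1%:C *: val z; pose v := (en (val (chi z)))^-1%:C *: val (chi z).
have nV (x : R) : 0 < x -> normc x^-1%:C = x^-1.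
  by move=> x0; rewrite normc_real gtr0_norm// invr_gt0.
have nu : en u = 1 by rewrite enZ nV// mulVf.
have nv : en v = 1 by rewrite enZ nV// mulVf.
pose h (t : C) := inner (extend0 (fun z => val (chi z)) (t *: u)) v.
have tu t : normc t < 1 -> en (t *: u) < 1 by move=> t1; rewrite enZ nu mulr1.
have hd t : normc t < 1 -> cdiff h t.
  move=> t1; apply: cdiff_of_differentiable.
  apply: (@differentiable_comp _ _ _ _ _ (fun y : E => inner y v : C^o)).
    exact: (differentiable_ext0 hc (tu t t1)).
  exact: differentiable_inner.
have h1 t : normc t < 1 -> normc (h t) <= 1.
  move=> t1; rewrite /h (extend0E _ (tu t t1)); apply: le_trans (inner_CS _ _) _.
  by rewrite nv mulr1 ltW// uball_lt1.
have h0 : h 0 = 0.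
  have H0 : en (0 *: u) < 1 by apply: tu; rewrite normc0.
  rewrite /h (extend0E _ H0) (_ : in_ball H0 = origin R d) ?c0 ?inner0l//.
  by apply: uball_inj; rewrite /= scale0r.
have nt : normc (en (val z))%:C = en (val z) by rewrite normc_real gtr0_norm.
have t1 : normc (en (val z))%:C < 1 by rewrite nt uball_lt1.
have := schwarz hd h1 h0 t1; rewrite nt /h.
have -> : (en (val z))%:C *: u = val z.
  by rewrite scalerA -rmorphM divff// rmorph1 scale1r.
rewrite extend0_val /v innerZr inner_self conjc_realE -rmorphM normc_real expr2 mulKf//.
by rewrite ger0_norm// en_ge0.
Qed.

(** Schwarz's lemma for chi and its inverse shows that chi preserves norms, and so
    does its derivative A at 0. The component of chi along [A u] on the line of a
    unit vector u is then extremal in Schwarz's lemma, which gives chi = A on that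
    line. *)
Lemma automorphism_fix0 (chi : B -> B) : is_automorphism chi ->
  chi (origin R d) = origin R d ->
  forall z w, inner (val (chi z)) (val (chi w)) = inner (val z) (val w).
Proof.
move=> [hc [chi' [hc' cK cK']]] c0.
have c0' : chi' (origin R d) = origin R d by rewrite -{1}c0 cK.
have iso z : en (val (chi z)) = en (val z).
  by apply/eqP; rewrite eq_le schwarz_ball//= -{1}(cK z) schwarz_ball.
set F := extend0 (fun z => val (chi z)).
have Fd : differentiable F 0 by have := hc (origin R d).
have F0 : F 0 = 0 by rewrite -[0]/(val (origin R d)) /F extend0_val c0.
have nF x : en x < 1 -> en (F x) = en x.
  by move=> x1; rewrite /F (extend0E _ x1) iso.
pose A := 'd F (0 : E) : E -> E.
have AZ (a : C) x : A (a *: x) = a *: A x by exact: linearZ.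
have AD x y : A (x + y) = A x + A y by exact: linearD.
have AF e : 0 < e -> exists2 r : R, 0 < r & forall x, en x < r -> en (F x - A x) <= e * en x.
  move=> e0; have /diff_locallyP[_ /eqaddoP H] := Fd.
  have := H e%:C; rewrite ltcR => /(_ e0) /= /nbhs_ballP[r /= r0 {}H].
  have rE : r = (Re r)%:C by rewrite RRe_real// gtr0_real.
  exists (Re r); first by rewrite -ltcR -rE.
  move=> x xr; have := H x; rewrite -ball_normE /= sub0r normrN norm_en rE ltcR => /(_ xr).
  rewrite -rmorphM (_ : (F \o _ - _) x = F x - A x); first by rewrite norm_en lecR.
  by transitivity (F (x + 0) - (F 0 + A x)); [|rewrite addr0 F0 add0r].
(* Compare A with F at small multiples of x. *)
have nA x : en (A x) = en x.
  have [x0|x0] := eqVneq (en x) 0.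
    by rewrite (en_eq0 x0) -(scale0r (0 : E)) AZ !scale0r.
  have xp : 0 < en x by rewrite lt_def x0 en_ge0.
  apply/eqP; rewrite -subr_eq0 -normr_le0; apply/ler_addgt0Pr => e e0; rewrite add0r.
  have [r r0 H] := AF (e / en x) ltac:(by rewrite divr_gt0).
  pose t := Num.min (r / en x / 2) (1 / en x / 2).
  have t0 : 0 < t by rewrite lt_min !divr_gt0.
  have nt : normc t%:C = t by rewrite normc_real gtr0_norm.
  have t1 : t <= r / en x / 2 by rewrite ge_min lexx.
  have t2 : t <= 1 / en x / 2 by rewrite ge_min lexx orbT.
  have {}t1 : t * en x <= r / 2 by rewrite -ler_pdivlMr// mulrAC.
  have {}t2 : t * en x <= 1 / 2 by rewrite -ler_pdivlMr// mulrAC.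
  have := H (t%:C *: x); rewrite enZ nt.
  have -> : t * en x < r by lra.
  move=> /(_ isT); rewrite AZ => {}H.
  have nFt : en (F (t%:C *: x)) = t * en x by rewrite nF enZ nt//; lra.
  have D1 := le_enD (F (t%:C *: x) - t%:C *: A x) (t%:C *: A x).
  have D2 := le_enD (t%:C *: A x - F (t%:C *: x)) (F (t%:C *: x)).
  rewrite subrK nFt enZ nt in D1; rewrite subrK nFt enZ nt in D2.
  have sym : en (t%:C *: A x - F (t%:C *: x)) = en (F (t%:C *: x) - t%:C *: A x).
    by rewrite -enN opprB.
  rewrite sym in D2.
  have tE : e / en x * (t * en x) = t * e by field.
  rewrite tE in H.
  have : t * `|en (A x) - en x| <= t * e.
    rewrite -(gtr0_norm t0) -normrM (gtr0_norm t0) mulrBr ler_norml.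
    by apply/andP; split; lra.
  by rewrite ler_pM2l.
have FA x : en x < 1 -> F x = A x.
  move=> x1; have [x0|x0] := eqVneq (en x) 0.
    by rewrite (en_eq0 x0) F0 -(scale0r (0 : E)) AZ !scale0r.
  have xp : 0 < en x by rewrite lt_def x0 en_ge0.
  pose u := (en x)^-1%:C *: x.
  have nu : en u = 1 by rewrite enZ normc_real gtr0_norm ?invr_gt0// mulVf.
  have tu t : normc t < 1 -> en (t *: u) < 1 by move=> t1; rewrite enZ nu mulr1.
  have xu : x = (en x)%:C *: u by rewrite scalerA -rmorphM divff// rmorph1 scale1r.
  pose h (t : C) := inner (F (t *: u)) (A u).
  have hd t : normc t < 1 -> cdiff h t.
    move=> t1; apply: cdiff_of_differentiable.
    apply: (@differentiable_comp _ _ _ _ _ (fun y : E => inner y (A u) : C^o)).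
      exact: (differentiable_ext0 hc (tu t t1)).
    exact: differentiable_inner.
  have h1 t : normc t < 1 -> normc (h t) <= normc t.
    move=> t1; apply: le_trans (inner_CS _ _) _.
    by rewrite nA nF ?tu// enZ nu !mulr1.
  have h0 : h 0 = 0 by rewrite /h scale0r F0 inner0l.
  have hD : der h 0 1.
    apply/derCP => e e0; have [r r0 H] := AF e e0; exists r => // t tr.
    rewrite add0r h0 subr0 mul1r /h.
    have {2}-> : t = inner (t *: A u) (A u) by rewrite innerZl inner_self nA nu expr1n mulr1.
    rewrite -innerBl -AZ; apply: le_trans (inner_CS _ _) _; rewrite nA nu mulr1.
    by have := H (t *: u); rewrite enZ nu mulr1; apply.
  have nx : normc (en x)%:C < 1 by rewrite normc_real gtr0_norm.
  have hx := schwarz_eq hd h1 h0 hD nx; rewrite /h -xu in hx.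
  apply/eqP; rewrite -subr_eq0; apply/eqP/en_eq0.
  have : inner (F x - A x) (F x - A x) = 0.
    rewrite innerBl !innerBr !inner_self nA nF//.
    have E1 : inner (F x) (A x) = (en x ^+ 2)%:C.
      by rewrite {2}xu AZ innerZr hx conjc_realE -rmorphM.
    by rewrite (inner_conj (F x)) E1 conjc_realE !subrr.
  by rewrite inner_self => -[] /eqP; rewrite sqrf_eq0 => /eqP.
(* Polarization. *)
have AA x y : inner (A x) (A y) = inner x y.
  have pol (a : C) : inner (A x) (A x) + (a^* * inner (A x) (A y) + a * inner (A y) (A x)) =
      inner x x + (a^* * inner x y + a * inner y x).
    have : inner (A (x + a *: y)) (A (x + a *: y)) = inner (x + a *: y) (x + a *: y).
      by rewrite !inner_self nA.
    rewrite AD AZ !innerDl !innerDr !innerZl !innerZr !inner_self !nA => H.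
    by apply: (addIr (a * a^* * (en y ^+ 2)%:C)); rewrite -!addrA; move: H; rewrite -!addrA !mulrA.
  have P1 := pol 1; have P2 := pol 'i%C; rewrite !inner_self nA in P1 P2.
  have {}P1 := addrI _ P1; have {}P2 := addrI _ P2.
  rewrite conjC1 !mul1r in P1.
  have ci : ('i%C)^* = - 'i%C :> C by apply: eqC => /=; rewrite ?oppr0.
  rewrite ci !mulNr ![- _ + _]addrC -!mulrBr in P2.
  have i0 : 'i%C != 0 :> C by rewrite -normc_gt0 /= expr0n expr1n add0r sqrtr1.
  have {}P2 := mulfI i0 P2.
  apply: (mulfI (x := 2)); first by rewrite pnatr_eq0.
  have := congr2 (fun u v => u - v) P1 P2 => /= H.
  rewrite !mulr_natl !mulr2n; transitivity
     (inner (A x) (A y) + inner (A y) (A x) - (inner (A y) (A x) - inner (A x) (A y))); first by ring.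
  by rewrite H; ring.
move=> z w.
have val_chi y : val (chi y) = A (val y) by rewrite -FA ?uball_lt1// /F extend0_val.
by rewrite !val_chi AA.
Qed.

(** Every automorphism is the composition of an involution exchanging 0 with the
    preimage of 0 and of a unitary map. *)
Lemma automorphism_inner (phi : B -> B) : is_automorphism phi ->
  exists a : B, forall z w,
  1 - inner (val (phi z)) (val (phi w)) =
  (1 - en (val a) ^+ 2)%:C * (1 - inner (val z) (val w)) /
  ((1 - inner (val z) (val a)) * (1 - inner (val a) (val w))).
Proof.
move=> ph; have [_ [phi' [_ phK phK']]] := ph.
pose a := phi' (origin R d); exists a => z w.
have chi0 : (phi \o ball_moeb a) (origin R d) = origin R d by rewrite /= moeb0 phK'.
have H := automorphism_fix0 (automorphism_comp ph (ball_moeb_automorphism a)) chi0.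
have E y : (phi \o ball_moeb a) (ball_moeb a y) = phi y := congr1 phi (ball_moebK a y).
transitivity (1 - inner (val (ball_moeb a z)) (val (ball_moeb a w))); last exact: inner_moeb.
by congr (1 - _); rewrite -[phi z]E -[phi w]E; exact: H.
Qed.

End Ball.

(** * Reproducing kernel Hilbert spaces *)

Section RkhsTheory.
Variables (R : realType) (X : Type) (H : rkhs R X).
Local Open Scope classical_set_scope.
Local Open Scope ring_scope.
Local Open Scope complex_scope.
Local Notation "x ^*" := (Num.conj x) : complex_scope.
Import Normc.
Notation C := R[i].
Notation Re := (@complex.Re R).
Notation Im := (@complex.Im R).
Implicit Types (f g h : H).

Lemma ipDl f g h : ip H (f + g) h = ip H f h + ip H g h.
Proof. exact: linearDl. Qed.

Lemma ipZl a f h : ip H (a *: f) h = a * ip H f h.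
Proof. exact: linearZl_LR. Qed.

Lemma ip_conj f g : ip H g f = (ip H f g)^*.
Proof. by rewrite hermC expr0 mul1r. Qed.

Lemma ipDr f g h : ip H h (f + g) = ip H h f + ip H h g.
Proof. by rewrite ip_conj ipDl conjcD -!ip_conj. Qed.

Lemma ipZr a f h : ip H h (a *: f) = a^* * ip H h f.
Proof. by rewrite ip_conj ipZl conjcM -ip_conj. Qed.

Lemma ip0l f : ip H 0 f = 0. Proof. by rewrite -(scale0r (0 : H)) ipZl mul0r. Qed.
Lemma ip0r f : ip H f 0 = 0. Proof. by rewrite ip_conj ip0l conjC0. Qed.
Lemma ipNl f g : ip H (- f) g = - ip H f g.
Proof. by rewrite -scaleN1r ipZl mulN1r. Qed.
Lemma ipNr f g : ip H f (- g) = - ip H f g.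
Proof. by rewrite ip_conj ipNl conjcN -ip_conj. Qed.

Lemma norm_hnorm f : `|f| = (hnorm f)%:C.
Proof. by rewrite /hnorm RRe_real// ger0_real. Qed.

Lemma hnorm_ge0 f : 0 <= hnorm f.
Proof. by rewrite -ler0c -norm_hnorm normr_ge0. Qed.

Lemma ip_self f : ip H f f = (hnorm f ^+ 2)%:C.
Proof. by rewrite -ip_norm norm_hnorm -rmorphXn. Qed.

Lemma hnorm_eq0 f : hnorm f = 0 -> f = 0.
Proof. by move=> f0; apply/eqP; rewrite -normr_eq0 norm_hnorm f0. Qed.

Lemma hnorm0 : hnorm (0 : H) = 0.
Proof. by rewrite /hnorm normr0. Qed.

Lemma hnormZ a f : hnorm (a *: f) = normc a * hnorm f.
Proof. by have := normrZ a f; rewrite !norm_hnorm norm_normc -rmorphM => /complexI. Qed.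

Lemma hnormN f : hnorm (- f) = hnorm f.
Proof. by rewrite /hnorm normrN. Qed.

Lemma le_hnormD f g : hnorm (f + g) <= hnorm f + hnorm g.
Proof. by have := ler_normD f g; rewrite !norm_hnorm -rmorphD lecR. Qed.

Lemma hnorm2D f g (t : C) :
  hnorm (f + t *: g) ^+ 2 = hnorm f ^+ 2 + 2 * Re (t^* * ip H f g) + normc t ^+ 2 * hnorm g ^+ 2.
Proof.
apply: complexI; rewrite -ip_self ipDl !ipDr !ipZl !ipZr !ip_self (ip_conj f g).
rewrite sqr_normcE; case: t => t1 t2; case: (ip H f g) => b1 b2; simpc.
by apply: eqC => /=; ring.
Qed.

Lemma ip_CS f g : normc (ip H f g) <= hnorm f * hnorm g.
Proof.
rewrite -(ler_sqr (x := normc _)) ?nnegrE ?normc_ge0 ?mulr_ge0 ?hnorm_ge0//.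
rewrite exprMn; apply: discriminant => [|t]; first exact: sqr_ge0.
have := sqr_ge0 (hnorm (f + (- t) *: g)); rewrite hnorm2D normcN.
by rewrite conjcN mulNr ReN mulrN.
Qed.

Lemma rkhs_complete (u : nat -> H) :
  (forall e : R, 0 < e -> exists N, forall m n, (N <= m)%N -> (N <= n)%N -> hnorm (u n - u m) < e) ->
  exists g, forall e : R, 0 < e -> exists N, forall n, (N <= n)%N -> hnorm (g - u n) < e.
Proof.
move=> uc; have : cvgn u.
  apply: cauchy_cvg; apply: cauchy_exP => e e0.
  have eE : e = (Re e)%:C by rewrite RRe_real// gtr0_real.
  have [|N HN] := uc (Re e); first by rewrite -ltcR -eE.
  exists (u N); exists N => // n /= Nn; rewrite -ball_normE /= norm_hnorm eE ltcR.
  by apply: HN.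
move=> ug; exists (limn u) => e e0; have /cvgrPdist_lt := ug.
move=> /(_ e%:C); rewrite ltcR => /(_ e0)[N _ HN]; exists N => n Nn.
by have := HN n Nn; rewrite /= norm_hnorm ltcR.
Qed.

(** The Riesz representation of a bounded conjugate linear functional, given by
    its graph Q on a subspace: minimize |h|^2 - 2 Re l over Q. The last conclusion,
    that g is a limit of elements of the subspace, is what yields the density of
    the kernel functions. *)
Lemma riesz (Q : H -> C -> Prop) (c : R) : 0 <= c -> Q 0 0 ->
  (forall h l h' l' a, Q h l -> Q h' l' -> Q (h + a *: h') (l + a^* * l')) ->
  (forall h l, Q h l -> normc l <= c * hnorm h) ->
  exists g, [/\ forall h l, Q h l -> ip H g h = l, hnorm g <= c &
    forall e : R, 0 < e -> exists h l, Q h l /\ hnorm (g - h) < e].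
Proof.
move=> c0 Q0 QD Qc.
pose J h (l : C) : R := hnorm h ^+ 2 - 2 * Re l.
have Jlb h l : Q h l -> - c ^+ 2 <= J h l.
  move=> /Qc hl; rewrite /J; have := ler_Re_normc l; have := sqr_ge0 (hnorm h - c).
  rewrite sqrrB; set p := c * hnorm h in hl; rewrite (mulrC (hnorm h)) -/p.
  by rewrite -mulr_natl; lra.
pose S := [set x | exists h l, Q h l /\ x = J h l].
have SJ h l : Q h l -> S (J h l) by exists h, l.
have S0 : has_inf S.
  by split; [exists (J 0 0); exact: SJ|exists (- c ^+ 2) => _ [h [l [q ->]]]; exact: Jlb].
pose mu := inf S.
have muJ h l : Q h l -> mu <= J h l by move=> q; apply: ge_inf; [exact: S0.2|exact: SJ].
pose ep n : R := n.+1%:R^-1.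
have ep0 n : 0 < ep n by rewrite invr_gt0.
have : forall n, exists p : H * C, Q p.1 p.2 /\ J p.1 p.2 < mu + ep n.
  by move=> n; have [_ [h [l [q ->]]] Jn] := inf_adherent (ep0 n) S0; exists (h, l).
move=> /choice[p pP].
(* Parallelogram identity: near minimizers are close to each other. *)
have par m n : hnorm ((p n).1 - (p m).1) ^+ 2 <= 2 * ep n + 2 * ep m.
  have [qn Jn] := pP n; have [qm Jm] := pP m.
  have Qmid : Q (2^-1%:C *: ((p n).1 + (p m).1)) (2^-1%:C * ((p n).2 + (p m).2)).
    have := QD _ _ _ _ 2^-1%:C Q0 (QD _ _ _ _ 1 qn qm).
    by rewrite !add0r scale1r conjC1 mul1r conjc_realE.
  have := muJ _ _ Qmid; rewrite /J hnormZ exprMn normc_real ger0_norm ?invr_ge0// ReM /= mul0r subr0 ReD.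
  have E1 := hnorm2D (p n).1 (p m).1 1; have E2 := hnorm2D (p n).1 (p m).1 (-1).
  rewrite scale1r normc1 conjC1 !mul1r expr1n in E1.
  rewrite scaleN1r normcN normc1 conjcN conjC1 !mulN1r expr1n mul1r ReN in E2.
  rewrite E1 E2; move: Jn Jm; rewrite /J => Jn Jm K.
  have q4 : 2^-1 ^+ 2 = 1 / 4 :> R by field.
  rewrite q4 in K; lra.
have epl (e : R) : 0 < e -> exists N, forall n, (N <= n)%N -> ep n < e.
  move=> e0; exists (Num.bound e^-1) => n Nn; rewrite /ep invf_plt ?posrE//.
  have := archi_boundP (ltW (x := 0) (y := e^-1) ltac:(by rewrite invr_gt0)).
  by move=> /lt_le_trans; apply; rewrite ler_nat ltnW.
have [|g gP] := @rkhs_complete (fun n => (p n).1).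
  move=> e e0; have [N HN] := epl (e ^+ 2 / 4) ltac:(by rewrite divr_gt0// exprn_gt0).
  exists N => m n Nm Nn; rewrite -(ltr_sqr (x := hnorm _)) ?nnegrE ?hnorm_ge0 ?(ltW e0)//.
  apply: le_lt_trans (par m n) _; have := HN m Nm; have := HN n Nn; lra.
exists g.
have rep h l : Q h l -> ip H g h = l.
  move=> q; apply/eqP; rewrite -subr_eq0; apply/eqP/eq0_normc/eqP.
  rewrite -normr_le0 ger0_norm ?normc_ge0//.
  apply/ler_addgt0Pr => e e0; rewrite add0r.
  pose M := hnorm h + 1; have M0 : 0 < M by rewrite ltr_wpDl ?hnorm_ge0.
  have [N1 H1] := gP (e / 2 / M) ltac:(by rewrite !divr_gt0).
  have [N2 H2] := epl ((e / 2 / M) ^+ 2) ltac:(by rewrite exprn_gt0 ?divr_gt0).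
  pose n := maxn N1 N2; have [qn Jn] := pP n.
  (* J cannot decrease by more than [ep n] in the direction of h. *)
  have d1 : normc (ip H (p n).1 h - l) ^+ 2 <= ep n * hnorm h ^+ 2.
    apply: discriminant => [|t]; first exact: sqr_ge0.
    have := muJ _ _ (QD _ _ _ _ (- t) qn q); rewrite /J hnorm2D normcN.
    rewrite conjcN !mulNr mulrBr !ReD !ReN; move: Jn; rewrite /J; lra.
  have {}d1 : normc (ip H (p n).1 h - l) <= e / 2.
    rewrite -(ler_sqr (x := normc _)) ?nnegrE ?normc_ge0 ?divr_ge0 ?(ltW e0)//.
    apply: le_trans d1 _; have := H2 n (leq_maxr _ _) => /ltW.
    rewrite expr_div_n ler_pdivlMr ?exprn_gt0//; apply: le_trans.
    rewrite ler_wpM2l ?(ltW (ep0 _))// ler_sqr ?nnegrE ?hnorm_ge0 ?(ltW M0)//.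
    by rewrite lerDl.
  have d2 : normc (ip H (g - (p n).1) h) <= e / 2.
    apply: le_trans (ip_CS _ _) _; have := ltW (H1 n (leq_maxl _ _)).
    rewrite ler_pdivlMr//; apply: le_trans; rewrite ler_wpM2l ?hnorm_ge0//.
    by rewrite lerDl.
  have -> : ip H g h - l = ip H (g - (p n).1) h + (ip H (p n).1 h - l).
    by rewrite ipDl ipNl; ring.
  by apply: le_trans (le_normcD _ _) _; rewrite (splitr e) lerD.
have app (e : R) : 0 < e -> exists h l, Q h l /\ hnorm (g - h) < e.
  by move=> /gP[N HN]; exists (p N).1, (p N).2; split; [exact: (pP N).1|exact: HN].
split=> //.
have [->|g0] := eqVneq (hnorm g) 0; first by [].
have gp : 0 < hnorm g by rewrite lt_def g0 hnorm_ge0.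
rewrite -(ler_pM2l gp) -expr2; apply/ler_addgt0Pr => e e0.
have cg : 0 < hnorm g + c by rewrite ltr_wpDr.
have [h [l [q gh]]] := app (e / (hnorm g + c)) ltac:(by rewrite divr_gt0).
have : hnorm g ^+ 2 = Re (ip H g (g - h)) + Re l.
  by rewrite -ReD -(rep _ _ q) ipDr ipNr subrK ip_self.
move=> ->; have l1 := le_trans (ler_Re_normc _) (ip_CS g (g - h)).
have l2 := le_trans (ler_Re_normc l) (Qc _ _ q).
have l3 : hnorm h <= hnorm g + hnorm (g - h).
  by rewrite -{1}(subKr g h) -(hnormN (g - h)); exact: le_hnormD.
have l4 : c * hnorm h <= c * (hnorm g + hnorm (g - h)) by rewrite ler_wpM2l.
have l5 : (hnorm g + c) * hnorm (g - h) <= e by rewrite mulrC -ler_pdivlMr// ltW.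
by rewrite mulrDr in l4; rewrite mulrDl in l5; rewrite (mulrC (hnorm g) c); lra.
Qed.

Variable K : X -> X -> C.

Lemma kernel_functions : is_kernel H K -> exists k : X -> H,
  (forall x y, ev (k y) x = K x y) /\ (forall f y, ev f y = ip H f (k y)).
Proof.
move=> HK; have : forall y, exists k : H, ev k = K^~ y /\ forall f : H, ev f y = ip H f k.
  by move=> y; have [k k1 k2] := HK y; exists k.
move=> /choice[k kP]; exists k; split=> [x y|f y]; first by rewrite (kP y).1.
exact: (kP y).2.
Qed.

Variable k : X -> H.
Hypothesis evk : forall x y, ev (k y) x = K x y.
Hypothesis ipk : forall f y, ev f y = ip H f (k y).

Lemma ev_ext f g : (forall x, ev f x = ev g x) -> f = g.
Proof. by move=> fg; apply: ev_inj; apply/funext. Qed.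

Lemma evD f g x : ev (f + g) x = ev f x + ev g x.
Proof. by rewrite !ipk ipDl. Qed.

Lemma evZ a f x : ev (a *: f) x = a * ev f x.
Proof. by rewrite !ipk ipZl. Qed.

Lemma kernelE x y : K x y = ip H (k y) (k x).
Proof. by rewrite -evk ipk. Qed.

Lemma kernel_conj x y : K y x = (K x y)^*.
Proof. by rewrite !kernelE -ip_conj. Qed.

Lemma kernel_diag x : K x x = (hnorm (k x) ^+ 2)%:C.
Proof. by rewrite kernelE ip_self. Qed.

Definition comb (s : seq (C * X)) : H := \sum_(p <- s) p.1 *: k p.2.

Lemma ip_suml (I : Type) (s : seq I) (F : I -> H) g :
  ip H (\sum_(i <- s) F i) g = \sum_(i <- s) ip H (F i) g.
Proof.
elim: s => [|i s IH]; first by rewrite !big_nil ip0l.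
by rewrite !big_cons ipDl IH.
Qed.

Lemma ip_sumr (I : Type) (s : seq I) (F : I -> H) g :
  ip H g (\sum_(i <- s) F i) = \sum_(i <- s) ip H g (F i).
Proof.
elim: s => [|i s IH]; first by rewrite !big_nil ip0r.
by rewrite !big_cons ipDr IH.
Qed.

Lemma ip_combr f s : ip H f (comb s) = \sum_(p <- s) p.1^* * ev f p.2.
Proof. by rewrite ip_sumr; apply: eq_bigr => p _; rewrite ipZr ipk. Qed.

Lemma ip_comb s t : ip H (comb t) (comb s) =
  \sum_(p <- s) \sum_(q <- t) p.1^* * q.1 * K p.2 q.2.
Proof.
rewrite ip_combr; apply: eq_bigr => p _.
rewrite ipk ip_suml mulr_sumr; apply: eq_bigr => q _.
by rewrite ipZl kernelE mulrA.
Qed.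

(** The representative of the functional that G induces on combinations of kernel
    functions takes the values of G. *)
Lemma rkhs_mem (G : X -> C) (c : R) : 0 <= c ->
  (forall s, normc (\sum_(p <- s) p.1^* * G p.2) <= c * hnorm (comb s)) ->
  exists g : H, (forall x, ev g x = G x) /\ hnorm g <= c.
Proof.
move=> c0 Gc.
pose Q h (l : C) := exists s : seq (C * X), h = comb s /\ l = \sum_(p <- s) p.1^* * G p.2.
have [||h l [s [-> ->]]|g [gP gc _]] := @riesz Q c c0.
- by exists [::]; rewrite /comb !big_nil.
- move=> h l h' l' a [s [-> ->]] [s' [-> ->]].
  exists (s ++ map (fun p => (a * p.1, p.2)) s'); rewrite /comb !big_cat !big_map /=.
  split; congr (_ + _).
    by rewrite scaler_sumr; apply: eq_bigr => p _; rewrite scalerA.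
  by rewrite mulr_sumr; apply: eq_bigr => p _; rewrite conjcM mulrA.
- exact: Gc.
exists g; split=> // x; rewrite ipk; apply: gP; exists [:: (1, x)].
by rewrite /comb !big_seq1 /= scale1r conjC1 mul1r.
Qed.

(** The representative of [ip H f] on combinations of kernel functions has the
    values of f and is a limit of such combinations. *)
Lemma comb_dense f (e : R) : 0 < e -> exists s, hnorm (f - comb s) < e.
Proof.
move=> e0.
pose Q h (l : C) := exists s : seq (C * X), h = comb s /\ l = ip H f (comb s).
have [||h l [s [-> ->]]|g [gP gc gd]] := @riesz Q (hnorm f) (hnorm_ge0 f).
- by exists [::]; rewrite /comb !big_nil ip0r.
- move=> h l h' l' a [s [-> ->]] [s' [-> ->]].
  exists (s ++ map (fun p => (a * p.1, p.2)) s'); rewrite -ipZr -ipDr.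
  suff -> : comb s + a *: comb s' = comb (s ++ map (fun p => (a * p.1, p.2)) s') by [].
  rewrite /comb !big_cat !big_map /=; congr (_ + _).
  by rewrite scaler_sumr; apply: eq_bigr => p _; rewrite scalerA.
- exact: ip_CS.
have -> : f = g.
  apply: ev_ext => x; rewrite !ipk; apply/esym; apply: gP; exists [:: (1, x)].
  by rewrite /comb big_seq1 /= scale1r.
by have [h [l [[s [-> _]]]]] := gd e e0; exists s.
Qed.

(** Lists may repeat points, so that this covers the matrices
    [L (x i) (x j)] of all finite families x. *)
Definition psd (L : X -> X -> C) : Prop := forall s : seq (C * X),
  0 <= \sum_(p <- s) \sum_(q <- s) p.1^* * q.1 * L p.2 q.2.

Lemma kernel_psd : psd K.
Proof. by move=> s; rewrite -ip_comb ip_self lecR sqr_ge0. Qed.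

Lemma mult_norm_le1 psi : (mult_norm H psi <= 1%:E)%E ->
  forall f g, (forall x, ev g x = psi x * ev f x) -> hnorm g <= hnorm f.
Proof.
move=> psi1 f g gf.
have [f0|f0] := eqVneq (hnorm f) 0.
  rewrite f0 (_ : g = 0) ?hnorm0//; apply: ev_ext => x.
  by rewrite gf (hnorm_eq0 f0) !ipk !ip0l mulr0.
have fp : 0 < hnorm f by rewrite lt_def f0 hnorm_ge0.
have nV : normc (hnorm f)^-1%:C = (hnorm f)^-1 by rewrite normc_real gtr0_norm ?invr_gt0.
have : ((hnorm ((hnorm f)^-1%:C *: g))%:E <= 1%:E)%E.
  apply: le_trans psi1; apply: ereal_sup_ubound.
  exists ((hnorm f)^-1%:C *: f), ((hnorm f)^-1%:C *: g); split=> //.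
    by rewrite hnormZ nV mulVf.
  by move=> x; rewrite !evZ gf mulrCA.
by rewrite lee_fin hnormZ nV mulrC ler_pdivrMr// mul1r.
Qed.

(** The adjoint of multiplication by psi maps [k x] to [(psi x)^* *: k x], and it is
    a contraction too. *)
Lemma contractive_comb psi :
  (forall f g, (forall x, ev g x = psi x * ev f x) -> hnorm g <= hnorm f) ->
  multiplier H psi -> forall s,
  hnorm (comb (map (fun p => ((psi p.2)^* * p.1, p.2)) s)) <= hnorm (comb s).
Proof.
move=> psi1 psim s; set u := comb _; have [g gu] := psim u.
have gs := psi1 _ _ gu.
have : ip H g (comb s) = (hnorm u ^+ 2)%:C.
  rewrite -ip_self {2}/u !ip_combr big_map; apply: eq_bigr => p _ /=.
  by rewrite gu conjcM conjcK; ring.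
move=> E; have := ip_CS g (comb s); rewrite E normc_real ger0_norm ?sqr_ge0// => le1.
have [->|u0] := eqVneq (hnorm u) 0; first exact: hnorm_ge0.
have up : 0 < hnorm u by rewrite lt_def u0 hnorm_ge0.
rewrite -(ler_pM2l up) -expr2; apply: le_trans le1 _.
by rewrite ler_wpM2r ?hnorm_ge0.
Qed.

(** The adjoint of f |-> (f o phi) / delta maps [k x] to [k (phi x)] divided by the
    conjugate of [delta x]; by the assumption on K these vectors have the same Gram
    matrix as the [k x]. *)
Lemma weighted_composition (phi : X -> X) (delta : X -> C) :
  (forall x, delta x != 0) ->
  (forall x y, K (phi x) (phi y) = delta x * (delta y)^* * K x y) ->
  forall f, exists g : H, (forall x, ev g x = ev f (phi x) / delta x) /\ hnorm g <= hnorm f.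
Proof.
move=> d0 KE f; apply: rkhs_mem; first exact: hnorm_ge0.
move=> s; pose t := map (fun p : C * X => (p.1 / (delta p.2)^*, phi p.2)) s.
have nt : hnorm (comb t) = hnorm (comb s).
  have : ip H (comb t) (comb t) = ip H (comb s) (comb s).
    rewrite !ip_comb big_map; apply: eq_bigr => p _.
    rewrite big_map; apply: eq_bigr => q _ /=; rewrite KE conjcM conjcV conjcK; field.
    by rewrite conjC_eq0 !d0.
  rewrite !ip_self => /complexI/eqP; rewrite eqrXn2 ?hnorm_ge0//; exact: eqP.
rewrite -nt; apply: le_trans (ip_CS _ _); rewrite ip_combr big_map.
rewrite le_eqVlt; apply/orP; left; apply/eqP.
by congr normc; apply: eq_bigr => p _ /=; rewrite conjcM conjcV conjcK; ring.
Qed.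

(** The weighted composition operators of phi and of its inverse are mutually
    inverse contractions. Conjugating with them turns multiplication by psi into
    multiplication by psi o phi, as the weights cancel. *)
Lemma isometric_composition_of_kernel (phi phi' : X -> X) (delta : X -> C) :
  cancel phi phi' -> cancel phi' phi -> (forall x, delta x != 0) ->
  (forall x y, K (phi x) (phi y) = delta x * (delta y)^* * K x y) ->
  isometric_composition H phi.
Proof.
move=> phK phK' d0 KE.
have U := weighted_composition d0 KE.
have d0' x : (delta (phi' x))^-1 != 0 by rewrite invr_eq0.
have KE' x y : K (phi' x) (phi' y) = (delta (phi' x))^-1 * ((delta (phi' y))^-1)^* * K x y.
  have := KE (phi' x) (phi' y); rewrite !phK' => ->; rewrite conjcV; field.
  by rewrite conjC_eq0 !d0.
have U' := weighted_composition (delta := fun x => (delta (phi' x))^-1) d0' KE'.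
move=> psi psim; split.
  move=> f; have [f' [f'P _]] := U' f; have [g' g'P] := psim f'.
  have [g [gP _]] := U g'; exists g => x.
  by rewrite gP g'P f'P phK invrK /= mulrA mulfK.
congr (ereal_sup _); apply/seteqP; split=> e /= [f [g [f1 gf ->]]].
  have [f' [f'P f'n]] := U' f; have [g' [g'P g'n]] := U' g.
  exists f', g'; split; first exact: le_trans f1.
    by move=> x; rewrite f'P g'P gf /= phK' mulrA.
  congr (_%:E); apply/eqP; rewrite eq_le g'n andbT.
  have [g'' [g''P]] := U g'; rewrite (_ : g'' = g)//.
  by apply: ev_ext => x; rewrite g''P g'P phK invrK mulfK.
have [f' [f'P f'n]] := U f; have [g' [g'P g'n]] := U g.
exists f', g'; split; first exact: le_trans f1.
  by move=> x; rewrite f'P g'P gf /= mulrA.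
congr (_%:E); apply/eqP; rewrite eq_le g'n andbT.
have [g'' [g''P]] := U' g'; rewrite (_ : g'' = g)//.
by apply: ev_ext => x; rewrite g''P g'P phK' invrK divfK.
Qed.

End RkhsTheory.

(** * Positive semidefinite matrices and kernels *)

Section PsdMatrix.
Variable R : realType.
Local Open Scope sesquilinear_scope.
Local Open Scope complex_scope.
Local Notation "x ^*" := (Num.conj x) : complex_scope.
Import Normc.
Notation C := R[i].

Local Notation "M ^t*" := (M ^t Num.conj) (at level 30) : sesquilinear_scope.

Lemma tcE m n (A : 'M[C]_(m, n)) i j : (A ^t*) i j = (A j i)^*.
Proof. by rewrite !mxE. Qed.

Lemma tcM m n p (A : 'M[C]_(m, n)) (B : 'M[C]_(n, p)) : (A *m B)^t* = B^t* *m A^t*.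
Proof. by rewrite trmx_mul map_mxM. Qed.

Lemma tcK m n (A : 'M[C]_(m, n)) : A^t*^t* = A.
Proof. by apply/matrixP => i j; rewrite !tcE conjCK. Qed.

Lemma tcD m n (A B : 'M[C]_(m, n)) : (A + B)^t* = A^t* + B^t*.
Proof. by apply/matrixP => i j; rewrite tcE !mxE rmorphD. Qed.

Lemma tcN m n (A : 'M[C]_(m, n)) : (- A)^t* = - A^t*.
Proof. by apply/matrixP => i j; rewrite tcE !mxE rmorphN. Qed.

Lemma tcZ m n a (A : 'M[C]_(m, n)) : (a *: A)^t* = a^* *: A^t*.
Proof. by apply/matrixP => i j; rewrite tcE !mxE rmorphM. Qed.

Lemma mul_tc00 n (u v : 'rV[C]_n) : (u *m v^t*) 0 0 = \sum_l u 0 l * (v 0 l)^*.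
Proof. by rewrite mxE; apply: eq_bigr => l _; rewrite tcE. Qed.

Lemma row_norm_ge0 n (u : 'rV[C]_n) : 0 <= (u *m u^t*) 0 0.
Proof. by rewrite mul_tc00 sumr_ge0// => l _; rewrite mul_conjC_ge0. Qed.

Lemma row_norm_eq0 n (u : 'rV[C]_n) : (u *m u^t*) 0 0 = 0 -> u = 0.
Proof.
rewrite mul_tc00 => /eqP; rewrite psumr_eq0 => [|l _]; last exact: mul_conjC_ge0.
move=> /allP u0; apply/rowP => l; rewrite mxE; apply/eqP.
by have := u0 l (mem_index_enum _); rewrite mul_conjC_eq0.
Qed.

Lemma mul_tc_eq0 m n (A : 'M[C]_(m, n)) : A *m A^t* = 0 -> A = 0.
Proof.
move=> A0; apply/row_matrixP => i; rewrite row0; apply: row_norm_eq0.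
have -> : (row i A)^t* = A^t* *m (delta_mx 0 i)^t*.
  by rewrite -tcM -rowE.
by rewrite rowE -mulmxA (mulmxA A) A0 mul0mx mulmx0 mxE.
Qed.

Lemma psd_spectral n (A : 'M[C]_n) : A^t* = A -> possemidef A ->
  exists (P : 'M[C]_n) (D : 'rV[C]_n),
    [/\ P *m P^t* = 1%:M, A = P^t* *m diag_mx D *m P & forall i, 0 <= D 0 i].
Proof.
move=> Ah Ap; pose P := spectralmx A; pose D := spectral_diag A.
have Pu : P \is unitarymx := spectral_unitarymx A.
have PP : P *m P^t* = 1%:M by apply/unitarymxP.
have An : A \is normalmx by apply/normalmxP; rewrite -[_ ^t*]/(A^t*) Ah.
have AE : A = P^t* *m diag_mx D *m P.
  have /orthomx_spectralP E := An.
  by rewrite -[P^t*](invmx_unitary Pu); exact: E.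
exists P, D; split=> // i.
have := Ap ((row i P)^t*).
suff -> : (((row i P)^t*)^t Num.conj *m A *m (row i P)^t*) 0 0 = D 0 i by [].
rewrite -[_ ^t Num.conj]/(((row i P)^t*)^t*) tcK {1}AE rowE tcM !mulmxA.
have -> : delta_mx 0 i *m P *m P^t* *m diag_mx D *m P *m P^t* = delta_mx 0 i *m diag_mx D :> 'rV_n.
  by rewrite -!mulmxA PP mulmx1 (mulmxA P) PP mul1mx.
rewrite mul_mx_diag mxE (bigD1 i)//= big1 ?addr0 => [|j ji]; last first.
  by rewrite !mxE (negbTE ji) andbF mul0r mul0r.
by rewrite !mxE !eqxx /= conjC1 mulr1 mul1r.
Qed.

Lemma diag_tc n (D : 'rV[C]_n) : (diag_mx D)^t* = diag_mx (map_mx Num.conj D).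
Proof. by rewrite tr_diag_mx map_diag_mx. Qed.

Lemma psd_factor n (A : 'M[C]_n) : A^t* = A -> possemidef A ->
  exists G : 'M[C]_n, A = G *m G^t*.
Proof.
move=> Ah Ap; have [P [D [PP AE D0]]] := psd_spectral Ah Ap.
pose S := diag_mx (\row_i sqrtC (D 0 i)).
have SS : S *m S^t* = diag_mx D.
  rewrite /S diag_tc mulmx_diag; congr diag_mx; apply/rowP => i; rewrite !mxE.
  by rewrite conj_Creal ?ger0_real ?sqrtC_ge0// -expr2 sqrtCK.
exists (P^t* *m S); rewrite tcM tcK mulmxA -(mulmxA _ S) SS; exact: AE.
Qed.

(** Inverting the nonzero eigenvalues only: Pick matrices may be singular. *)
Lemma psd_pinv n (A : 'M[C]_n) : A^t* = A -> possemidef A ->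
  exists B : 'M[C]_n, [/\ B^t* = B, A *m B *m A = A & B *m A *m B = B].
Proof.
move=> Ah Ap; have [P [D [PP AE D0]]] := psd_spectral Ah Ap.
pose D' : 'rV[C]_n := \row_i (D 0 i)^-1.
have mid (X Y : 'M[C]_n) : P^t* *m X *m P *m (P^t* *m Y *m P) = P^t* *m (X *m Y) *m P.
  by rewrite !mulmxA -(mulmxA _ P) PP mulmx1.
have dd i : D 0 i * (D 0 i)^-1 * D 0 i = D 0 i.
  by have [->|d0] := eqVneq (D 0 i) 0; rewrite ?mulr0// divff// mul1r.
have dd' i : (D 0 i)^-1 * D 0 i * (D 0 i)^-1 = (D 0 i)^-1.
  by have [->|d0] := eqVneq (D 0 i) 0; rewrite ?invr0 ?mulr0// mulVf// mul1r.
exists (P^t* *m diag_mx D' *m P); split.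
- rewrite !tcM tcK diag_tc mulmxA; congr (_ *m diag_mx _ *m _).
  apply/rowP => i; rewrite !mxE fmorphV; congr (_^-1).
  by apply: conj_Creal; rewrite ger0_real.
- rewrite AE (mid (diag_mx D)).
  rewrite (mid (diag_mx D *m diag_mx D')).
  rewrite !mulmx_diag.
  have -> // : \row_j ((\row_j0 (D 0 j0 * D' 0 j0)) 0 j * D 0 j) = D.
  by apply/rowP => i; rewrite !mxE dd.
- rewrite AE (mid (diag_mx D')) (mid (diag_mx D' *m diag_mx D)).
  rewrite !mulmx_diag.
  have -> // : \row_j ((\row_j0 (D' 0 j0 * D 0 j0)) 0 j * D' 0 j) = D'.
  by apply/rowP => i; rewrite !mxE dd'.
Qed.

Lemma possemidefE n (A : 'M[C]_n) :
  possemidef A <-> forall a : 'I_n -> C, 0 <= \sum_i \sum_j (a i)^* * a j * A i j.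
Proof.
have E (v : 'cV[C]_n) : (v^t Num.conj *m A *m v) 0 0 = \sum_i \sum_j (v i 0)^* * v j 0 * A i j.
  rewrite mxE exchange_big /=; apply: eq_bigr => j _; rewrite mxE mulr_suml.
  by apply: eq_bigr => i _; rewrite !mxE; ring.
split=> [H a|H v]; last by rewrite E; exact: H.
have := H (\col_i a i); rewrite E.
by under eq_bigr do under eq_bigr do rewrite !mxE.
Qed.

Section PsdKernel.
Variable X : Type.
Implicit Types L : X -> X -> C.

Lemma psd_fin L : psd L -> forall (I : finType) (x : I -> X) (a : I -> C),
  0 <= \sum_i \sum_j (a i)^* * a j * L (x i) (x j).
Proof.
move=> Lp I x a; have := Lp (map (fun i => (a i, x i)) (enum I)).
rewrite big_map big_enum /=.
by under eq_bigr do rewrite big_map big_enum /=.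
Qed.

Lemma psd_ord L : (forall n (x : 'I_n -> X) (a : 'I_n -> C),
    0 <= \sum_i \sum_j (a i)^* * a j * L (x i) (x j)) -> psd L.
Proof.
move=> H s; have := H (size s) (fun i => (tnth (in_tuple s) i).2) (fun i => (tnth (in_tuple s) i).1).
move=> /le_trans; apply; rewrite le_eqVlt; apply/orP; left; apply/eqP.
by rewrite [RHS]big_tnth; apply: eq_bigr => i _; rewrite [RHS]big_tnth.
Qed.

Lemma psd_possemidef L n (x : 'I_n -> X) : psd L -> possemidef (\matrix_(i, j) L (x i) (x j)).
Proof.
move=> Lp; apply/possemidefE => a; have := psd_fin Lp x a.
by under [X in _ -> 0 <= X]eq_bigr do under eq_bigr do rewrite mxE.
Qed.

(** Schur's product theorem: factoring the second kernel as a Gram matrix turns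
    the product into a sum of rescaled copies of the first kernel. *)
Lemma psd_mul L1 L2 : psd L1 -> psd L2 -> (forall x y, L2 y x = (L2 x y)^*) ->
  psd (fun x y => L1 x y * L2 x y).
Proof.
move=> p1 p2 h2; apply: psd_ord => n x a.
have [|G GE] := psd_factor _ (psd_possemidef x p2).
  by apply/matrixP => i j; rewrite tcE !mxE -h2.
have -> : \sum_i \sum_j (a i)^* * a j * (L1 (x i) (x j) * L2 (x i) (x j)) =
    \sum_l \sum_i \sum_j (a i * (G i l)^*)^* * (a j * (G j l)^*) * L1 (x i) (x j).
  rewrite [RHS]exchange_big /=; apply: eq_bigr => i _; rewrite [RHS]exchange_big /=.
  apply: eq_bigr => j _; have /matrixP/(_ i j) := GE; rewrite !mxE => ->.
  rewrite !mulr_sumr; apply: eq_bigr => l _; rewrite tcE conjcM conjcK; ring.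
by apply: sumr_ge0 => l _; exact: psd_fin.
Qed.

Lemma psd_sum L1 L2 : psd L1 -> psd L2 -> psd (fun x y => L1 x y + L2 x y).
Proof.
move=> p1 p2 s; apply: le_trans (addr_ge0 (p1 s) (p2 s)) _.
rewrite -big_split le_eqVlt; apply/orP; left; apply/eqP; apply: eq_bigr => p _.
by rewrite -big_split; apply: eq_bigr => q _ /=; rewrite mulrDr.
Qed.

Lemma psd_scale L (c : C) : 0 <= c -> psd L -> psd (fun x y => c * L x y).
Proof.
move=> c0 p1 s; apply: le_trans (mulr_ge0 c0 (p1 s)) _.
rewrite mulr_sumr le_eqVlt; apply/orP; left; apply/eqP; apply: eq_bigr => p _.
by rewrite mulr_sumr; apply: eq_bigr => q _ /=; ring.
Qed.

Lemma psd_one : psd (fun _ _ : X => 1 : C).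
Proof.
move=> s; rewrite (_ : \sum_(p <- s) _ = (\sum_(p <- s) p.1)^* * \sum_(p <- s) p.1).
  by rewrite mulrC mul_conjC_ge0.
rewrite rmorph_sum mulr_suml; apply: eq_bigr => p _; rewrite mulr_sumr.
by apply: eq_bigr => q _; rewrite mulr1.
Qed.

Lemma psd_vector (I : finType) L (x : I -> X) N (u : I -> 'rV[C]_N) : psd L ->
  0 <= \sum_i \sum_j L (x i) (x j) * (u i *m (u j)^t*) 0 0.
Proof.
move=> Lp; rewrite (_ : \sum_i _ = \sum_l \sum_i \sum_j
    ((u i 0 l)^*)^* * (u j 0 l)^* * L (x i) (x j)).
  by apply: sumr_ge0 => l _; exact: psd_fin.
rewrite [RHS]exchange_big; apply: eq_bigr => i _; rewrite [RHS]exchange_big; apply: eq_bigr => j _.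
by rewrite mul_tc00 mulr_sumr; apply: eq_bigr => l _; rewrite conjcK; ring.
Qed.

End PsdKernel.

End PsdMatrix.

(** * Tangential Nevanlinna-Pick interpolation *)

Section PickInterpolation.
Variables (R : realType) (X : Type).
Local Open Scope sesquilinear_scope.
Local Open Scope complex_scope.
Local Notation "x ^*" := (Num.conj x) : complex_scope.
Local Notation "M ^t*" := (M ^t Num.conj) (at level 30) : sesquilinear_scope.
Import Normc.
Notation C := R[i].

Variables (F K : X -> X -> C).
Hypothesis Fpsd : psd F.
Hypothesis Fconj : forall x y, F y x = (F x y)^*.
Hypothesis Fdiag : forall x, F x x < 1.
Hypothesis Kpsd : psd K.
Hypothesis KF : forall x y, K x y * (1 - F x y) = 1.

Variables (m r N : nat) (x : 'I_m -> X).
Variables (E L : 'M[C]_(m, r)) (Ga : 'M[C]_(m, N)).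

(* The lurking isometry. Put F = 1 - 1/K. The equality [HG] of two Gram matrices
   says that row p of the direct sum of E with the F-weighted Ga can be sent
   isometrically to row p of T = [L Ga]. The interpolant is the transfer function
   of this isometry: the state [Gax y] solves the fixed point equation
   Gax y = (E^* + Gax y Ga^* D y) Gp Ga, and Phi y = (E^* + Gax y Ga^* D y) Gp L,
   where Gp is a generalized inverse of G = T T^*. *)
Let D (y : X) : 'M[C]_m := diag_mx (\row_p F y (x p)).
Let Hf : 'M[C]_m := \matrix_(p, q) (F (x p) (x q) * (Ga *m Ga^t*) p q).
Let G : 'M[C]_m := L *m L^t* + Ga *m Ga^t*.
Hypothesis HG : E *m E^t* + Hf = G.
Variable Gp : 'M[C]_m.
Hypotheses (Gph : Gp^t* = Gp) (GGp : G *m Gp *m G = G) (GpG : Gp *m G *m Gp = Gp).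

Let conj_sum (I : finType) (f : I -> C) : (\sum_i f i)^* = \sum_i (f i)^*.
Proof. exact: rmorph_sum. Qed.

Let GpL : G *m Gp *m L = L /\ G *m Gp *m Ga = Ga.
Proof.
pose T := row_mx L Ga.
have TT : T *m T^t* = G by rewrite /T tr_row_mx map_col_mx mul_row_col.
have E0 : (T - G *m Gp *m T) *m T^t* = 0 by rewrite mulmxBl -(mulmxA (G *m Gp)) TT GGp subrr.
have : (T - G *m Gp *m T) *m (T - G *m Gp *m T)^t* = 0.
  by rewrite [X in _ *m X]tcD tcN !tcM mulmxBr !mulmxA E0 !mul0mx subrr.
move=> /mul_tc_eq0/eqP; rewrite subr_eq0 /T mul_mx_row => /eqP/eq_row_mx[<- <-].
by [].
Qed.

(** The right-hand side minus the left-hand side is a Schur complement in the Gram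
    matrix formed by c, the u i and the interpolation data. *)
Let schur n (c : 'rV[C]_r) (y : 'I_n -> X) (u : 'I_n -> 'rV[C]_N) (mu : 'rV[C]_m) :
  mu = c *m E^t* + \sum_i u i *m Ga^t* *m D (y i) ->
  (mu *m Gp *m mu^t*) 0 0 <=
  (c *m c^t*) 0 0 + \sum_i \sum_j F (y i) (y j) * (u i *m (u j)^t*) 0 0.
Proof.
move=> muE; have [xi xiE] : exists xi, xi = mu *m Gp by exists (mu *m Gp).
pose nu := \sum_i u i *m Ga^t* *m D (y i).
have H1 := row_norm_ge0 (c - xi *m E).
pose w (i : 'I_n + 'I_m) : 'rV[C]_N :=
  match i with inl i => u i | inr p => - xi 0 p *: row p Ga end.
pose z (i : 'I_n + 'I_m) := match i with inl i => y i | inr p => x p end.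
have H2 := psd_vector z w Fpsd.
rewrite big_sumType /= in H2.
have S1 : \sum_i \sum_j F (z (inl i)) (z j) * (w (inl i) *m (w j)^t*) 0 0 =
   \sum_i \sum_j F (y i) (y j) * (u i *m (u j)^t*) 0 0 - (nu *m xi^t*) 0 0.
  under eq_bigr do rewrite big_sumType /=.
  rewrite big_split /=; congr (_ + _).
  rewrite /nu mulmx_suml summxE -sumrN; apply: eq_bigr => i _.
  rewrite mxE -sumrN; apply: eq_bigr => p _.
  rewrite tcZ -scalemxAr mul_mx_diag !mxE rmorphN /= !mulr_sumr !mulr_suml -sumrN.
  by apply: eq_bigr => l _; rewrite !mxE; ring.
have S2 : \sum_p \sum_j F (z (inr p)) (z j) * (w (inr p) *m (w j)^t*) 0 0 =
   - (xi *m nu^t*) 0 0 + (xi *m Hf *m xi^t*) 0 0.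
  under eq_bigr do rewrite big_sumType /=.
  rewrite big_split /=; congr (_ + _).
    rewrite exchange_big /=.
    have -> : (xi *m nu^t*) 0 0 = ((nu *m xi^t*) 0 0)^*.
      by rewrite -tcE tcM tcK.
    rewrite /nu mulmx_suml summxE conj_sum -sumrN; apply: eq_bigr => i _.
    rewrite mxE conj_sum -sumrN; apply: eq_bigr => p _.
    rewrite -scalemxAl mul_mx_diag !mxE !conjcM conjcK -Fconj conj_sum.
    rewrite !mulr_sumr !mulr_suml -sumrN.
    by apply: eq_bigr => l _; rewrite !mxE !conjcM conjcK; ring.
  rewrite mxE exchange_big /=; apply: eq_bigr => q _; rewrite mxE mulr_suml.
  apply: eq_bigr => p _; rewrite tcZ -scalemxAl -scalemxAr !mxE rmorphN /=.
  rewrite !mulr_sumr !mulr_suml.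
  by apply: eq_bigr => l _; rewrite !mxE; ring.
rewrite S1 S2 in H2.
have H3 : ((c - xi *m E) *m (c - xi *m E)^t*) 0 0 =
   (c *m c^t*) 0 0 - (c *m E^t* *m xi^t*) 0 0 - (xi *m (c *m E^t*)^t*) 0 0
   + (xi *m (E *m E^t*) *m xi^t*) 0 0.
  have -> : (c - xi *m E) *m (c - xi *m E)^t* = c *m c^t* - c *m E^t* *m xi^t*
     - xi *m (c *m E^t*)^t* + xi *m (E *m E^t*) *m xi^t*.
    rewrite tcD tcN mulmxBl !mulmxBr !tcM tcK !mulmxA opprB addrA.
    by rewrite -!addrA; congr (_ + (_ + _)); rewrite addrC.
  by rewrite !mxE.
rewrite H3 in H1.
have M1 : (mu *m xi^t*) 0 0 = (c *m E^t* *m xi^t*) 0 0 + (nu *m xi^t*) 0 0.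
  by rewrite muE -/nu mulmxDl mxE.
have M2 : (xi *m mu^t*) 0 0 = (xi *m (c *m E^t*)^t*) 0 0 + (xi *m nu^t*) 0 0.
  by rewrite muE -/nu tcD mulmxDr mxE.
have M3 : (xi *m G *m xi^t*) 0 0 = (xi *m (E *m E^t*) *m xi^t*) 0 0 + (xi *m Hf *m xi^t*) 0 0.
  by rewrite -HG mulmxDr mulmxDl mxE.
have X1 : mu *m xi^t* = mu *m Gp *m mu^t* by rewrite xiE tcM Gph mulmxA.
have X2 : xi *m G *m xi^t* = mu *m Gp *m mu^t*.
  by rewrite xiE tcM Gph !mulmxA -!(mulmxA mu) GpG !mulmxA.
rewrite X1 in M1; rewrite X2 in M3; rewrite {1}xiE in M2.
rewrite -subr_ge0; apply: le_trans (addr_ge0 H1 H2) _.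
rewrite le_eqVlt; apply/orP; left; apply/eqP.
set b1 := (c *m E^t* *m xi^t*) 0 0 in M1 *; set b2 := (nu *m xi^t*) 0 0 in M1 *.
set b3 := (xi *m (c *m E^t*)^t*) 0 0 in M2 *; set b4 := (xi *m nu^t*) 0 0 in M2 *.
set b5 := (xi *m (E *m E^t*) *m xi^t*) 0 0 in M3 *; set b6 := (xi *m Hf *m xi^t*) 0 0 in M3 *.
set A := \sum_i _; set cc := (c *m c^t*) 0 0; set t := (mu *m Gp *m mu^t*) 0 0 in M1 M2 M3 *.
transitivity (cc + A - (b1 + b2) - (b3 + b4) + (b5 + b6)); first by ring.
by rewrite -M1 -M2 -M3; ring.
Qed.

Let S y : 'M[C]_N := Ga^t* *m D y *m Gp *m Ga.

(** A fixed vector of S y would give |u|^2 <= F y y |u|^2 by [schur]. *)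
Let fixS y (u : 'rV[C]_N) : u *m S y = u -> u = 0.
Proof.
move=> uS; apply: row_norm_eq0; apply/eqP.
pose mu := u *m Ga^t* *m D y.
have H : (mu *m Gp *m mu^t*) 0 0 <= F y y * (u *m u^t*) 0 0.
  have := @schur 1 0 (fun=> y) (fun=> u) mu; have z0 : (0 : 'M[C]_1) 0 0 = 0 by rewrite mxE.
  rewrite !big_ord1 !mul0mx z0 !add0r.
  exact.
have uE : u = mu *m Gp *m Ga by rewrite -[LHS]uS /S /mu !mulmxA.
have le1 : (u *m u^t*) 0 0 <= (mu *m Gp *m mu^t*) 0 0.
  have -> : mu *m Gp *m mu^t* = (mu *m Gp *m L) *m (mu *m Gp *m L)^t* + u *m u^t*.
    rewrite {1 2}uE !tcM Gph -{1}GpG /G mulmxDr mulmxDl mulmxDr mulmxDl !mulmxA.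
    by [].
  by rewrite [leRHS]mxE lerDr row_norm_ge0.
have := le_trans le1 H; rewrite -subr_le0 -{1}[(u *m u^t*) 0 0]mul1r -mulrBl.
rewrite pmulr_rle0 ?subr_gt0// => le0.
by rewrite eq_le le0 row_norm_ge0.
Qed.

Let unitS y : 1%:M - S y \in unitmx.
Proof.
rewrite -row_free_unit -kermx_eq0; apply/eqP/row_matrixP => i; rewrite row0.
apply: (@fixS y); have : row i (kermx (1%:M - S y)) *m (1%:M - S y) = 0.
  by rewrite -row_mul mulmx_ker row0.
by rewrite mulmxBr mulmx1 => /eqP; rewrite subr_eq0 => /eqP <-.
Qed.

Let Gax y : 'M[C]_(r, N) := E^t* *m Gp *m Ga *m invmx (1%:M - S y).
Let M y : 'M[C]_(r, m) := E^t* + Gax y *m Ga^t* *m D y.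
Let Phi y : 'M[C]_r := M y *m Gp *m L.

Let GaxE y : Gax y = M y *m Gp *m Ga.
Proof.
have : Gax y *m (1%:M - S y) = E^t* *m Gp *m Ga by rewrite /Gax mulmxKV.
rewrite mulmxBr mulmx1 => /eqP; rewrite subr_eq => /eqP {1}->.
by rewrite /M !mulmxDl /S !mulmxA.
Qed.

Let rowG p : row p E *m E^t* + row p Ga *m Ga^t* *m D (x p) = row p G.
Proof.
rewrite -HG linearD /= row_mul; congr (_ + _).
apply/rowP => q; rewrite mul_mx_diag !mxE mulrC; congr (_ * _).
by apply: eq_bigr => l _; rewrite !mxE.
Qed.

Let GaS y : Gax y *m (1%:M - S y) = E^t* *m Gp *m Ga.
Proof. by rewrite /Gax mulmxKV. Qed.

(** At a node, row p of Ga solves the fixed point equation. *)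
Let Gax_interp p : row p E *m Gax (x p) = row p Ga.
Proof.
apply/eqP; rewrite -subr_eq0; apply/eqP; apply: (@fixS (x p)).
set u := _ - _; apply/eqP; rewrite eq_sym -subr_eq0 -{1}[u]mulmx1 -mulmxBr; apply/eqP.
rewrite /u mulmxBl -mulmxA GaS mulmxBr mulmx1 /S.
have : row p G *m Gp *m Ga = row p Ga by rewrite -!row_mul GpL.2.
by rewrite -rowG !mulmxDl !mulmxA => {1}<-; rewrite addrK subrr.
Qed.

Let M_interp p : row p E *m M (x p) = row p G.
Proof. by rewrite /M mulmxDr -rowG -Gax_interp !mulmxA. Qed.

Let Phi_interp p : row p E *m Phi (x p) = row p L.
Proof. by rewrite /Phi !mulmxA M_interp -!row_mul GpL.1. Qed.

Let alg1 (p q a b c f : C) :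
  p * q * a + f * (p * q * b) - p * q * c = p * q * (a + f * b - c).
Proof. ring. Qed.

Let alg2 (k f a b c : C) : k * (1 - f) = 1 -> k * (a + f * c - b) + c = k * (a - b + c).
Proof. by move=> kf; rewrite -[X in _ + X]mul1r -kf; ring. Qed.

(** Isolates the Schur complement from v (1 - Phi Phi^* ) w^*. *)
Let defect y y' (v w : 'rV[C]_r) :
  v *m (1%:M - Phi y *m (Phi y')^t*) *m w^t* =
  v *m w^t* - (v *m M y) *m Gp *m (w *m M y')^t*
  + (v *m Gax y) *m (w *m Gax y')^t*.
Proof.
have -> : v *m M y *m Gp *m (w *m M y')^t* =
    v *m M y *m Gp *m G *m Gp *m (w *m M y')^t*.
  by rewrite -!(mulmxA (v *m M y)) GpG.
rewrite !GaxE /Phi; move: (M y) (M y') => a b.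
rewrite /G mulmxBr mulmxBl mulmx1 mulmxDr !mulmxDl !tcM Gph !mulmxA.
by rewrite opprD addrA subrK.
Qed.

(** The defect 1 - Phi Phi^* is the Schur complement De plus 1 - F times the Gram
    kernel of Gax. Multiplied by K, the first part is positive by Schur's product
    theorem, and the second is a Gram kernel since K (1 - F) = 1. *)
Let Phi_psd n (y : 'I_n -> X) (v : 'I_n -> 'rV[C]_r) :
  0 <= \sum_i \sum_j K (y i) (y j) *
    (v i *m (1%:M - Phi (y i) *m (Phi (y j))^t*) *m (v j)^t*) 0 0.
Proof.
pose De (i j : 'I_n) : C := (v i *m (v j)^t*) 0 0
  + F (y i) (y j) * ((v i *m Gax (y i)) *m (v j *m Gax (y j))^t*) 0 0
  - ((v i *m M (y i)) *m Gp *m (v j *m M (y j))^t*) 0 0.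
have Deh i j : De j i = (De i j)^*.
  have h k (a b : 'rV[C]_k) : (b *m a^t*) 0 0 = ((a *m b^t*) 0 0)^*.
    by rewrite -tcE tcM tcK.
  rewrite /De conjcD conjcN conjcD conjcM -!h -Fconj; congr (_ + _ - _).
  by rewrite (tcM (v i *m M (y i)) Gp) Gph !mulmxA.
have dbl k N' (p q : 'I_k -> 'rV[C]_N') : ((\sum_i p i) *m (\sum_j q j)^t*) 0 0 =
     \sum_i \sum_j (p i *m (q j)^t*) 0 0.
  rewrite mulmx_suml summxE; apply: eq_bigr => i _.
  by rewrite linear_sum map_mx_sum mulmx_sumr summxE.
have sc k (a b : C) (u w : 'rV[C]_k) :
    ((a^* *: u) *m (b^* *: w)^t*) 0 0 = a^* * b * (u *m w^t*) 0 0.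
  by rewrite tcZ -scalemxAl -scalemxAr !mxE mulrA conjcK.
have Dep : psd De.
  apply: psd_ord => k x0 a.
  have := @schur k (\sum_i (a i)^* *: v (x0 i)) (y \o x0)
     (fun i => (a i)^* *: (v (x0 i) *m Gax (y (x0 i)))) _ erefl.
  rewrite /= -subr_ge0 => /le_trans; apply; rewrite le_eqVlt; apply/orP; left; apply/eqP.
  have -> : (\sum_i (a i)^* *: v (x0 i)) *m E^t* +
      \sum_i (a i)^* *: (v (x0 i) *m Gax (y (x0 i))) *m Ga^t* *m D (y (x0 i)) =
      \sum_i (a i)^* *: (v (x0 i) *m M (y (x0 i))).
    rewrite mulmx_suml -big_split; apply: eq_bigr => i _ /=.
    by rewrite -!scalemxAl -scalerDr /M mulmxDr !mulmxA.
  rewrite [_ *m Gp]mulmx_suml !dbl -big_split -sumrB; apply: eq_bigr => i _ /=.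
  rewrite -big_split -sumrB; apply: eq_bigr => j _ /=.
  by rewrite -(scalemxAl _ _ Gp) !sc alg1.
have KDe := psd_fin (psd_mul (L1 := fun i j => K (y i) (y j))
   (psd_ord (fun k x0 a => psd_fin Kpsd (y \o x0) a)) Dep Deh) id (fun=> 1).
have gg := row_norm_ge0 (\sum_i v i *m Gax (y i)); rewrite dbl in gg.
apply: le_trans (addr_ge0 KDe gg) _; rewrite -big_split le_eqVlt; apply/orP; left; apply/eqP.
apply: eq_bigr => i _; rewrite -big_split; apply: eq_bigr => j _ /=.
have dE (a b e : 'M[C]_1) : (a - b + e) 0 0 = a 0 0 - b 0 0 + e 0 0 by rewrite !mxE.
rewrite defect dE conjC1 !mul1r /De.
exact/alg2/KF.
Qed.

Lemma lurking_isometry : exists Phi : X -> 'M[C]_r,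
  (forall p, row p E *m Phi (x p) = row p L) /\
  forall n (y : 'I_n -> X) (v : 'I_n -> 'rV[C]_r), 0 <= \sum_i \sum_j K (y i) (y j) *
    (v i *m (1%:M - Phi (y i) *m (Phi (y j))^t*) *m (v j)^t*) 0 0.
Proof. by exists Phi; split=> [p|n y v]; [exact: Phi_interp|exact: Phi_psd]. Qed.

End PickInterpolation.

(** * Complete Pick spaces from positivity of 1 - 1/K *)

Section CompletePick.
Variables (R : realType) (X : Type).
Local Open Scope sesquilinear_scope.
Local Open Scope complex_scope.
Local Notation "x ^*" := (Num.conj x) : complex_scope.
Local Notation "M ^t*" := (M ^t Num.conj) (at level 30) : sesquilinear_scope.
Import Normc.
Notation C := R[i].

Lemma possemidef_gram n m (A : 'M[C]_(n, m)) : possemidef (A *m A^t*).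
Proof.
move=> v; have := row_norm_ge0 ((v^t*) *m A).
by rewrite tcM tcK !mulmxA.
Qed.

Lemma possemidefD n (A B : 'M[C]_n) : possemidef A -> possemidef B -> possemidef (A + B).
Proof.
by move=> pA pB v; rewrite mulmxDr mulmxDl mxE addr_ge0// ?pA ?pB.
Qed.

Variables (F K : X -> X -> C).
Hypothesis Fpsd : psd F.
Hypothesis Fconj : forall x y, F y x = (F x y)^*.
Hypothesis Fdiag : forall x, F x x < 1.
Hypothesis Kpsd : psd K.
Hypothesis Kconj : forall x y, K y x = (K x y)^*.
Hypothesis KF : forall x y, K x y * (1 - F x y) = 1.

(** Factor the Pick matrix as P = Ga Ga^*. Since K (1 - F) = 1, the definition of P
    amounts to E E^* + F o P = L L^* + P, with entrywise product o. *)
Lemma tangential_pick m r (x : 'I_m -> X) (E L : 'M[C]_(m, r)) :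
  possemidef (\matrix_(p, q) (K (x p) (x q) * (E *m E^t* - L *m L^t*) p q)) ->
  exists Phi : X -> 'M[C]_r, (forall p, row p E *m Phi (x p) = row p L) /\
  forall n (y : 'I_n -> X) (v : 'I_n -> 'rV[C]_r), 0 <= \sum_i \sum_j K (y i) (y j) *
    (v i *m (1%:M - Phi (y i) *m (Phi (y j))^t*) *m (v j)^t*) 0 0.
Proof.
set P := (X in possemidef X) => Pp.
have hh (A : 'M[C]_(m, r)) p q : (A *m A^t*) q p = ((A *m A^t*) p q)^*.
  by rewrite -tcE tcM tcK.
have [|Ga PE] := psd_factor _ Pp.
  apply/matrixP => p q; rewrite tcE /P mxE [RHS]mxE conjcM -Kconj; congr (_ * _).
  have sub (A B : 'M[C]_m) a b : (A - B) a b = A a b - B a b by rewrite !mxE.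
  by rewrite !sub conjcD conjcN -!hh.
have [|Gp [Gph GGp GpG]] := psd_pinv _ (possemidefD (possemidef_gram L) (possemidef_gram Ga)).
  by rewrite tcD !tcM !tcK.
apply: (lurking_isometry Fpsd Fconj Fdiag Kpsd KF _ Gph GGp GpG).
apply/matrixP => p q; rewrite [LHS]mxE [RHS]mxE [X in _ + X]mxE -PE /P !mxE.
set e := \sum_i _; set l := \sum_i _; have := KF (x p) (x q); move: (K _ _) (F _ _) => k f kf.
apply/eqP; rewrite -subr_eq0.
have -> : e + f * (k * (e - l)) - (l + k * (e - l)) = (e - l) * (1 - k * (1 - f)) by ring.
by rewrite kf subrr mulr0.
Qed.

End CompletePick.

Section MatrixMultiplier.
Variables (R : realType) (X : Type) (H : rkhs R X).
Local Open Scope sesquilinear_scope.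
Local Open Scope complex_scope.
Local Notation "x ^*" := (Num.conj x) : complex_scope.
Local Notation "M ^t*" := (M ^t Num.conj) (at level 30) : sesquilinear_scope.
Import Normc.
Notation C := R[i].
Notation Re := (@complex.Re R).

Variable K : X -> X -> C.
Variable k : X -> H.
Hypothesis evk : forall x y, ev (k y) x = K x y.
Hypothesis ipk : forall f y, ev f y = ip H f (k y).

Variables (r : nat) (Phi : X -> 'M[C]_r).
Hypothesis Phi_psd : forall n (y : 'I_n -> X) (v : 'I_n -> 'rV[C]_r),
  0 <= \sum_i \sum_j K (y i) (y j) *
    (v i *m (1%:M - Phi (y i) *m (Phi (y j))^t*) *m (v j)^t*) 0 0.

(* The adjoint of multiplication by Phi, on tuples of combinations of kernel
   functions. *)
Let adj (s : 'I_r -> seq (C * X)) (j : 'I_r) : H :=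
  \sum_l comb k (map (fun p => ((Phi p.2 l j)^* * p.1, p.2)) (s l)).

Lemma block_psd : psd (fun p q : X * 'I_r =>
  K p.1 q.1 * ((p.2 == q.2)%:R - \sum_j Phi p.1 p.2 j * (Phi q.1 q.2 j)^*)).
Proof.
apply: psd_ord => n x a.
have := Phi_psd (fun i => (x i).1) (fun i => (a i)^* *: delta_mx 0 (x i).2).
move=> /le_trans; apply; rewrite le_eqVlt; apply/orP; left; apply/eqP.
apply: eq_bigr => i _; apply: eq_bigr => j _.
rewrite tcZ conjcK -scalemxAr -!scalemxAl -rowE.
have -> (A : 'rV[C]_r) (l : 'I_r) : A *m (delta_mx 0 l)^t* = (A 0 l)%:M.
  apply/matrixP => ? ?; rewrite !ord1 !mxE (bigD1 l)//= big1 => [|l' ll'].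
    by rewrite !mxE !eqxx /= conjC1 mulr1 addr0.
  by rewrite !mxE (negbTE ll') /= conjC0 mulr0.
have sc m (b c : C) (A : 'rV[C]_m) l : (b *: (c *: A)) 0 l = b * c * A 0 l.
  by rewrite !mxE mulrA.
have e11 (c : C) : (c%:M : 'M[C]_1) 0 0 = c by rewrite mxE eqxx mulr1n.
rewrite sc e11 !mxE mulrCA [a j * _]mulrC; do 2 congr (_ * _).
by congr (_ - _); apply: eq_bigr => l _; rewrite !mxE.
Qed.

Lemma adj_contractive s :
  \sum_j hnorm (adj s j) ^+ 2 <= \sum_l hnorm (comb k (s l)) ^+ 2.
Proof.
have := block_psd [seq (p.1, (p.2, l)) | l <- index_enum 'I_r, p <- s l].
rewrite big_allpairs_dep /=.
under eq_bigr do under eq_bigr do rewrite big_allpairs_dep /=.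
have -> : \sum_(l <- index_enum 'I_r) \sum_(p <- s l) \sum_(l' <- index_enum 'I_r)
    \sum_(q <- s l') p.1^* * q.1 * (K p.2 q.2 * ((l == l')%:R -
      \sum_j Phi p.2 l j * (Phi q.2 l' j)^*)) =
    \sum_l ip H (comb k (s l)) (comb k (s l)) - \sum_j ip H (adj s j) (adj s j).
  have -> : \sum_j ip H (adj s j) (adj s j) = \sum_l \sum_(p <- s l) \sum_l'
      \sum_(q <- s l') p.1^* * q.1 * (K p.2 q.2 *
        \sum_j Phi p.2 l j * (Phi q.2 l' j)^*).
    rewrite (eq_bigr (fun j => \sum_l \sum_(p <- s l) \sum_l' \sum_(q <- s l')
        p.1^* * q.1 * (K p.2 q.2 * (Phi p.2 l j * (Phi q.2 l' j)^*)))) => [|j _].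
      rewrite exchange_big; apply: eq_bigr => l _; rewrite exchange_big; apply: eq_bigr => p _.
      rewrite exchange_big; apply: eq_bigr => l' _; rewrite exchange_big; apply: eq_bigr => q _.
      by rewrite -!mulr_sumr.
    rewrite ip_sumr; apply: eq_bigr => l _; rewrite ip_suml.
    under eq_bigr do rewrite (ip_comb evk ipk) big_map.
    rewrite exchange_big; apply: eq_bigr => p _; apply: eq_bigr => l' _; rewrite big_map.
    by apply: eq_bigr => q _ /=; rewrite conjcM conjcK; ring.
  rewrite -sumrB; apply: eq_bigr => l _; rewrite (ip_comb evk ipk) -sumrB.
  apply: eq_bigr => p _.
  under eq_bigr do under eq_bigr do rewrite !mulrBr.
  under eq_bigr do rewrite sumrB.
  rewrite sumrB; congr (_ - _).
  rewrite (bigD1 l)//= [X in _ + X]big1 ?addr0 => [|l' ll'].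
    by apply: eq_bigr => q _; rewrite eqxx mulr1.
  by rewrite big1 => // q _; rewrite eq_sym (negbTE ll') !mulr0.
rewrite subr_ge0 => le1; rewrite -lecR !rmorph_sum /=.
under eq_bigr do rewrite -ip_self.
by under [leRHS]eq_bigr do rewrite -ip_self.
Qed.

Lemma ip_adj s (f g : 'I_r -> H) :
  (forall i x, ev (g i) x = \sum_j Phi x i j * ev (f j) x) ->
  \sum_l ip H (g l) (comb k (s l)) = \sum_j ip H (f j) (adj s j).
Proof.
move=> gf.
have -> : \sum_j ip H (f j) (adj s j) =
    \sum_j \sum_l \sum_(p <- s l) p.1^* * (Phi p.2 l j * ev (f j) p.2).
  apply: eq_bigr => j _; rewrite ip_sumr; apply: eq_bigr => l _.
  rewrite (ip_combr ipk) big_map; apply: eq_bigr => p _ /=.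
  by rewrite conjcM conjcK; ring.
rewrite exchange_big; apply: eq_bigr => l _; rewrite exchange_big (ip_combr ipk).
by apply: eq_bigr => p _; rewrite gf mulr_sumr.
Qed.

Lemma entry_multiplier i j : multiplier H (fun x => Phi x i j).
Proof.
move=> f; have [|g [gP _]] := rkhs_mem ipk (G := fun x => Phi x i j * ev f x) (hnorm_ge0 f).
  move=> s; pose s' l := if l == i then s else [::].
  have adjE : adj s' j = comb k (map (fun p => ((Phi p.2 i j)^* * p.1, p.2)) s).
    rewrite /adj (bigD1 i)//= big1 ?addr0 /s' ?eqxx// => l li.
    by rewrite (negbTE li) /comb big_nil.
  have le1 : hnorm (adj s' j) <= hnorm (comb k s).
    rewrite -(ler_sqr (x := hnorm _)) ?nnegrE ?hnorm_ge0//.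
    have := adj_contractive s'; rewrite (bigD1 j)//= => le1.
    apply: le_trans (le_trans le1 _); first by rewrite lerDl sumr_ge0// => l _; exact: sqr_ge0.
    rewrite (bigD1 i)//= {1}/s' eqxx big1 ?addr0// => l li.
    by rewrite /s' (negbTE li) /comb big_nil hnorm0 expr0n.
  apply: le_trans (ler_wpM2l (hnorm_ge0 f) le1).
  apply: le_trans (ip_CS _ _); rewrite adjE (ip_combr ipk) big_map le_eqVlt; apply/orP; left; apply/eqP.
  by congr normc; apply: eq_bigr => p _ /=; rewrite conjcM conjcK; ring.
by exists g.
Qed.

(** Duality with [adj_contractive]: the components of g are approximated within e
    by combinations of kernel functions, and the inequality 2 a b <= a^2 + b^2
    stands in for the Cauchy-Schwarz inequality for tuples. *)
Lemma contractive_multiplier (f g : 'I_r -> H) :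
  (forall i x, ev (g i) x = \sum_j Phi x i j * ev (f j) x) ->
  \sum_l hnorm (g l) ^+ 2 <= \sum_l hnorm (f l) ^+ 2.
Proof.
move=> gf; set a := \sum_l hnorm (g l) ^+ 2; set b := \sum_l hnorm (f l) ^+ 2.
pose c := \sum_l hnorm (g l).
have c0 : 0 <= c by apply: sumr_ge0 => l _; exact: hnorm_ge0.
suff le_e (e : R) : 0 < e -> a <= b + 4 * (e * c) + e ^+ 2 * r%:R.
  apply/ler_addgt0Pr => e e0; pose M := 4 * c + r%:R + 1.
  have M0 : 0 < M by rewrite ltr_wpDl// addr_ge0// mulr_ge0.
  pose t := Num.min 1 (e / M).
  have t0 : 0 < t by rewrite lt_min ltr01 divr_gt0.
  have t1 : t <= 1 by rewrite ge_min lexx.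
  have tM : t * M <= e by rewrite -ler_pdivlMr// ge_min lexx orbT.
  apply: le_trans (le_e t t0) _; rewrite -addrA lerD2l; apply: le_trans tM.
  rewrite /M !mulrDr mulr1 -addrA mulrCA lerD2l.
  apply: ler_wpDr; first exact: ltW.
  by rewrite ler_wpM2r// expr2 ler_piMl// ltW.
move=> e0.
have /choice[s sP] : forall l, exists s, hnorm (g l - comb k s) < e.
  by move=> l; exact: (comb_dense ipk).
have aE : a%:C = \sum_j ip H (f j) (adj s j) + \sum_l ip H (g l) (g l - comb k (s l)).
  rewrite -(ip_adj s gf) -big_split /a rmorph_sum; apply: eq_bigr => l _ /=.
  by rewrite -ip_self -ipDr addrC subrK.
have aE' : a = \sum_j Re (ip H (f j) (adj s j)) + \sum_l Re (ip H (g l) (g l - comb k (s l))).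
  have -> : a = Re a%:C by [].
  by rewrite aE ReD; congr (_ + _); exact: raddf_sum.
have le_ip (u v : H) : Re (ip H u v) <= hnorm u * hnorm v.
  apply: le_trans (ip_CS u v); apply: le_trans (Re_le_normc _); exact: ler_norm.
have le1 : \sum_j Re (ip H (f j) (adj s j)) <= (b + \sum_j hnorm (adj s j) ^+ 2) / 2.
  rewrite -big_split mulr_suml; apply: ler_sum => j _ /=.
  apply: le_trans (le_ip _ _) _; rewrite ler_pdivlMr//.
  have := sqr_ge0 (hnorm (f j) - hnorm (adj s j)); nra.
have le2 : \sum_l Re (ip H (g l) (g l - comb k (s l))) <= e * c.
  rewrite mulr_sumr; apply: ler_sum => l _; apply: le_trans (le_ip _ _) _.
  by rewrite mulrC ler_wpM2r ?hnorm_ge0// ltW.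
have le3 : \sum_l hnorm (comb k (s l)) ^+ 2 <= a + 2 * (e * c) + e ^+ 2 * r%:R.
  have -> : a + 2 * (e * c) + e ^+ 2 * r%:R = \sum_l (hnorm (g l) + e) ^+ 2.
    under eq_bigr do rewrite sqrrD.
    rewrite !big_split /= sumr_const card_ord -mulr_natr; congr (_ + _ + _).
    by rewrite -mulr_suml -/c; ring.
    by rewrite mulr_natr.
  apply: ler_sum => l _; rewrite ler_sqr ?nnegrE ?addr_ge0 ?hnorm_ge0 ?ltW//.
  have -> : comb k (s l) = g l + - (g l - comb k (s l)) by rewrite opprB addrC subrK.
  by apply: le_lt_trans (le_hnormD _ _) _; rewrite hnormN ltrD2l.
have le4 := adj_contractive s.
rewrite -/a; move: aE' le1 le2 le3 le4.
move: (\sum_j Re _) (\sum_l Re _) (\sum_j hnorm _ ^+ 2) (\sum_l hnorm _ ^+ 2) => x1 x2 x3 x4.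
move: (e * c) (e ^+ 2 * r%:R) => y1 y2; lra.
Qed.

Lemma mx_mult_norm_le1 :
  (mx_mult_norm H (\matrix_(i, j) (fun x => Phi x i j)) <= 1%:E)%E.
Proof.
apply: ge_ereal_sup => _ [f [g [f1 gf ->]]]; rewrite lee_fin.
have f2 : \sum_l hnorm (f l) ^+ 2 <= 1.
  move: f1; rewrite /vhnorm -{1}sqrtr1 ler_sqrt//.
rewrite /vhnorm -sqrtr1 ler_sqrt//; apply: le_trans f2.
apply: contractive_multiplier => i x; rewrite gf.
by apply: eq_bigr => j _; rewrite mxE.
Qed.

End MatrixMultiplier.

Section CnpOfKernel.
Variables (R : realType) (X : Type) (H : rkhs R X).
Local Open Scope sesquilinear_scope.
Local Open Scope complex_scope.
Local Notation "x ^*" := (Num.conj x) : complex_scope.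
Local Notation "M ^t*" := (M ^t Num.conj) (at level 30) : sesquilinear_scope.
Notation C := R[i].

(** Matrix interpolation at n points is the tangential problem in which every point
    is repeated r times, with the standard basis vectors as left directions. *)
Lemma cnp_of_kernel (F K : X -> X -> C) : is_kernel H K -> psd F ->
  (forall x y, F y x = (F x y)^*) -> (forall x, F x x < 1) ->
  (forall x y, K x y * (1 - F x y) = 1) -> complete_nevanlinna_pick H K.
Proof.
move=> Kker Fpsd Fconj Fdiag KF n r _ _ z Lambda Pick.
have [k [evk ipk]] := kernel_functions Kker.
pose sg (p : 'I_(\sum_(i < n) r)) : 'I_n := tagnat.sig1 p.
pose sg' (p : 'I_(\sum_(i < n) r)) : 'I_r := tagnat.sig2 p.
pose E : 'M[C]_(\sum_(i < n) r, r) := \matrix_(p, q) (sg' p == q)%:R.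
pose L : 'M[C]_(\sum_(i < n) r, r) := \matrix_(p, q) Lambda (sg p) (sg' p) q.
have [|Phi [PhiE Phi_psd]] := tangential_pick (x := fun p => z (sg p)) (E := E) (L := L)
    Fpsd Fconj Fdiag (kernel_psd evk ipk) (kernel_conj evk ipk) KF.
  have delta_sum (a b : 'I_r) : \sum_j (a == j)%:R * ((b == j)%:R)^* = (a == b)%:R :> C.
    rewrite (bigD1 a)//= big1 ?addr0 => [|l la]; first by rewrite eqxx mul1r conjC_nat eq_sym.
    by rewrite eq_sym (negbTE la) mul0r.
  suff -> : \matrix_(p, q) (K (z (sg p)) (z (sg q)) * (E *m E^t* - L *m L^t*) p q) =
    \mxblock_(i < n, j < n) (K (z i) (z j) *: (1%:M - Lambda i *m (Lambda j)^t*)) by [].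
  apply/matrixP => p q; rewrite !mxE; congr (_ * (_ - _)).
    by rewrite -delta_sum; apply: eq_bigr => l _; rewrite !mxE.
  by apply: eq_bigr => l _; rewrite !mxE.
exists (\matrix_(i, j) (fun x => Phi x i j)); split.
- by move=> i j; rewrite mxE; exact: (entry_multiplier evk ipk Phi_psd).
- exact: (mx_mult_norm_le1 evk ipk Phi_psd).
- move=> i; apply/matrixP => a b; rewrite !mxE.
  have sgR : sg' (tagnat.Rank i a) = a by apply: val_inj; rewrite /sg' tagnat.Rank2K.
  have /rowP/(_ b) := PhiE (tagnat.Rank i a).
  have -> : row (tagnat.Rank i a) E = delta_mx 0 a.
    by apply/rowP => q; rewrite !mxE eqxx /= sgR eq_sym.
  by rewrite -rowE !mxE sgR /sg tagnat.Rank1K.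
Qed.

End CnpOfKernel.

(** * The binomial series *)

Section BinomialSeries.
Variable R : realType.
Local Open Scope classical_set_scope.
Local Open Scope ring_scope.
Local Open Scope complex_scope.
Local Notation "x ^*" := (Num.conj x) : complex_scope.
Import Normc.
Notation C := R[i].
Notation Re := (@complex.Re R).
Notation Im := (@complex.Im R).

(** The mean value theorem applies to the real and the imaginary part separately,
    whence the factor 2. *)
Lemma normc_increment (f df : C -> C) (x : C) (M : R) :
  (forall t : R, 0 <= t <= 1 -> der f (t%:C * x) (df (t%:C * x))) ->
  (forall t : R, 0 <= t <= 1 -> normc (df (t%:C * x)) <= M) ->
  normc (f x - f 0) <= 2 * (M * normc x).
Proof.
move=> fd dfM.
have cd (t : R) : 0 <= t <= 1 -> curve_der (fun s => f (0 + s%:C * x)) t (df (t%:C * x) * x).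
  move=> t01; apply: curve_der_comp; last exact: curve_der_line.
  by rewrite add0r; exact: fd.
have bd (t : R) : 0 < t < 1 -> normc (df (t%:C * x) * x) <= M * normc x.
  by case/andP=> t0 t1; rewrite normcM ler_wpM2r ?normc_ge0// dfM// !ltW.
have end1 : 0 + 1%:C * x = x by rewrite add0r mul1r.
have end0 : 0 + 0%:C * x = 0 by rewrite add0r mul0r.
have [s s01 Es] := der_MVT (ltr01 : (0 : R) < 1) (fun t t01 => (cd t t01).1).
have [r r01 Er] := der_MVT (ltr01 : (0 : R) < 1) (fun t t01 => (cd t t01).2).
rewrite /= end1 end0 subr0 mulr1 in Es Er.
apply: le_trans (normc_le_ReIm _) _; rewrite ReD ReN ImD ImN Es Er mulr2n mulrDl mul1r.
rewrite mulr1; apply: lerD; first exact: le_trans (Re_le_normc _) (bd s s01).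
exact: le_trans (Im_le_normc _) (bd r r01).
Qed.

Lemma natC n : (n%:R : R)%:C = n%:R :> C. Proof. exact: rmorph_nat. Qed.

Lemma realM (a b : R) : (a * b)%:C = a%:C * b%:C :> C. Proof. exact: rmorphM. Qed.

Lemma realB (a b : R) : (a - b)%:C = a%:C - b%:C :> C. Proof. exact: rmorphB. Qed.

Lemma normcX (z : C) n : normc (z ^+ n) = normc z ^+ n.
Proof. by elim: n => [|n IH]; rewrite ?expr0 ?normc1// !exprS normcM IH. Qed.

Variable alpha : R.
Hypothesis alpha01 : 0 < alpha <= 1.
Let alpha0 : 0 < alpha. Proof. by case/andP: alpha01. Qed.
Let alpha1 : alpha <= 1. Proof. by case/andP: alpha01. Qed.

(** The Taylor coefficients of (1 - x)^alpha. *)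
Fixpoint binc (n : nat) : R :=
  if n is n'.+1 then (n'%:R - alpha) * binc n' / n%:R else 1.

Lemma bincS n : n.+1%:R * binc n.+1 = (n%:R - alpha) * binc n.
Proof. by rewrite /= mulrCA divff ?mulr1// pnatr_eq0. Qed.

Lemma binc_le0 n : binc n.+1 <= 0.
Proof.
elim: n => [|n IH]; first by rewrite /= sub0r mulr1 divr1 oppr_le0 ltW.
rewrite -(pmulr_rle0 _ (x := n.+2%:R)) ?ltr0n// bincS mulr_ge0_le0// subr_ge0.
by apply: le_trans alpha1 _; rewrite ler1n.
Qed.

Lemma binc_bound n : `|(n%:R - alpha) * binc n| <= 1.
Proof.
elim: n => [|n IH]; first by rewrite sub0r mulr1 normrN gtr0_norm.
apply: le_trans IH; rewrite -(bincS n) !normrM ler_wpM2r// ger0_norm.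
  by rewrite (@ger0_norm _ n.+1%:R)// gerBl ltW.
by rewrite subr_ge0; apply: le_trans alpha1 _; rewrite ler1n.
Qed.

Definition binsum n (x : C) : C := \sum_(k < n.+1) (binc k)%:C * x ^+ k.

Lemma binsumS n x : binsum n.+1 x = binsum n x + (binc n.+1)%:C * x ^+ n.+1.
Proof. by rewrite /binsum big_ord_recr. Qed.

Lemma binsum0 n : binsum n 0 = 1.
Proof.
rewrite /binsum big_ord_recl expr0 mulr1 /= big1 ?addr0// => i _.
by rewrite expr0n mulr0.
Qed.

(** The partial sums satisfy the differential equation of (1 - x)^alpha up to one
    term of order n. *)
Lemma der_binsum n (x : C) : exists2 D, der (binsum n) x D &
  D * (1 - x) = - alpha%:C * binsum n x + ((alpha - n%:R) * binc n)%:C * x ^+ n.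
Proof.
elim: n => [|n [D Dd DE]].
  exists 0.
    apply: (der_ext (f := fun=> 1)); last exact: der_cst.
    by move=> t; rewrite /binsum big_ord1 expr0 mulr1.
  by rewrite /binsum big_ord1 expr0 !mulr1 subr0 mul0r addrC subrr.
exists (D + (binc n.+1)%:C * (n.+1%:R * x ^+ n * 1)).
  apply: (der_ext (f := fun t => binsum n t + (binc n.+1)%:C * t ^+ n.+1)).
    by move=> t; rewrite binsumS.
  by apply: derD => //; apply: derMl; exact: (derX n.+1 (der_id x)).
have E : (binc n.+1)%:C * n.+1%:R = ((n%:R - alpha) * binc n)%:C.
  by rewrite -bincS realM natC mulrC.
rewrite mulrDl DE binsumS mulr1 mulrA; move: E (bincS n); move: (binc n.+1) => b1 E bE; rewrite E !realM !realB !natC exprS -natr1.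
have E' : b1%:C * (n%:R + 1) = (n%:R - alpha%:C) * (binc n)%:C.
  by rewrite natr1 E realM realB natC.
move: E'; move: (binsum n x) b1%:C (binc n)%:C alpha%:C (n%:R : C) (x ^+ n).
move=> s b' b al m y E'.
apply/eqP; rewrite -subr_eq0; apply/eqP.
transitivity (x * y * (b' * (m + 1) - (m - al) * b)); first by ring.
by rewrite E' subrr mulr0.
Qed.

(** The quotient of the partial sum by (1 - x)^alpha equals 1 at 0, and by
    [der_binsum] its derivative on the segment from 0 to x is of order |x|^n. *)
Lemma binsum_cvg (x : C) : normc x < 1 -> binsum ^~ x @ \oo --> cpow (1 - x) alpha.
Proof.
move=> x1; set d := 1 - normc x; have d0 : 0 < d by rewrite subr_gt0.
pose Kx := (d `^ alpha * d)^-1.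
have Kx0 : 0 < Kx by rewrite invr_gt0 mulr_gt0// powR_gt0.
have tx (t : R) : 0 <= t <= 1 -> normc (t%:C * x) <= normc x.
  by case/andP=> t0 t1; rewrite normcM normc_real ger0_norm// ler_piMl ?normc_ge0.
pose f n z := binsum n z * cpow (1 - z) (- alpha).
pose df n z := cpow (1 - z) (- alpha) * ((alpha - n%:R) * binc n)%:C * z ^+ n / (1 - z).
have fd n z : normc z < 1 -> der (f n) z (df n z).
  move=> z1; have z0 := Re_1B z1; have [D Dd DE] := der_binsum n z.
  have dz : der (fun t : C => 1 - t) z (0 - 1) by apply: derB; [exact: der_cst|exact: der_id].
  have cd := der_comp (g := fun t : C => 1 - t) (der_cpow (- alpha) z0) dz.
  apply: der_eq (derM Dd cd) _.
  have nz := Re_gt0_neq0 z0.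
  have -> : D = (- alpha%:C * binsum n z + ((alpha - n%:R) * binc n)%:C * z ^+ n) / (1 - z).
    by rewrite -DE mulfK.
  rewrite /df rmorphN /=; field.
  by [].
have dfM n (t : R) : 0 <= t <= 1 -> normc (df n (t%:C * x)) <= normc x ^+ n * Kx.
  move=> t01; set z := _ * x; have zx : normc z <= normc x := tx t t01.
  have z1 := le_lt_trans zx x1; have nz := Re_gt0_neq0 (Re_1B z1).
  have dz : d <= normc (1 - z).
    rewrite /d lerBlDr -(normc1 R); apply: le_trans (_ : normc (1 - z + z) <= _).
      by rewrite subrK.
    by apply: le_trans (le_normcD _ _) _; rewrite lerD2l.
  have u0 : 0 < normc (1 - z) := lt_le_trans d0 dz.
  rewrite /df; have := normc_cpow (- alpha) nz; move: (cpow _ _) => cp cpE.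
  rewrite !normcM normc_real normcV cpE powRN normcX.
  have ba : `|(alpha - n%:R) * binc n| <= 1 by rewrite -normrN -mulNr opprB binc_bound.
  have alg (A c w u : R) : A^-1 * c * w / u = c * (w * (A * u)^-1) by rewrite invfM; ring.
  rewrite alg -[leRHS]mul1r; apply: ler_pM => //.
    by rewrite mulr_ge0// ?exprn_ge0 ?normc_ge0// invr_ge0 mulr_ge0 ?powR_ge0 ?ltW.
  rewrite mulrC [leRHS]mulrC.
  apply: ler_pM; rewrite ?invr_ge0 ?mulr_ge0 ?powR_ge0 ?exprn_ge0 ?normc_ge0 ?(ltW u0)//.
    rewrite lef_pV2 ?posrE ?mulr_gt0 ?powR_gt0//; apply: ler_pM; rewrite ?powR_ge0 ?(ltW d0)//.
    by rewrite ge0_ler_powR ?nnegrE ?(ltW d0) ?(ltW u0) ?(ltW alpha0).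
  by apply: lerXn2r; rewrite ?nnegrE ?normc_ge0.
have x0 := Re_gt0_neq0 (Re_1B x1); set c := cpow (1 - x) alpha.
have le1 n : normc (binsum n x - c) <= normc x ^+ n * (2 * (Kx * normc c)).
  have -> : binsum n x - c = (f n x - f n 0) * c.
    rewrite /f binsum0 subr0 cpow1 mul1r mulrBl mul1r cpowN -/c -mulrA mulVf ?mulr1//.
    exact: cpow_neq0.
  rewrite normcM mulrCA mulrA mulrA; apply: ler_wpM2r; first exact: normc_ge0.
  have := normc_increment (fun t t01 => fd n _ (le_lt_trans (tx t t01) x1)) (fun t => dfM n t).
  move=> /le_trans; apply; rewrite -mulrA ler_wpM2l// ler_piMr ?(ltW x1)//.
  by rewrite mulr_ge0 ?exprn_ge0 ?normc_ge0// ltW.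
have cv0 : (fun n => normc x ^+ n * (2 * (Kx * normc c))) @ \oo --> (0 : R).
  rewrite -(mul0r (2 * (Kx * normc c))); apply: cvgM; last exact: cvg_cst.
  by apply: cvg_expr; rewrite ger0_norm ?normc_ge0.
apply: cvg_complex; apply/cvgrPdist_le => e e0; move/cvgrPdist_le: cv0 => /(_ e e0);
  apply: filterS => n; rewrite sub0r normrN => /(le_trans (ler_norm _)) len;
  rewrite -normrN opprB; apply: le_trans len; apply: le_trans (le1 n).
  by rewrite -ReN -ReD Re_le_normc.
by rewrite -ImN -ImD Im_le_normc.
Qed.

End BinomialSeries.

(** * Sufficiency: the spaces with kernel (1 - <z, w>)^(-alpha) *)

Section Sufficiency.
Variable R : realType.
Local Open Scope classical_set_scope.
Local Open Scope ring_scope.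
Local Open Scope complex_scope.
Local Notation "x ^*" := (Num.conj x) : complex_scope.
Import Normc.
Notation C := R[i].
Notation Re := (@complex.Re R).
Notation Im := (@complex.Im R).

Lemma cvgC_ge0 (u : nat -> C) (l : C) : u @ \oo --> l -> (forall n, 0 <= u n) -> 0 <= l.
Proof.
move=> ul u0.
have uR := cvg_Re ul; have uI := cvg_Im ul.
have h n : 0 <= Re (u n) /\ Im (u n) = 0 by have := u0 n; case: (u n) => a b; rewrite lecE /= => /andP[/eqP -> ->].
have l1 : 0 <= Re l.
  rewrite -(cvg_lim _ uR)//; apply: limr_ge; first by apply/cvg_ex; eexists; exact: uR.
  by apply: nearW => n; exact: (h n).1.
have l2 : Im l = 0.
  rewrite -(cvg_lim _ uI)// (_ : (fun n => Im (u n)) = fun=> 0) ?lim_cst//.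
  by apply/funext => n; exact: (h n).2.
by move: l1 l2; case: (l) => a b /= a0 ->; rewrite lecE /= eqxx.
Qed.

Lemma psd_limit (X : Type) (L : nat -> X -> X -> C) (L' : X -> X -> C) :
  (forall n, psd (L n)) -> (forall x y, (fun n => L n x y) @ \oo --> L' x y) -> psd L'.
Proof.
move=> Lp LL s.
apply: (@cvgC_ge0 (fun n => \sum_(p <- s) \sum_(q <- s) p.1^* * q.1 * L n p.2 q.2)) => [|n]; last exact: Lp.
apply: cvg_big => [|p _]; first exact: add_continuous.
apply: cvg_big => [|q _]; first exact: add_continuous.
by apply: cvgM; [exact: cvg_cst|exact: LL].
Qed.

Lemma psd_expr (X : Type) (L : X -> X -> C) n : psd L ->
  (forall x y, L y x = (L x y)^*) -> psd (fun x y => L x y ^+ n).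
Proof.
move=> Lp Lh; elim: n => [|n IH].
  suff -> : (fun x y => L x y ^+ 0) = (fun _ _ => 1) by exact: psd_one.
  by apply/funext => x; apply/funext => y; rewrite expr0.
suff -> : (fun x y => L x y ^+ n.+1) = (fun x y => L x y ^+ n * L x y) by exact: psd_mul.
by apply/funext => x; apply/funext => y; rewrite exprSr.
Qed.

Variable d : option nat.
Notation E := (ell2 R d).
Notation B := (uball R d).

Lemma psd_inner : psd (fun z w : B => inner (val z) (val w)).
Proof.
move=> s; pose v : E := \sum_(p <- s) p.1^* *: val p.2.
suff -> : \sum_(p <- s) \sum_(q <- s) p.1^* * q.1 * inner (val p.2) (val q.2) = inner v v.
  by rewrite inner_self lecR sqr_ge0.
have suml (t : seq (C * B)) w : inner (\sum_(p <- t) p.1^* *: val p.2) w =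
    \sum_(p <- t) p.1^* * inner (val p.2) w.
  elim: t => [|p t IH]; first by rewrite !big_nil inner0l.
  by rewrite !big_cons innerDl IH innerZl.
have sumr (t : seq (C * B)) w : inner w (\sum_(p <- t) p.1^* *: val p.2) =
    \sum_(p <- t) p.1 * inner w (val p.2).
  elim: t => [|p t IH]; first by rewrite !big_nil inner0r.
  by rewrite !big_cons innerDr IH innerZr conjcK.
rewrite suml; apply: eq_bigr => p _; rewrite sumr mulr_sumr.
by apply: eq_bigr => q _; rewrite mulrA.
Qed.

Variable alpha : R.
Hypothesis alpha01 : 0 < alpha <= 1.

Let F (z w : B) : C := 1 - cpow (1 - inner (val z) (val w)) alpha.

(** 1 - (1 - t)^alpha has nonnegative Taylor coefficients for alpha <= 1, and the
    powers of the inner product are positive by Schur's product theorem. *)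
Lemma psd_one_minus_pow : psd F.
Proof.
apply: (@psd_limit _ (fun n z w => 1 - binsum alpha n (inner (val z) (val w)))) => [n|z w]; last first.
  apply: cvgB; first exact: cvg_cst.
  by apply: binsum_cvg => //; apply: inner_lt1; exact: uball_lt1.
elim: n => [|n IH].
  move=> s; rewrite big1 // => p _; rewrite big1 // => q _.
  by rewrite /binsum big_ord1 expr0 mulr1 subrr mulr0.
suff -> : (fun z w : B => 1 - binsum alpha n.+1 (inner (val z) (val w))) =
   (fun z w => (1 - binsum alpha n (inner (val z) (val w)))
     + (- binc alpha n.+1)%:C * inner (val z) (val w) ^+ n.+1).
  apply: psd_sum => //; apply: psd_scale; first by rewrite lecR oppr_ge0 binc_le0.
  by apply: psd_expr; [exact: psd_inner|move=> x y; exact: inner_conj].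
apply/funext => z; apply/funext => w; rewrite binsumS.
by rewrite (_ : (- binc alpha n.+1)%:C = - (binc alpha n.+1)%:C) ?mulNr ?opprD ?addrA//; exact: rmorphN.
Qed.

Variables (H : rkhs R B) (K : B -> B -> C).
Hypothesis Kker : is_kernel H K.
Hypothesis KE : forall z w, K z w = 1 / cpow (1 - inner (val z) (val w)) alpha.

Lemma cnp_of_power : complete_nevanlinna_pick H K.
Proof.
apply: (cnp_of_kernel (F := F) Kker psd_one_minus_pow).
- move=> x y; rewrite /F conjcB conjC1 -cpow_conj ?Re_1B_inner//.
  by rewrite conjcB conjC1 -inner_conj.
- move=> x; rewrite /F inner_self.
  have -> : 1 - (en (val x) ^+ 2)%:C = (1 - en (val x) ^+ 2)%:C by rewrite realB.
  have x0 : 0 < 1 - en (val x) ^+ 2 by rewrite subr_gt0 expr_lt1 ?en_ge0 ?uball_lt1.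
  by rewrite cpow_real// ltrBlDr ltrDl ltcR powR_gt0.
- by move=> x y; rewrite KE /F subKr mul1r mulVf// cpow_neq0.
Qed.

(** Testing a dependence at the origin gives a + b = 0; then the principal power,
    being injective on the right half-plane, separates the two points. *)
Lemma irreducible_of_power : irreducible K.
Proof.
split=> [z w|x y xy a b ab].
  by rewrite KE mul1r invr_eq0 cpow_neq0.
have ab0 : a + b = 0.
  have := ab (origin R d); rewrite !KE /origin /= !inner0l subr0 cpow1.
  by rewrite divr1 !mulr1.
suff a0 : a = 0 by move: ab0; rewrite a0 add0r.
apply/eqP; apply: contra_notT xy => a0.
have eK t : K t x = K t y.
  have := ab t; have -> : b = - a by apply/eqP; rewrite -addr_eq0 addrC ab0.
  by rewrite mulNr -mulrBr => /eqP; rewrite mulf_eq0 (negbTE a0) subr_eq0 => /eqP.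
have ei (t : B) : inner (val t) (val x) = inner (val t) (val y).
  have := eK t; rewrite !KE !mul1r => /invr_inj/(cpow_inj alpha01 (Re_1B_inner _ _) (Re_1B_inner _ _)).
  by move=> /addrI/oppr_inj.
apply: uball_inj; apply/eqP; rewrite -subr_eq0; apply/eqP/en_eq0/eqP.
rewrite -sqrf_eq0; apply/eqP/complexI; rewrite -inner_self.
by rewrite innerBl !innerBr !ei !subrr.
Qed.

(** An automorphism multiplies 1 - <z, w> by a factor depending on z times a factor
    depending on w, and the principal power respects this factorization. *)
Lemma invariant_of_power (phi : B -> B) : is_automorphism phi -> isometric_composition H phi.
Proof.
move=> phA; have [k [evk ipk]] := kernel_functions Kker.
have [a aP] := automorphism_inner phA; have [_ [phi' [_ phK phK']]] := phA.
set c := 1 - en (val a) ^+ 2 in aP.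
have c0 : 0 < c by rewrite subr_gt0 expr_lt1 ?en_ge0 ?uball_lt1.
pose s : C := (Num.sqrt (c `^ alpha))%:C^-1.
pose delta (z : B) : C := s * cpow (1 - inner (val z) (val a)) alpha.
have sn : (Num.sqrt (c `^ alpha))%:C != 0 :> C.
  by rewrite -normc_gt0 normc_real normr_gt0 gt_eqF// sqrtr_gt0 powR_gt0.
have ca : (c `^ alpha)%:C = (Num.sqrt (c `^ alpha))%:C ^+ 2 :> C.
  by rewrite expr2 -realM -expr2 sqr_sqrtr// powR_ge0.
apply: (isometric_composition_of_kernel evk ipk (delta := delta) phK phK') => [x|x y].
  by rewrite mulf_neq0 ?cpow_neq0// invr_eq0.
rewrite !KE !mul1r aP cpow_moebius ?Re_1B_inner//; last first.
  by rewrite -aP Re_1B_inner.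
rewrite /delta conjcM -cpow_conj ?Re_1B_inner// conjcB conjC1 -inner_conj.
rewrite /s conjcV conjc_realE ca; field.
by rewrite !cpow_neq0 sn.
Qed.

End Sufficiency.

(** * Two-point interpolation *)

Section TwoPointPick.
Variables (R : realType) (X : Type) (H : rkhs R X).
Local Open Scope sesquilinear_scope.
Local Open Scope complex_scope.
Local Notation "x ^*" := (Num.conj x) : complex_scope.
Local Notation "M ^t*" := (M ^t Num.conj) (at level 30) : sesquilinear_scope.
Import Normc.
Notation C := R[i].
Notation Re := (@complex.Re R).

Variable K : X -> X -> C.
Variable k : X -> H.
Hypothesis evk : forall x y, ev (k y) x = K x y.
Hypothesis ipk : forall f y, ev f y = ip H f (k y).
Hypothesis Knz : forall x y, K x y != 0.

Definition kdiag x : R := hnorm (k x) ^+ 2.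

Lemma kernel_kdiag x : K x x = (kdiag x)%:C.
Proof. exact: (kernel_diag evk ipk). Qed.

Lemma kdiag_gt0 x : 0 < kdiag x.
Proof.
rewrite lt_def sqr_ge0 andbT; have := Knz x x; rewrite kernel_kdiag.
by apply: contraNneq => ->.
Qed.

(** The squared cosine of the angle between two kernel functions. *)
Definition overlap x y : R := normc (K x y) ^+ 2 / (kdiag x * kdiag y).

Lemma overlap_le1 x y : overlap x y <= 1.
Proof.
rewrite /overlap ler_pdivrMr; last by rewrite mulr_gt0 ?kdiag_gt0.
rewrite mul1r /kdiag mulrC -exprMn.
by rewrite ler_sqr ?nnegrE ?normc_ge0 ?mulr_ge0 ?hnorm_ge0// (kernelE evk ipk) ip_CS.
Qed.

(** The adjoint of multiplication by psi kills [k y] and scales [k x]; compare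
    norms on the component of [k x] orthogonal to [k y]. *)
Lemma two_point_schwarz psi x y : multiplier H psi -> (mult_norm H psi <= 1%:E)%E ->
  psi y = 0 -> normc (psi x) ^+ 2 <= 1 - overlap x y.
Proof.
move=> psim psi1 psiy; pose b : C := - K y x / (kdiag y)%:C.
have ny : (kdiag y)%:C != 0 :> C by rewrite -kernel_kdiag Knz.
have := contractive_comb ipk (mult_norm_le1 ipk psi1) psim [:: (1, x); (b, y)].
rewrite /comb !big_cons !big_nil /= psiy conjC0 mul0r scale0r mulr1 scale1r !addr0.
rewrite -(ler_sqr (x := hnorm _)) ?nnegrE ?hnorm_ge0//.
have -> : hnorm (k x + b *: k y) ^+ 2 = kdiag x * (1 - overlap x y).
  apply: complexI; rewrite -ip_self [X in ip H _ X]addrC ipDr ipZr -!ipk !(evD ipk) !(evZ ipk) !evk.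
  rewrite !kernel_kdiag.
  have -> : K y x + b * (kdiag y)%:C = 0 by rewrite /b divfK// subrr.
  rewrite mulr0 add0r (realM (kdiag x)) (realB 1) /overlap.
  have -> : (normc (K x y) ^+ 2 / (kdiag x * kdiag y))%:C =
     K x y * (K x y)^* / ((kdiag x)%:C * (kdiag y)%:C).
    by rewrite mulC_conj -(realM (kdiag x)) fmorph_div.
  rewrite /b -(kernel_conj evk ipk); field.
  by apply/andP; split; [exact: ny|have := Knz x x; rewrite kernel_kdiag].
rewrite hnormZ normc_conj exprMn mulrC ler_pM2l ?kdiag_gt0//.
Qed.

(** For this value at x the 2 x 2 Pick matrix has rank one. *)
Lemma two_point_pick : complete_nevanlinna_pick H K -> forall x y, exists psi,
  [/\ multiplier H psi, (mult_norm H psi <= 1%:E)%E,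
      psi x = (Num.sqrt (1 - overlap x y))%:C & psi y = 0].
Proof.
move=> cnp x y; set l := Num.sqrt _.
have l2 : l ^+ 2 = 1 - overlap x y by rewrite sqr_sqrtr// subr_ge0 overlap_le1.
pose z (i : 'I_2) := if i == ord0 then x else y.
pose lam (i : 'I_2) : C := if i == ord0 then l%:C else 0.
pose Lambda (i : 'I_2) : 'M[C]_1 := (lam i)%:M.
have ny : (kdiag y)%:C != 0 :> C by rewrite -kernel_kdiag Knz.
have gram i j : K (z i) (z j) * (1 - lam i * (lam j)^*) =
    K (z i) y * (K (z j) y)^* / (kdiag y)%:C.
  rewrite -(kernel_conj evk ipk) /z /lam; case: ifP => _; case: ifP => _.
  - rewrite conjc_realE -realM -expr2 l2 (kernel_conj evk ipk x y) mulC_conj.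
    rewrite kernel_kdiag (_ : 1 = 1%:C)// -realB -realM -fmorph_div /=; congr (_%:C).
    by rewrite subKr /overlap; field; rewrite !gt_eqF ?kdiag_gt0.
  - by rewrite conjC0 mulr0 subr0 mulr1 kernel_kdiag mulfK.
  - by rewrite mul0r subr0 mulr1 kernel_kdiag mulrAC divff// mul1r.
  - by rewrite mul0r subr0 mulr1 kernel_kdiag mulfK.
have [//|//||Phi [Phim Phi1 PhiL]] := cnp 2%N 1%N _ _ z Lambda.
  apply/possemidefE => a.
  pose sg (p : 'I_(\sum_(i < 2) 1)) : 'I_2 := tagnat.sig1 p.
  have -> : \sum_p \sum_q (a p)^* * a q * (\mxblock_(i < 2, j < 2)
      (K (z i) (z j) *: (1%:M - Lambda i *m (Lambda j)^t*))) p q =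
     (\sum_p (a p)^* * K (z (sg p)) y) * (\sum_p (a p)^* * K (z (sg p)) y)^* / (kdiag y)%:C.
    rewrite rmorph_sum mulr_suml mulr_suml; apply: eq_bigr => p _.
    rewrite mulr_sumr mulr_suml; apply: eq_bigr => q _.
    rewrite !mxE big_ord1 !mxE !ord1 /= !mulr1n gram conjcM conjcK /sg; ring.
  by rewrite mulC_conj -fmorph_div lecR divr_ge0 ?sqr_ge0// ltW// kdiag_gt0.
exists (Phi 0 0); split.
- exact: Phim.
- apply: le_trans Phi1; apply: ge_ereal_sup => _ [f [g [f1 gf ->]]].
  apply: ereal_sup_ubound; exists (fun=> f), (fun=> g); split.
  + by rewrite /vhnorm big_ord1 sqrtr_sqr ger0_norm ?hnorm_ge0.
  + by move=> i t; rewrite big_ord1 ord1 gf.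
  + by rewrite /vhnorm big_ord1 sqrtr_sqr ger0_norm ?hnorm_ge0.
- by have /matrixP/(_ 0 0) := PhiL ord0; rewrite !mxE.
- by have /matrixP/(_ 0 0) := PhiL ord_max; rewrite !mxE.
Qed.

(** By the two preceding lemmas, the overlap is determined by the largest modulus
    at x of a contractive multiplier that vanishes at y, and composition with phi
    preserves contractive multipliers. *)
Lemma overlap_invariant (phi phi' : X -> X) : complete_nevanlinna_pick H K ->
  cancel phi phi' -> cancel phi' phi ->
  isometric_composition H phi -> isometric_composition H phi' ->
  forall x y, overlap (phi x) (phi y) = overlap x y.
Proof.
move=> cnp.
have le (f g : X -> X) : cancel f g -> isometric_composition H g ->
    forall x y, overlap (f x) (f y) <= overlap x y.
  move=> fK gi x y; have [psi [psim psi1 psix psiy]] := two_point_pick cnp x y.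
  have [m1 m2] := gi _ psim.
  have := @two_point_schwarz (psi \o g) (f x) (f y) m1; rewrite m2 => /(_ psi1).
  rewrite /= !fK psiy psix => /(_ erefl).
  rewrite normc_real ger0_norm ?sqrtr_ge0// sqr_sqrtr ?subr_ge0 ?overlap_le1//.
  by rewrite lerD2l lerN2.
move=> fK gK fi gi x y; apply/eqP; rewrite eq_le (le _ _ fK gi)/=.
by have := le _ _ gK fi (phi x) (phi y); rewrite !fK.
Qed.

End TwoPointPick.

(** * The radial profile of an invariant kernel on a disc *)

Section RadialProfile.
Variable R : realType.
Local Open Scope classical_set_scope.
Local Open Scope ring_scope.
Local Open Scope complex_scope.
Local Notation "x ^*" := (Num.conj x) : complex_scope.
Import Normc.
Notation C := R[i].
Notation Re := (@complex.Re R).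
Notation Im := (@complex.Im R).

(** The kernel (1 - z w^* )^(-alpha) equals exp (alpha * disc_height z) on the
    diagonal, so its logarithm is linear in this coordinate. *)
Definition disc_height (z : C) : R := - ln (1 - normc z ^+ 2).
Local Notation Y := disc_height.

Let Yr (t : R) : R := - ln (1 - t ^+ 2).

Lemma disc_height_ray (t : R) (u : C) : normc u = 1 -> Y (t%:C * u) = Yr t.
Proof.
by move=> u1; rewrite /disc_height normcM normc_real u1 mulr1 real_normK ?num_real.
Qed.

Let der_Yr (t : R) : `|t| < 1 -> der Yr t (2 * t / (1 - t ^+ 2)).
Proof.
move=> t1.
have t0 : 0 < 1 - t ^+ 2 by rewrite subr_gt0 -real_normK ?num_real// expr_lt1.
have d1 : der (fun t : R => 1 - t ^+ 2) t (0 - (2 * t ^+ 1 * 1)).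
  by apply: derB; [exact: der_cst|exact: (derX 2 (der_id t))].
apply: der_eq (derN (der_comp (g := fun t : R => 1 - t ^+ 2) (is_derive1_ln t0) d1)) _.
by rewrite expr1 mulr1 sub0r mulrN opprK mulrC.
Qed.

(* [kap] is the restriction of an invariant kernel to a complex line, and M is the
   logarithm of its diagonal as a function of the height. *)
Variables (kap : C -> C -> C) (M : R -> R).
Hypothesis kap_hol : forall z w, normc z < 1 -> normc w < 1 -> cdiff (kap ^~ w) z.
Hypothesis kap_conj : forall z w, normc z < 1 -> normc w < 1 -> kap w z = (kap z w)^*.
Hypothesis kap0 : forall z, normc z < 1 -> kap z 0 = 1.
Hypothesis M0 : M 0 = 0.
Hypothesis kapM : forall z w, normc z < 1 -> normc w < 1 ->
  normc (kap z w) ^+ 2 = expR (M (Y z) + M (Y w) - M (Y z + Y w + ln (normc (1 - z * w^*) ^+ 2))).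

Let lt01 : normc (0 : C) < 1. Proof. by rewrite normc0. Qed.

Let kap_neq0 z w : normc z < 1 -> normc w < 1 -> kap z w != 0.
Proof.
move=> z1 w1; rewrite -normc_gt0 lt_def normc_ge0 andbT -sqrf_eq0 kapM//.
by rewrite gt_eqF// expR_gt0.
Qed.

(** Both sides have the same modulus by [kapM], and the value 1 at z = 0. *)
Let kap_rot l z w : normc l = 1 -> normc z < 1 -> normc w < 1 ->
  kap (l * z) (l * w) = kap z w.
Proof.
move=> l1 z1 w1.
have nl x : normc (l * x) = normc x by rewrite normcM l1 mul1r.
have ll : l * l^* = 1 by rewrite mulC_conj l1 expr1n.
have lw1 : normc (l * w) < 1 by rewrite nl.
move: z z1; apply: (eq_of_eq_normc (f := fun z => kap (l * z) (l * w)) (g := fun z => kap z w)).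
- move=> z z1; have [|a Ha] := @kap_hol (l * z) (l * w) _ lw1; first by rewrite nl.
  by exists (a * (l * 1)); apply: der_comp Ha _; apply: derMl; exact: der_id.
- by move=> z z1; exact: kap_hol.
- by move=> z z1; exact: kap_neq0.
- move=> z z1; apply/eqP; rewrite -(eqrXn2 (n := 2)) ?normc_ge0//; apply/eqP.
  rewrite !kapM ?nl// /disc_height !nl conjcM.
  by rewrite (_ : l * z * (l^* * w^*) = z * w^*) // mulrACA ll mul1r.
- by rewrite mulr0 !(@kap_conj _ 0)// !kap0.
Qed.

Let kap_swap (r s : R) u : 0 < r < 1 -> 0 < s < 1 -> normc u = 1 ->
  kap (r%:C * u) s%:C = (kap (s%:C * u^*) r%:C)^*.
Proof.
move=> /andP[r0 r1] /andP[s0 s1] u1.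
have nr : normc r%:C < 1 by rewrite normc_real gtr0_norm.
have ns : normc s%:C < 1 by rewrite normc_real gtr0_norm.
have nu (z : C) : normc (z * u) = normc z by rewrite normcM u1 mulr1.
rewrite kap_conj ?nu// -(@kap_rot u^*) ?nu// ?normc_conj//; congr (kap _ _)^*; first by rewrite mulrC.
by rewrite mulrCA [u^* * u]mulrC mulC_conj u1 expr1n mulr1.
Qed.

(** Differentiating [kap_swap] along the unit circle shows that the products
    z f'(z) for f = kap (., s) at r u and for f = kap (., r) at s u^* are conjugate,
    as the values of these functions are. *)
Let angular (r s : R) u a b : 0 < r < 1 -> 0 < s < 1 -> normc u = 1 ->
  der (kap ^~ s%:C) (r%:C * u) a -> der (kap ^~ r%:C) (s%:C * u^*) b ->
  a * (r%:C * u) = (b * (s%:C * u^*))^*.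
Proof.
move=> r01 s01 u1 fa gb; pose I : C := 0 +i* 1.
pose e (c : C) (z : C) := cexp (z * c).
have de c : der (e c) 0 c.
  have dc : der (fun z : C => z * c) 0 (0 * 0 + c * 1) := derM (der_id 0) (der_cst c 0).
  have := der_comp (g := fun z : C => z * c) (der_cexp _) dc.
  by rewrite mul0r cexp0 mul0r add0r mulr1 mul1r.
have d1 : der (fun z => kap (r%:C * u * e I z) s%:C) 0 (a * (r%:C * u * I)).
  apply: (der_comp (f := kap ^~ s%:C) (g := fun z => r%:C * u * e I z) _ (derMl _ (de I))).
  by rewrite /e mul0r cexp0 mulr1.
have d2 : der (fun z => kap (s%:C * u^* * e (- I) z) r%:C) 0 (b * (s%:C * u^* * - I)).
  apply: (der_comp (f := kap ^~ r%:C) (g := fun z => s%:C * u^* * e (- I) z) _ (derMl _ (de (- I)))).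
  by rewrite /e mul0r cexp0 mulr1.
have line0 : 0 + 0%:C * 1 = 0 :> C by rewrite add0r mul0r.
have c1 : curve_der (fun t => kap (r%:C * u * e I (0 + t%:C * 1)) s%:C) 0 (a * (r%:C * u * I) * 1).
  apply: (curve_der_comp (f := fun z => kap (r%:C * u * e I z) s%:C)); last exact: curve_der_line.
  by rewrite line0.
have c2 : curve_der (fun t => kap (s%:C * u^* * e (- I) (0 + t%:C * 1)) r%:C) 0
    (b * (s%:C * u^* * - I) * 1).
  apply: (curve_der_comp (f := fun z => kap (s%:C * u^* * e (- I) z) r%:C)); last exact: curve_der_line.
  by rewrite line0.
have sw (t : R) : kap (r%:C * u * e I (0 + t%:C * 1)) s%:C =
    (kap (s%:C * u^* * e (- I) (0 + t%:C * 1)) r%:C)^*.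
  have ec : (e I (0 + t%:C * 1))^* = e (- I) (0 + t%:C * 1).
    rewrite /e -cexp_conj; congr cexp; rewrite add0r mulr1 conjcM conjc_realE.
    by congr (_ * _); rewrite /I; apply: eqC; rewrite ?Re_conj ?Im_conj /= ?oppr0.
  rewrite -mulrA -ec -mulrA -conjcM; apply: kap_swap => //.
  rewrite normcM u1 mul1r /e normc_cexp add0r mulr1 ReM /I /=.
  by rewrite mulr0 mul0r subr0 expR0.
have [r1 i1] := c1; have [r2 i2] := c2.
have E1 := der_uniq (der_ext (fun t => etrans (congr1 Re (sw t)) (Re_conj _)) r1) r2.
have E2 := der_uniq (der_ext (fun t => etrans (congr1 Im (sw t)) (Im_conj _)) i1) (derN i2).
have E : a * (r%:C * u * I) = (b * (s%:C * u^* * - I))^*.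
  by rewrite -[LHS]mulr1 -[b * _]mulr1; apply: eqC; rewrite ?Re_conj ?Im_conj.
have I0 : I != 0 by rewrite -normc_gt0 /I /= expr0n expr1n add0r sqrtr1.
apply: (mulIf I0); rewrite -mulrA E !conjcM conjcN.
have -> : I^* = - I by apply: eqC; rewrite ?Re_conj ?Im_conj /= ?oppr0.
by rewrite opprK !mulrA.
Qed.

Let xi (t : R) : R := 2 * t ^+ 2 / (1 - t ^+ 2).

Let Yrs (r s : R) (u : C) : R := Yr r + Yr s + ln (normc (1 - r%:C * u * s%:C) ^+ 2).

Let lt1_ray (r : R) u : `|r| < 1 -> normc u = 1 -> normc (r%:C * u) < 1.
Proof. by move=> r1 u1; rewrite normcM normc_real u1 mulr1. Qed.

Let kapMr (r s : R) u : `|r| < 1 -> `|s| < 1 -> normc u = 1 ->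
  normc (kap (r%:C * u) s%:C) ^+ 2 = expR (M (Yr r) + M (Yr s) - M (Yrs r s u)).
Proof.
move=> r1 s1 u1; have n1 : normc (1 : C) = 1 by rewrite normc1.
have ns : normc s%:C < 1 by rewrite normc_real.
have Ys : Y s%:C = Yr s by rewrite -(disc_height_ray s n1) mulr1.
by rewrite (kapM (lt1_ray r1 u1) ns) disc_height_ray// Ys conjc_realE.
Qed.

Let slope (r s : R) u : R :=
  2 * Re ((1 - r%:C * u * s%:C)^* * - (r%:C * u * s%:C)) / normc (1 - r%:C * u * s%:C) ^+ 2.

(** The real part of z f'(z) / f(z) is also the radial derivative of ln |f|, which [kapMr]
    expresses by the profile M. *)
Let radial (r s : R) u a m1 m3 : 0 < r < 1 -> 0 < s < 1 -> normc u = 1 ->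
  der (kap ^~ s%:C) (r%:C * u) a -> der M (Yr r) m1 -> der M (Yrs r s u) m3 ->
  2 * Re ((kap (r%:C * u) s%:C)^* * (a * (r%:C * u))) =
  normc (kap (r%:C * u) s%:C) ^+ 2 * (m1 * xi r - m3 * (xi r + slope r s u)).
Proof.
move=> /andP[r0 r1] /andP[s0 s1] u1 fa Mr My.
have r1' : `|r| < 1 by rewrite gtr0_norm.
have s1' : `|s| < 1 by rewrite gtr0_norm.
have lineE (t : R) : 0 + t%:C * u = t%:C * u by rewrite add0r.
have fa' : der (kap ^~ s%:C) (0 + r%:C * u) a by rewrite lineE.
have H1 := curve_der_normc2 (curve_der_comp (u := fun t : R => 0 + t%:C * u) fa' (curve_der_line 0 u r)).
have Hl := curve_der_normc2 (curve_der_line 1 (- (u * s%:C)) r).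
have lE (t : R) : 1 + t%:C * - (u * s%:C) = 1 - t%:C * u * s%:C by rewrite mulrN mulrA.
have l0 : 0 < normc (1 + r%:C * - (u * s%:C)) ^+ 2.
  rewrite lE exprn_gt0// normc_gt0; apply/Re_gt0_neq0/Re_1B.
  by rewrite !normcM !normc_real u1 mulr1 mulr_ilt1.
have Hl' := der_comp (g := fun t : R => normc (1 + t%:C * - (u * s%:C)) ^+ 2) (is_derive1_ln l0) Hl.
have HY := derD (derD (der_Yr r1') (der_cst (Yr s) r)) Hl'.
have YE (t : R) : Yr t + Yr s + ln (normc (1 + t%:C * - (u * s%:C)) ^+ 2) = Yrs t s u by rewrite lE.
have My' : der M (Yr r + Yr s + ln (normc (1 + r%:C * - (u * s%:C)) ^+ 2)) m3 by rewrite YE.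
have HM := derB (derD (der_comp Mr (der_Yr r1')) (der_cst (M (Yr s)) r))
  (der_comp (g := fun t : R => Yr t + Yr s + ln (normc (1 + t%:C * - (u * s%:C)) ^+ 2)) My' HY).
have HE := der_comp (g := fun t : R => M (Yr t) + M (Yr s) -
   M (Yr t + Yr s + ln (normc (1 + t%:C * - (u * s%:C)) ^+ 2))) (is_derive_expR _) HM.
have d0 : 0 < 1 - r by rewrite subr_gt0.
have near (t : R) : `|t - r| < 1 - r -> expR (M (Yr t) + M (Yr s) -
    M (Yr t + Yr s + ln (normc (1 + t%:C * - (u * s%:C)) ^+ 2))) =
    normc (kap (0 + t%:C * u) s%:C) ^+ 2.
  move=> tr; rewrite YE lineE kapMr//.
  by rewrite -(subrK r t) (le_lt_trans (ler_normD _ _))// (gtr0_norm r0) -ltrBrDr.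
have HN := der_near d0 near HE.
have := der_uniq H1 HN; rewrite YE -kapMr// lineE lE => /(congr1 (fun x => x * r)).
have ReZ (z : C) (x : R) : Re z * x = Re (z * x%:C) by rewrite ReM /= mulr0 subr0.
rewrite -mulrA ReZ => E.
have -> : a * (r%:C * u) = a * u * r%:C by rewrite -mulrA [u * _]mulrC.
rewrite [_^* * (_ * _)]mulrA E -[LHS]mulrA; congr (_ * _).
rewrite /slope /xi.
have -> : (1 - r%:C * u * s%:C)^* * - (r%:C * u * s%:C) =
  (1 - r%:C * u * s%:C)^* * - (u * s%:C) * r%:C by ring.
rewrite -(ReZ _ r); move: (Re _) => x; move: (normc _) => N.
rewrite !addr0; move: (_ ^- 2) (1 - r ^+ 2)^-1 => N' q.
ring.
Qed.

(** The real parts of the two logarithmic derivatives in [angular] agree, and the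
    term [slope] is the same for both. *)
Let identity (r s : R) u m1 m2 m3 : 0 < r < 1 -> 0 < s < 1 -> normc u = 1 ->
  der M (Yr r) m1 -> der M (Yr s) m2 -> der M (Yrs r s u) m3 ->
  m1 * xi r - m2 * xi s = m3 * (xi r - xi s).
Proof.
move=> r01 s01 u1 Mr Ms My.
have lt1 (t : R) v : 0 < t < 1 -> normc v = 1 -> normc (t%:C * v) < 1.
  by case/andP=> t0 t1 v1; apply: lt1_ray => //; rewrite gtr0_norm.
have lt1' (t : R) : 0 < t < 1 -> normc t%:C < 1.
  by move=> t01; rewrite -[t%:C]mulr1 lt1// normc1.
have u1' : normc u^* = 1 by rewrite normc_conj.
have [a fa] := kap_hol (lt1 r u r01 u1) (lt1' s s01).
have [b gb] := kap_hol (lt1 s u^* s01 u1') (lt1' r r01).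
have cE : 1 - s%:C * u^* * r%:C = (1 - r%:C * u * s%:C)^*.
  by rewrite conjcB conjC1 !conjcM !conjc_realE; congr (1 - _); ring.
have yE : Yrs s r u^* = Yrs r s u by rewrite /Yrs cE normc_conj [Yr s + _]addrC.
have slE : slope s r u^* = slope r s u.
  rewrite /slope cE normc_conj; congr (2 * _ / _).
  rewrite -[LHS]Re_conj conjcM conjcN !conjcM !conjcK !conjc_realE; congr Re.
  by ring.
have H1 := radial r01 s01 u1 fa Mr My.
have My' : der M (Yrs s r u^*) m3 by rewrite yE.
have H2 := radial s01 r01 u1' gb Ms My'.
have N2 : normc (kap (s%:C * u^*) r%:C) = normc (kap (r%:C * u) s%:C).
  by rewrite (kap_swap r01 s01 u1) normc_conj.
have E : 2 * Re ((kap (r%:C * u) s%:C)^* * (a * (r%:C * u))) =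
    2 * Re ((kap (s%:C * u^*) r%:C)^* * (b * (s%:C * u^*))).
  rewrite (angular r01 s01 u1 fa gb) (kap_swap r01 s01 u1) -[in RHS]Re_conj !conjcM !conjcK.
  by [].
have N0 : normc (kap (r%:C * u) s%:C) ^+ 2 != 0.
  by rewrite sqrf_eq0 gt_eqF// normc_gt0 kap_neq0 ?lt1 ?lt1'.
rewrite H1 H2 N2 slE in E; have {}E := mulfI N0 E.
apply/eqP; rewrite -subr_eq0; apply/eqP.
transitivity ((m1 * xi r - m3 * (xi r + slope r s u)) - (m2 * xi s - m3 * (xi s + slope r s u))).
  by ring.
by rewrite E subrr.
Qed.

(** Every height [y0 > 0], and those close to it, are reached by fixed distinct
    radii and a variable direction [u y]. *)
Let parametrization (y0 : R) : 0 < y0 -> exists r s : R, exists u : R -> C,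
  [/\ 0 < r < 1, 0 < s < 1, xi r != xi s, exists v, curve_der u y0 v &
   exists2 e, 0 < e & forall y, `|y - y0| < e -> normc (u y) = 1 /\ Yrs r s (u y) = y].
Proof.
move=> y00; pose E := expR y0; have E1 : 1 < E by rewrite expR_gt1.
have E0 : 0 < E by apply: lt_trans E1.
(* With r^2 = p and s^2 = si the direction u = i has height y0, which is the
   relation [rel] below. *)
pose si := (E - 1) / (4 * E); pose de := si + E * (1 - si); pose p := (E * (1 - si) - 1) / de.
have siE : E * si = (E - 1) / 4 by rewrite /si; field; rewrite gt_eqF.
have si0 : 0 < si by rewrite divr_gt0 ?subr_gt0 ?mulr_gt0.
have si1 : si < 1 / 4 by rewrite /si ltr_pdivrMr ?mulr_gt0//; lra.
have de0 : 0 < de by rewrite /de mulrBr siE; lra.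
have pE : p * de = E * (1 - si) - 1 by rewrite /p divfK// gt_eqF.
have p0 : 0 < p by rewrite divr_gt0// mulrBr siE; lra.
have p1 : p < 1 by rewrite ltr_pdivrMr// mul1r /de; lra.
have psi' : p != si.
  rewrite gt_eqF// -(ltr_pM2r de0) pE /de mulrBr mulr1 siE.
  have : si * (si + (E - (E - 1) / 4)) < si * E.
    have : si < E * si by rewrite ltr_pMl.
    by rewrite ltr_pM2l// siE; lra.
  by rewrite [si * E]mulrC siE; lra.
have rel : 1 + p * si = E * ((1 - p) * (1 - si)) by move: pE; rewrite /de; lra.
pose r := Num.sqrt p; pose s := Num.sqrt si.
have r2 : r ^+ 2 = p by rewrite sqr_sqrtr// ltW.
have s2 : s ^+ 2 = si by rewrite sqr_sqrtr// ltW.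
have r0 : 0 < r by rewrite sqrtr_gt0.
have s0 : 0 < s by rewrite sqrtr_gt0.
have r1 : r < 1 by rewrite -sqrtr1 ltr_sqrt.
have s1 : s < 1 by rewrite -sqrtr1 ltr_sqrt//; lra.
have c0 : 0 < 2 * r * s by rewrite !mulr_gt0.
pose q (y : R) : R := (2 * r * s)^-1 * (1 + p * si - expR y * ((1 - p) * (1 - si))).
have q0 : q y0 = 0 by rewrite /q -rel subrr mulr0.
pose u (y : R) : C := q y +i* Num.sqrt (1 - q y ^+ 2).
have [q' Hq] : exists q', der q y0 q'.
  eexists; apply: derMl; apply: derB; first exact: der_cst.
  by apply: derM; [exact: is_derive_expR|exact: der_cst].
exists r, s, u; split; rewrite ?r0 ?s0//.
- rewrite /xi r2 s2 -subr_eq0.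
  have np : 1 - p != 0 by rewrite gt_eqF// subr_gt0.
  have ns : 1 - si != 0 by rewrite gt_eqF//; lra.
  have -> : 2 * p / (1 - p) - 2 * si / (1 - si) = 2 * (p - si) / ((1 - p) * (1 - si)).
    by field; rewrite np ns.
  by apply: mulf_neq0; [apply: mulf_neq0; rewrite ?pnatr_eq0 ?subr_eq0|rewrite invr_eq0 mulf_neq0].
- exists (q' +i* 0); split => //=.
  have q2 : 0 < 1 - q y0 ^+ 2 by rewrite q0 expr0n subr0.
  have H2 : der (fun y => 1 - q y ^+ 2) y0 (0 - 2 * q y0 ^+ 1 * q').
    by apply: derB; [exact: der_cst|exact: (derX 2 Hq)].
  apply: der_eq (der_comp (g := fun y => 1 - q y ^+ 2) (is_derive1_sqrt q2) H2) _.
  by rewrite q0 expr1 mulr0 mul0r subr0 mulr0.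
- have /cvgrPdist_lt/(_ 1 ltr01)/nbhs_ballP[e /= e0 He] := der_cont Hq.
  exists e => // y ye; have {He ye} q1 : `|q y| < 1.
    by have := He y; rewrite /ball /= distrC q0 sub0r normrN; exact.
  have w0 : 0 <= 1 - q y ^+ 2 by rewrite subr_ge0 -real_normK ?num_real// expr_le1// ltW.
  have w2 := sqr_sqrtr w0.
  split; first by rewrite /u /= w2 addrC subrK sqrtr1.
  rewrite /Yrs; have -> : normc (1 - r%:C * u y * s%:C) ^+ 2 = expR y * ((1 - p) * (1 - si)).
    rewrite sqr_normcE !(ReD, ImD, ReN, ImN, ReM, ImM) /=.
    rewrite !(mul0r, mulr0, subr0, addr0, add0r, sub0r) sqrrN exprMn exprMn w2 s2 r2.
    have -> : expR y * ((1 - p) * (1 - si)) = 1 + p * si - 2 * r * s * q y.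
      by rewrite /q mulVKf ?gt_eqF// subKr.
    rewrite -r2 -s2; ring.
  rewrite lnM ?posrE ?expR_gt0 ?mulr_gt0 ?subr_gt0//; last lra.
  by rewrite expRK lnM ?posrE ?subr_gt0//; [rewrite /Yr r2 s2; ring|lra].
Qed.

(** Along the parametrization, M y is a constant minus the logarithm of
    |kap|^2. *)
Let M_der (y0 : R) : 0 < y0 -> exists a, der M y0 a.
Proof.
move=> y00; have [r [s [u [r01 s01 _ [v uv] [e e0 He]]]]] := parametrization y00.
have [r0 r1] := andP r01; have [s0 s1] := andP s01.
have r1' : `|r| < 1 by rewrite gtr0_norm.
have s1' : `|s| < 1 by rewrite gtr0_norm.
have ye0 : `|y0 - y0| < e by rewrite subrr normr0.
have [u1 _] := He y0 ye0.
have ns : normc s%:C < 1 by rewrite normc_real.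
have [a fa] := kap_hol (lt1_ray r1' u1) ns.
have fa' : der (fun z => kap (r%:C * z) s%:C) (u y0) (a * (r%:C * 1)).
  by apply: (der_comp (f := kap ^~ s%:C) (g := fun z => r%:C * z)) => //; apply: derMl; exact: der_id.
have H1 := curve_der_normc2 (curve_der_comp fa' uv).
have N0 : 0 < normc (kap (r%:C * u y0) s%:C) ^+ 2.
  by rewrite exprn_gt0// normc_gt0 kap_neq0// lt1_ray.
have H2 := der_comp (g := fun y => normc (kap (r%:C * u y) s%:C) ^+ 2) (is_derive1_ln N0) H1.
have H3 := derB (der_cst (M (Yr r) + M (Yr s)) y0) H2.
eexists; apply: der_near e0 _ H3 => y ye; have [uy Ey] := He y ye.
by rewrite kapMr// expRK Ey opprB addrC subrK.
Qed.

Let M' (y : R) : R := 'D_1 M y.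

Let M'P (y : R) : 0 < y -> der M y (M' y).
Proof. by move=> /M_der[a Ma]; rewrite /M'; have [_ ->] := Ma. Qed.

Let Yr_gt0 (r : R) : 0 < r < 1 -> 0 < Yr r.
Proof.
move=> /andP[r0 r1]; rewrite oppr_gt0 -ln1 ltr_ln ?posrE// ?ltrBlDr ?ltrDl ?exprn_gt0//.
by rewrite subr_gt0 expr_lt1 ?ltW.
Qed.

(** On the left of [identity] nothing depends on u, so that M' is locally
    constant. *)
Let M'_cst (y : R) : 0 < y -> M' y = M' 1.
Proof.
move: y.
have loc (y0 : R) : 0 < y0 -> der M' y0 0.
  move=> y00; have [r [s [u [r01 s01 rs _ [e e0 He]]]]] := parametrization y00.
  have const y : 0 < y -> `|y - y0| < e ->
      M' y = (M' (Yr r) * xi r - M' (Yr s) * xi s) / (xi r - xi s).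
    move=> y1 ye; have [uy Ey] := He y ye.
    rewrite (@identity r s (u y) _ _ (M' y))// ?Ey; try by apply: M'P; rewrite ?Yr_gt0.
    by rewrite mulfK// subr_eq0.
  have d0 : 0 < Num.min e y0 by rewrite lt_min e0.
  apply: (der_near d0 _ (der_cst (M' y0) y0)) => y.
  rewrite lt_min => /andP[ye yy0]; have ye0 : `|y0 - y0| < e by rewrite subrr normr0.
  have y1 : 0 < y by move: yy0; rewrite ltr_norml; lra.
  by rewrite (const y0 y00 ye0) (const y y1 ye).
move=> y y0; have [y1|y1] := leP y 1.
  by apply/esym/der0_cst => // x /andP[yx _]; apply: loc; exact: lt_le_trans yx.
by apply: der0_cst (ltW y1) _ => x /andP[x1 _]; apply: loc; exact: lt_le_trans x1.
Qed.

Let M_affine (y : R) : 0 < y -> M y = M 1 - M' 1 + M' 1 * y.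
Proof.
move=> y0; pose G (x : R) := M x - M' 1 * x.
have dG (x : R) : 0 < x -> der G x 0.
  move=> x0; apply: der_eq (derB (M'P x0) (derMl (M' 1) (der_id x))) _.
  by rewrite M'_cst// mulr1 subrr.
suff : G y = G 1 by rewrite /G mulr1 => <-; rewrite subrK.
have [y1|y1] := leP y 1.
  by apply/esym/der0_cst => // x /andP[yx _]; apply: dG; exact: lt_le_trans yx.
by apply: der0_cst (ltW y1) _ => x /andP[x1 _]; apply: dG; exact: lt_le_trans x1.
Qed.

Let right_cont (G : R -> R) (a c e : R) : 0 < e -> der G 0 a ->
  (forall t, 0 < t < e -> G t = c) -> G 0 = c.
Proof.
move=> e0 Ga Gc; apply/eqP; rewrite -subr_eq0 -normr_eq0 eq_le normr_ge0 andbT.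
apply/ler_addgt0Pr => x x0; rewrite add0r.
have /cvgrPdist_lt/(_ x x0)/nbhs_ballP[f /= f0 Hf] := der_cont Ga.
pose t := Num.min e f / 2; have m0 : 0 < Num.min e f by rewrite lt_min e0.
have t0 : 0 < t by rewrite divr_gt0.
have tm : t < Num.min e f by rewrite /t; lra.
have /andP[te tf] : (t < e) && (t < f) by rewrite -lt_min.
rewrite -(Gc t) ?t0//; apply/ltW/Hf.
by rewrite /ball /= sub0r normrN gtr0_norm.
Qed.

(** M is affine on the positive half-line; letting t tend to 0 in kap (t, s) shows
    that its constant term is 0. *)
Lemma radial_profile : exists alpha : R, forall y, 0 <= y -> M y = alpha * y.
Proof.
exists (M' 1) => y; rewrite le_eqVlt => /predU1P[<-|/M_affine ->]; first by rewrite M0 mulr0.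
suff -> : M 1 - M' 1 = 0 by rewrite add0r.
set al := M' 1; set be := M 1 - al.
pose s : R := 1 / 2; have s0 : 0 < s by rewrite /s; lra. have s1 : s < 1 by rewrite /s; lra.
have s1' : `|s| < 1 by rewrite gtr0_norm.
have n1 : normc (1 : C) = 1 by rewrite normc1.
pose l (t : R) : R := ln ((1 - t * s) ^+ 2).
pose G (t : R) : R := normc (kap (0 + t%:C * 1) s%:C) ^+ 2 * expR (al * l t).
have dl : der l 0 (((1 - 0 * s) ^+ 2)^-1 * (2%:R * (1 - 0 * s) ^+ 1 * (0 - (0 * 0 + s * 1)))).
  apply: (der_comp (f := @ln R) (g := fun t : R => (1 - t * s) ^+ 2)).
    by apply: is_derive1_ln; rewrite mul0r subr0 expr1n.
  apply: (derX 2); apply: derB; first exact: der_cst.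
  exact: (derM (der_id 0) (der_cst s 0)).
have ns : normc s%:C < 1 by rewrite normc_real.
have [a fa] := kap_hol lt01 ns.
have fa' : der (kap ^~ s%:C) (0 + 0%:C * 1) a by rewrite add0r mul0r.
have H1 := curve_der_normc2 (curve_der_comp (u := fun t : R => 0 + t%:C * 1) fa' (curve_der_line 0 1 0)).
have H2 := der_comp (is_derive_expR _) (derMl al dl).
have HG := derM H1 H2.
have := right_cont (G := G) (c := expR be) s0 HG.
have -> : G 0 = 1.
  rewrite /G add0r mul0r (kap_conj ns lt01) (kap0 ns) conjC1 n1 expr1n mul1r.
  by rewrite /l mul0r subr0 expr1n ln1 mulr0 expR0.
suff Gs (t : R) : 0 < t < s -> G t = expR be.
  by move=> /(_ Gs) G1; rewrite -(expRK be) -G1 ln1.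
move=> /andP[t0 ts]; have t1 : t < 1 := lt_trans ts s1.
have t1' : `|t| < 1 by rewrite gtr0_norm.
have nE : normc (1 - t%:C * 1 * s%:C) ^+ 2 = (1 - t * s) ^+ 2.
  by rewrite mulr1 -realM -(realB 1) normc_real real_normK ?num_real.
have Yt : 0 < Yr t by rewrite Yr_gt0// t0.
have Ys : 0 < Yr s by rewrite Yr_gt0// s0.
have pt : 0 < 1 - t ^+ 2 by rewrite subr_gt0 expr_lt1// ltW.
have ps : 0 < 1 - s ^+ 2 by rewrite subr_gt0 expr_lt1// ltW.
have ts1 : 0 < 1 - t * s by rewrite subr_gt0 mulr_ilt1// ltW.
have y0 : 0 < Yr t + Yr s + l t.
  rewrite /Yr /l -opprD addrC subr_gt0 -lnM ?posrE// ltr_ln ?posrE ?mulr_gt0 ?exprn_gt0//.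
  by rewrite -subr_gt0 (_ : _ - _ = (s - t) ^+ 2) ?exprn_gt0 ?subr_gt0//; ring.
have YsE : Yrs t s 1 = Yr t + Yr s + l t by rewrite /Yrs nE.
rewrite /G add0r (kapMr t1' s1' n1) YsE (M_affine Yt) (M_affine Ys) (M_affine y0) -expRD.
rewrite -/al -/be; congr expR; rewrite /be /al.
by move: (Yr t) (Yr s) (l t) (M 1) (M' 1) => a1 a2 a3 b c; ring.
Qed.

End RadialProfile.

(** * Necessity: invariant complete Pick kernels are powers *)

Section Necessity.
Variables (R : realType) (d : option nat).
Local Open Scope classical_set_scope.
Local Open Scope ring_scope.
Local Open Scope complex_scope.
Local Notation "x ^*" := (Num.conj x) : complex_scope.
Import Normc.
Notation C := R[i].
Notation Re := (@complex.Re R).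
Notation Im := (@complex.Im R).
Notation E := (ell2 R d).
Notation B := (uball R d).

(** A total map, so that functions on the ball can be evaluated along lines
    without proofs of membership. *)
Definition pt (v : E) : B := insubd (origin R d) v.

Lemma val_pt (v : E) : en v < 1 -> val (pt v) = v.
Proof. by move=> v1; rewrite /pt val_insubd in_uballE v1. Qed.

Lemma inner_pt (v w : E) : en v < 1 -> en w < 1 ->
  inner (val (pt v)) (val (pt w)) = inner v w.
Proof. by move=> v1 w1; rewrite (val_pt v1) (val_pt w1). Qed.

Lemma pt_val (z : B) : pt (val z) = z.
Proof. by apply: uball_inj; rewrite val_pt// uball_lt1. Qed.

Lemma pt0 : pt 0 = origin R d.
Proof. exact: (pt_val (origin R d)). Qed.

Lemma extend0_pt (f : B -> C) (v : E) : en v < 1 -> extend0 f v = f (pt v).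
Proof. by move=> v1; rewrite (extend0E f v1); congr f; apply: uball_inj; rewrite val_pt. Qed.

Lemma cdiff_pt (f : B -> C) (e : E) (z : C) : holomorphic f -> en e = 1 -> normc z < 1 ->
  cdiff (fun t => f (pt (t *: e))) z.
Proof.
move=> fh e1 z1; have ne t : en (t *: e) = normc t by rewrite enZ e1 mulr1.
have [|a fa] := @cdiff_line R d f e z fh; first by rewrite ne.
exists a; have d0 : 0 < (1 - normc z)%:C :> C by rewrite ltcR subr_gt0.
apply: (der_near d0 _ fa) => t; rewrite normc_lt => tz.
rewrite extend0_pt// ne -(subrK z t) (le_lt_trans (le_normcD _ _))//.
by rewrite -ltrBrDr.
Qed.

Definition height (z : B) : R := - ln (1 - en (val z) ^+ 2).

Lemma one_sub_en (z : B) : 0 < 1 - en (val z) ^+ 2.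
Proof. by rewrite subr_gt0 expr_lt1 ?en_ge0 ?uball_lt1. Qed.

Lemma height_ge0 z : 0 <= height z.
Proof.
rewrite oppr_ge0 -ln1 ler_ln ?posrE ?one_sub_en// lerBlDr lerDl sqr_ge0//.
Qed.

Lemma height_moeb (z w : B) :
  height (ball_moeb w z) = height z + height w + ln (normc (1 - inner (val z) (val w)) ^+ 2).
Proof.
have n0 : 0 < normc (1 - inner (val z) (val w)) ^+ 2.
  by rewrite exprn_gt0// normc_gt0 inner1B_neq0.
have E1 : 1 - en (val (ball_moeb w z)) ^+ 2 =
    (1 - en (val w) ^+ 2) * (1 - en (val z) ^+ 2) / normc (1 - inner (val z) (val w)) ^+ 2.
  apply: complexI; have := inner_moeb w z z; rewrite -!val_ball_moeb !inner_self.
  have -> : 1 - inner (val w) (val z) = (1 - inner (val z) (val w))^*.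
    by rewrite conjcB conjC1 -inner_conj.
  rewrite mulC_conj -!(realB 1) -realM => ->.
  by rewrite -fmorph_div.
move: E1 n0; rewrite /height; move: (normc _ ^+ 2) => N -> N0.
rewrite lnM ?posrE ?invr_gt0 ?mulr_gt0 ?one_sub_en// lnV ?posrE//.
by rewrite lnM ?posrE ?one_sub_en//; ring.
Qed.

Variables (H : rkhs R B) (K : B -> B -> C).
Hypothesis H_analytic : forall f : H, holomorphic (ev f : B -> C).
Variable k : B -> H.
Hypothesis evk : forall x y, ev (k y) x = K x y.
Hypothesis ipk : forall f y, ev f y = ip H f (k y).
Hypothesis Knorm : normalized_at K (origin R d).
Hypothesis Kirr : irreducible K.
Hypothesis cnp : complete_nevanlinna_pick H K.
Hypothesis inv : forall phi : B -> B, is_automorphism phi -> isometric_composition H phi.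

Notation o := (origin R d).
Notation n := (kdiag k).
Let Knz := Kirr.1.
Let n_gt0 z : 0 < n z := kdiag_gt0 evk ipk Knz z.

Let overlap_aut (phi : B -> B) : is_automorphism phi ->
  forall z w, overlap K k (phi z) (phi w) = overlap K k z w.
Proof.
move=> phA; have [ph [phi' [ph' phK phK']]] := phA.
apply: (overlap_invariant evk ipk Knz cnp phK phK'); first exact: inv.
by apply: inv; split=> //; exists phi.
Qed.

Let n0 : n o = 1.
Proof. by apply: complexI; rewrite -(kernel_kdiag evk ipk) Knorm. Qed.

Let overlap0 z : overlap K k z o = (n z)^-1.
Proof. by rewrite /overlap Knorm normc1 expr1n n0 mulr1 mul1r. Qed.

Let n_radial z w : en (val z) = en (val w) -> n z = n w.
Proof.
move=> zw; have [phi phA [phz phI]] := unitary_transitive zw.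
have ph0 : phi o = o.
  apply: uball_inj; apply: en_eq0; apply/eqP; rewrite -sqrf_eq0; apply/eqP/complexI.
  by rewrite -inner_self phI inner0l.
by apply: invr_inj; rewrite -!overlap0 -[in RHS]ph0 -phz overlap_aut.
Qed.

Let K2 z w : normc (K z w) ^+ 2 = n z * n w / n (ball_moeb w z).
Proof.
have := overlap_aut (ball_moeb_automorphism w) z w; rewrite moeba overlap0 => ->.
by rewrite /overlap mulrC divfK// gt_eqF// mulr_gt0.
Qed.

Section Direction.
Variable e : E.
Hypothesis e1 : en e = 1.

Let ne t : en (t *: e) = normc t. Proof. by rewrite enZ e1 mulr1. Qed.

Let M (y : R) : R := ln (n (pt ((Num.sqrt (1 - expR (- y)))%:C *: e))).

Let nM z : n z = expR (M (height z)).
Proof.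
rewrite /M lnK ?posrE ?n_gt0// /height opprK lnK ?posrE ?one_sub_en// subKr sqrtr_sqr.
rewrite ger0_norm ?en_ge0//; apply: n_radial; rewrite val_pt ne normc_real ger0_norm ?en_ge0//.
exact: uball_lt1.
Qed.

Let KM z w : normc (K z w) ^+ 2 =
  expR (M (height z) + M (height w) -
        M (height z + height w + ln (normc (1 - inner (val z) (val w)) ^+ 2))).
Proof. by rewrite K2 !nM height_moeb expRB expRD. Qed.

(** Since unitary maps act transitively on spheres, invariance of the overlap makes
    the diagonal of K a function of the norm. Moving w to 0 by an involution then
    expresses |K (z, w)| by the diagonal, which is the situation of
    [radial_profile]. *)
Lemma kernel_modulus : exists alpha : R, forall z w,
  normc (K z w) ^+ 2 = expR (- alpha * ln (normc (1 - inner (val z) (val w)) ^+ 2)).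
Proof.
have hp z : normc z < 1 -> height (pt (z *: e)) = disc_height z.
  by move=> z1; rewrite /height val_pt ne.
have [|||||alpha Ma] := @radial_profile R (fun z w => K (pt (z *: e)) (pt (w *: e))) M.
- move=> z w z1 w1; have := cdiff_pt (H_analytic (k (pt (w *: e)))) e1 z1.
  by move=> [a fa]; exists a; apply: der_ext fa => t; rewrite evk.
- by move=> z w _ _; exact: (kernel_conj evk ipk).
- by move=> z _; rewrite scale0r pt0 Knorm.
- by rewrite /M oppr0 expR0 subrr sqrtr0 scale0r pt0 n0 ln1.
- move=> z w z1 w1; have zb : en (z *: e) < 1 by rewrite ne.
  have wb : en (w *: e) < 1 by rewrite ne.
  have -> : z * w^* = inner (val (pt (z *: e))) (val (pt (w *: e))).
    by rewrite (inner_pt zb wb) innerZl innerZr inner_self e1 expr1n mulr1.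
  by rewrite -(hp z z1) -(hp w w1); exact: KM.
exists alpha => z w; rewrite KM !Ma ?height_ge0//; last by rewrite -height_moeb height_ge0.
by congr expR; ring.
Qed.

End Direction.

(** On the line of z both sides are holomorphic in z with equal moduli, and they
    have the value 1 at 0. *)
Lemma kernel_power (alpha : R) :
  (forall z w, normc (K z w) ^+ 2 =
     expR (- alpha * ln (normc (1 - inner (val z) (val w)) ^+ 2))) ->
  forall z w, K z w = 1 / cpow (1 - inner (val z) (val w)) alpha.
Proof.
move=> KE z w.
have [z0|z0] := eqVneq (en (val z)) 0.
  have -> : z = o by apply: uball_inj; exact: en_eq0.
  by rewrite /= inner0l subr0 cpow1 divr1 (kernel_conj evk ipk w) Knorm conjC1.
have zp : 0 < en (val z) by rewrite lt_def z0 en_ge0.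
pose e : E := (en (val z))^-1%:C *: val z.
have e1 : en e = 1 by rewrite enZ normc_real gtr0_norm ?invr_gt0// mulVf.
have ze : val z = (en (val z))%:C *: e by rewrite scalerA -realM divff// scale1r.
have ne t : en (t *: e) = normc t by rewrite enZ e1 mulr1.
have Re0 t : normc t < 1 -> 0 < Re (1 - t * inner e (val w)).
  by move=> t1; rewrite -innerZl; apply/Re_1B/inner_lt1; rewrite ?ne ?uball_lt1.
have Hfg : forall t, normc t < 1 -> K (pt (t *: e)) w = (cpow (1 - t * inner e (val w)) alpha)^-1.
  apply: eq_of_eq_normc => [t t1|t t1|t t1|t t1|].
  - have [a fa] := cdiff_pt (H_analytic (k w)) e1 t1.
    by exists a; apply: der_ext fa => s; rewrite evk.
  - have dt : der (fun t : C => 1 - t * inner e (val w)) t (0 - (t * 0 + inner e (val w) * 1)).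
      by apply: derB; [exact: der_cst|exact: derM (der_id t) (der_cst (inner e (val w)) t)].
    have dc := der_comp (g := fun t : C => 1 - t * inner e (val w)) (der_cpow alpha (Re0 t t1)) dt.
    by eexists; apply: derV dc; exact: cpow_neq0.
  - by rewrite invr_eq0 cpow_neq0.
  - apply/eqP; rewrite -(eqrXn2 (n := 2)) ?normc_ge0//; apply/eqP.
    have n0' := Re_gt0_neq0 (Re0 t t1); have p0 := n0'; rewrite -normc_gt0 in p0.
    rewrite KE val_pt ?ne// innerZl normcV normc_cpow// -powRN.
    rewrite /powR (gt_eqF p0) [RHS]expr2 -expRD lnXn//; congr expR.
    by rewrite mulr2n; ring.
  - by rewrite scale0r pt0 (kernel_conj evk ipk w) Knorm conjC1 mul0r subr0 cpow1 invr1.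
have := Hfg (en (val z))%:C; rewrite normc_real gtr0_norm// uball_lt1 => /(_ isT).
by rewrite -ze pt_val -innerZl -ze mul1r.
Qed.

(** alpha >= 0 because the overlap with the origin is at most 1; alpha <> 0 because
    [k x] and [k o] are independent; alpha <= 1 by Schwarz's lemma for the extremal
    multiplier that vanishes at the origin. *)
Lemma exponent_bounds (alpha : R) (x : B) : x <> o ->
  (forall z w, K z w = 1 / cpow (1 - inner (val z) (val w)) alpha) -> 0 < alpha <= 1.
Proof.
move=> xo KE.
have x0 : en (val x) != 0.
  by apply/eqP => x0; apply: xo; apply: uball_inj; exact: en_eq0.
have xp : 0 < en (val x) by rewrite lt_def x0 en_ge0.
set c := 1 - en (val x) ^+ 2; have c0 : 0 < c := one_sub_en x.
have c1 : c < 1 by rewrite /c ltrBlDr ltrDl exprn_gt0.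
have nx : (n x)^-1 = c `^ alpha.
  have := kernel_kdiag evk ipk x; rewrite KE inner_self -(realB 1) cpow_real// mul1r.
  by rewrite -fmorphV => /complexI <-; rewrite invrK.
have le1 : c `^ alpha <= 1 by rewrite -nx -overlap0 (overlap_le1 evk ipk Knz).
have lnc : ln c < 0 by rewrite -ln1 ltr_ln ?posrE.
have al0 : 0 <= alpha.
  by move: le1; rewrite /powR gt_eqF// -expR0 ler_expR nmulr_lle0.
have al1 : alpha != 0.
  apply/eqP => a0; have [] := Kirr.2 x o xo 1 (-1).
    move=> t; rewrite !KE a0 /cpow !mul0r !cexp0.
    by rewrite mul1r divr1 mulN1r subrr.
  by move=> /eqP; rewrite oner_eq0.
rewrite lt_def al1 al0 /=.
have [psi [psim psi1 psix psi0]] := two_point_pick evk ipk Knz cnp x o.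
have psiB z : normc (psi z) <= 1.
  have := two_point_schwarz evk ipk Knz z psim psi1 psi0; rewrite -(expr_le1 (n := 2)) ?normc_ge0//.
  by move=> /le_trans; apply; rewrite lerBlDr lerDl overlap0 invr_ge0 ltW.
have [g gE] : exists g : H, forall z, ev g z = psi z.
  have [g gE] := psim (k o); exists g => z.
  by rewrite gE evk Knorm mulr1.
pose e : E := (en (val x))^-1%:C *: val x.
have e1 : en e = 1 by rewrite enZ normc_real gtr0_norm ?invr_gt0// mulVf.
have xe : val x = (en (val x))%:C *: e by rewrite scalerA -realM divff// scale1r.
have := @schwarz R (fun t => psi (pt (t *: e))) _ _ _ (en (val x))%:C.
rewrite -xe pt_val psix !normc_real gtr0_norm// uball_lt1 => S.
have {S} : `|Num.sqrt (1 - overlap K k x o)| <= en (val x).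
  apply: S => //.
  - move=> z z1; have [a fa] := cdiff_pt (H_analytic g) e1 z1.
    by exists a; apply: der_ext fa => s; rewrite gE.
  - by rewrite scale0r pt0.
rewrite ger0_norm ?sqrtr_ge0// -(ler_sqr (x := Num.sqrt _)) ?nnegrE ?sqrtr_ge0 ?en_ge0//.
rewrite sqr_sqrtr ?subr_ge0 ?(overlap_le1 evk ipk Knz)// overlap0 nx.
rewrite lerBlDr -lerBlDl -/c => cc.
have : ln c <= ln (c `^ alpha) by rewrite ler_ln ?posrE ?powR_gt0.
by rewrite ln_powR ler_nMl.
Qed.

(** If the ball is a point then every exponent does. *)
Lemma necessity : exists alpha : R, 0 < alpha <= 1 /\
  forall z w, K z w = 1 / cpow (1 - inner (val z) (val w)) alpha.
Proof.
have [[x xo]|triv] := pselect (exists x : B, x <> o); last first.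
  have to z : z = o by apply: contrapT => zo; apply: triv; exists z.
  exists 1; split=> [|z w]; first by rewrite ltr01 lexx.
  by rewrite (to z) (to w) Knorm /= inner0l subr0 cpow1 divr1.
have x0 : en (val x) != 0.
  by apply/eqP => x0; apply: xo; apply: uball_inj; exact: en_eq0.
have [|alpha Ka] := @kernel_modulus ((en (val x))^-1%:C *: val x).
  by rewrite enZ normc_real ger0_norm ?invr_ge0 ?en_ge0// mulVf.
have KE := kernel_power Ka.
by exists alpha; split=> //; exact: exponent_bounds xo KE.
Qed.

End Necessity.

(** * The characterization *)

Theorem corollary4p4 (R : realType) (d : option nat)
    (H : rkhs R (uball R d)) (K : uball R d -> uball R d -> R[i])
    (H_analytic : forall f : H, holomorphic (ev f : uball R d -> R[i]))
    (H_kernel : is_kernel H K)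
    (H_normalized : normalized_at K (origin R d)) :
  (irreducible K /\ complete_nevanlinna_pick H K /\
   forall phi : uball R d -> uball R d,
     is_automorphism phi -> isometric_composition H phi)
  <->
  (exists alpha : R, 0 < alpha <= 1 /\
     forall z w : uball R d,
       K z w = 1 / cpow (1 - inner (val z) (val w)) alpha).
Proof.
split=> [[Kirr [cnp inv]]|[alpha [alpha01 KE]]].
  have [k [evk ipk]] := kernel_functions H_kernel.
  exact: (necessity H_analytic evk ipk H_normalized Kirr cnp inv).
split; first exact: (irreducible_of_power alpha01 KE).
split; first exact: (cnp_of_power alpha01 H_kernel KE).
by move=> phi; exact: (invariant_of_power H_kernel KE).
Qed.
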